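(* Let $H$ be a Hilbert space, $\mathcal{B}:=\mathcal{B}(H)$, $\mathcal{K}:=\mathcal{K}(H)$ the ideal of compact operators, and $\mathcal{L}^1=\mathcal{L}^1(H)$ the ideal of trace-class operators. (1) For any symmetrically-normed ideal $(\mathcal{I},|||\cdot|||)$, the left and bilateral multiplier topologies $\mu_{\mathcal{I}}$ and $\mu^*_{\mathcal{I}}$ on $\mathcal{B}$ have the same bounded sets, namely the norm-bounded ones. (2) If $\mathcal{I}$ is additionally approximable, in the sense that the finite-rank operators are $|||\cdot|||$-dense in $\mathcal{I}$, then $\mu_{\mathcal{I}}$ coincides on bounded sets with the $\sigma$-strong topology $\mu_2$, and similarly $\mu^*_{\mathcal{I}}$ coincides on bounded sets with the $\sigma$-strong$^*$ topology $\mu^*_2$. (3) If $\mathcal{I}$ is approximable and also satisfies $\mathcal{L}^1=\mathcal{I}\,(\mathcal{L}^1:\mathcal{I})$ for the ideal quotient $(\mathcal{L}^1:\mathcal{I}):=\{x\in\mathcal{B}\mid x\mathcal{I}\subseteq\mathcal{L}^1\}$, then $\mu_{\mathcal{I}}$ and $\mu_{\mathcal{I}}^*$ have the same continuous dual $\mathcal{L}^1\cong\mathcal{B}_*$ (i.e. their continuous linear functionals are precisely the weak$^*$-continuous functionals $T\mapsto \mathrm{tr}(TX)$, $X\in\mathcal{L}^1$). (4) Consider two approximable symmetrically-normed ideals $\mathcal{I},\mathcal{J}$ contained in $\mathcal{K}$ such that $\mathcal{I}\subseteq\mathcal{J}\,(\mathcal{I}:\mathcal{J})$. Then $\mu_{\mathcal{I}}$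 is weaker than (coarser than or equal to) $\mu_{\mathcal{J}}$, and similarly $\mu^*_{\mathcal{I}}$ is weaker than $\mu^*_{\mathcal{J}}$. (5) For two approximable symmetrically-normed ideals $\mathcal{I},\mathcal{J}$ contained in $\mathcal{K}$ with $\mathcal{I}\not\subseteq\mathcal{J}$, the left-multiplier topology $\mu_{\mathcal{I}}$ is not dominated by the bilateral-multiplier topology $\mu^*_{\mathcal{J}}$ (that is, $\mu_{\mathcal{I}}$ is not coarser than or equal to $\mu^*_{\mathcal{J}}$).
   Context: $\|\cdot\|$ is the operator norm on $\mathcal{B}$. A symmetric norm on a two-sided ideal $\mathcal{I}\trianglelefteq\mathcal{B}$ is a norm $|||\cdot|||$ on $\mathcal{I}$ with $|||AXB|||\le\|A\|\,|||X|||\,\|B\|$ for all $X\in\mathcal{I}$, $A,B\in\mathcal{B}$, and $|||X|||=\|X\|$ for all rank-one $X\in\mathcal{I}$. A symmetrically-normed ideal (sn-ideal) is an ideal complete with respect to a symmetric norm. Convention: sn-ideals are nonzero and contained in $\mathcal{K}$, hence they contain all finite-rank operators. For an sn-ideal $(\mathcal{I},|||\cdot|||_{\mathcal{I}})$, the left multiplier topology $\mu_{\mathcal{I}}$ is the locally convex topology on $\mathcal{B}$ induced by the seminorms $x\mapsto|||xy|||_{\mathcal{I}}$, $y\in\mathcal{I}$; the bilateral multiplier topology $\mu^*_{\mathcal{I}}$ is induced by all seminorms $x\mapsto|||xy|||_{\mathcal{I}}$ and $x\mapsto|||yx|||_{\mathcal{I}}$, $y\in\mathcal{I}$. $\mu_2$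 and $\mu_2^*$ denote these topologies for $\mathcal{I}=\mathcal{L}^2(H)$, the Hilbert-Schmidt operators with the Hilbert-Schmidt norm. For ideals $\mathcal{I},\mathcal{J}\trianglelefteq\mathcal{B}$, $(\mathcal{I}:\mathcal{J}):=\{x\in\mathcal{B}\mid x\mathcal{J}\subseteq\mathcal{I}\}=\{x\in\mathcal{B}\mid\mathcal{J}x\subseteq\mathcal{I}\}$, and the product of two ideals is the set of finite sums of products of their elements. A set in a locally convex space is bounded if it is absorbed by every neighborhood of the origin. *)

(* Defs.v *)
From HB Require Import structures.
From mathcomp Require Import all_boot all_order all_algebra.
From mathcomp Require Import complex.
From mathcomp Require Import all_classical all_reals all_analysis.

Set Implicit Arguments.
Unset Strict Implicit.
Unset Printing Implicit Defensive.

Import Order.TTheory GRing.Theory Num.Theory.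
Import numFieldNormedType.Exports.

Local Open Scope classical_set_scope.
Local Open Scope ring_scope.
Local Open Scope complex_scope.

HB.mixin Record isHilbert (R : realType) H & CompleteNormedModule R[i] H := {
  inner : H -> H -> R[i];
  innerDl : forall x y z : H, inner (x + y) z = inner x z + inner y z;
  innerZl : forall (a : R[i]) (x y : H), inner (a *: x) y = a * inner x y;
  innerC : forall x y : H, inner y x = (inner x y)^*%C;
  innerxx : forall x : H, inner x x = `|x| ^+ 2
}.

#[short(type="hilbertType")]
HB.structure Definition Hilbert (R : realType) :=
  {H of isHilbert R H & CompleteNormedModule R[i] H}.

(* `|x| is a complex number lying on the nonnegative real axis; rnorm is the
   same norm with values in R. *)
Definition rnorm (R : realType) (V : normedZmodType R[i]) (x : V) : R :=
  complex.Re `|x|.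

Section rnorm.
Context {R : realType}.

Lemma rnormE (V : normedZmodType R[i]) (x : V) : (rnorm x)%:C = `|x|.
Proof.
by rewrite /rnorm RRe_real// realE normr_ge0.
Qed.

Lemma rnorm_ge0 (V : normedZmodType R[i]) (x : V) : 0 <= rnorm x.
Proof. by rewrite -lecR rnormE; exact: normr_ge0. Qed.

Lemma rnormD (V : normedZmodType R[i]) (x y : V) :
  rnorm (x + y) <= rnorm x + rnorm y.
Proof. by rewrite -lecR raddfD /= !rnormE ler_normD. Qed.

Lemma rnormZ (V : normedModType R[i]) (a : R[i]) (x : V) :
  rnorm (a *: x) = rnorm a * rnorm x.
Proof.
by apply: complexI; rewrite rmorphM /= !rnormE normrZ.
Qed.

Lemma rnorm0 (V : normedZmodType R[i]) : rnorm (0 : V) = 0.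
Proof. by rewrite /rnorm normr0. Qed.

End rnorm.

Section bounded_operators.
Context {R : realType} (H : hilbertType R).

Definition bounded_linear (T : H -> H) : Prop :=
  linear T /\ exists M : R, forall x, rnorm (T x) <= M * rnorm x.

Definition bounded_linear_pred : pred (H -> H) :=
  fun T => `[< bounded_linear T >].

Record bop := Bop { bop_fun :> H -> H ; _ : bounded_linear_pred bop_fun }.

HB.instance Definition _ := [isSub for bop_fun].
HB.instance Definition _ := [Choice of bop by <:].

Lemma bounded_linear_submod_closed : submod_closed bounded_linear_pred.
Proof.
split=> [|a S T /asboolP[Sl [M SM]] /asboolP[Tl [N TN]]]; apply/asboolP.
  by split=> [b u v|]; [rewrite scaler0 addr0|exists 0 => x; rewrite rnorm0 mul0r].
split=> [b u v|].
  have E x : (a *: S + T) x = a *: S x + T x by [].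
  rewrite !E Sl Tl !scalerDr !scalerA [a * b]mulrC -!addrA; congr (_ + _).
  by rewrite addrCA.
exists (rnorm a * M + N) => x; rewrite fctE /= (le_trans (rnormD _ _))//.
rewrite mulrDl lerD// rnormZ -mulrA ler_wpM2l//; exact: rnorm_ge0.
Qed.

HB.instance Definition _ := GRing.isSubmodClosed.Build R[i] (H -> H)
  bounded_linear_pred (GRing.submod_closed_semi bounded_linear_submod_closed).
HB.instance Definition _ := [SubChoice_isSubLmodule of bop by <:].

Lemma bopP (S T : bop) : (forall x, S x = T x) -> S = T.
Proof. by move=> ST; apply/val_inj/funext. Qed.

Lemma bounded_linear_id : bounded_linear_pred idfun.
Proof. by apply/asboolP; split=> //; exists 1 => x; rewrite mul1r. Qed.

Lemma bounded_linear_comp (S T : bop) : bounded_linear_pred (S \o T).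
Proof.
case: S T => S /= /asboolP[Sl [M SM]] [T /= /asboolP[Tl [N TN]]].
apply/asboolP; split=> [b u v|]; first by rewrite /= Tl Sl.
exists (`|M| * N) => x /=; rewrite (le_trans (SM _))//.
rewrite (@le_trans _ _ (`|M| * rnorm (T x)))//.
  by rewrite ler_wpM2r ?rnorm_ge0// ler_norm.
by rewrite -mulrA ler_wpM2l.
Qed.

Lemma bop_comp_mulDr (S T U : bop) :
  Bop (bounded_linear_comp S (T + U)) =
  Bop (bounded_linear_comp S T) + Bop (bounded_linear_comp S U).
Proof.
apply: bopP => x; case: S => S /[dup] /asboolP[Sl _] ? /=.
by have /= := Sl 1 (T x) (U x); rewrite !scale1r.
Qed.

Lemma bop_comp_mulA : associative (fun S T => Bop (bounded_linear_comp S T)).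
Proof. by move=> S T U; apply: bopP. Qed.

Lemma bop_comp_mul1l :
  left_id (Bop bounded_linear_id) (fun S T => Bop (bounded_linear_comp S T)).
Proof. by move=> T; apply: bopP. Qed.

Lemma bop_comp_mul1r :
  right_id (Bop bounded_linear_id) (fun S T => Bop (bounded_linear_comp S T)).
Proof. by move=> T; apply: bopP. Qed.

Lemma bop_comp_mulDl :
  left_distributive (fun S T => Bop (bounded_linear_comp S T)) +%R.
Proof. by move=> S T U; apply: bopP. Qed.

(* The product of operators is composition: [(S * T) x = S (T x)]. *)
HB.instance Definition _ := GRing.Zmodule_isPzRing.Build (bop : Type)
  bop_comp_mulA bop_comp_mul1l bop_comp_mul1r bop_comp_mulDl bop_comp_mulDr.

End bounded_operators.

Section operators.
Context {R : realType} {H : hilbertType R}.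
Implicit Types (S T P X : bop H) (E : set H).

Definition opnorm T : R := sup [set rnorm (T x) | x in [set x | rnorm x <= 1]].

Definition norm_bounded (A : set (bop H)) : Prop :=
  exists M : R, forall T, A T -> opnorm T <= M.

Definition compact_op T : Prop := precompact (T @` [set x | rnorm x <= 1]).

Definition rank_le (n : nat) T : Prop :=
  exists v : 'I_n -> H, forall x, exists c : 'I_n -> R[i],
    T x = \sum_i c i *: v i.

Definition finite_rank T : Prop := exists n, rank_le n T.

Definition rank_one T : Prop := rank_le 1 T /\ T != 0.

Definition is_adjoint T S : Prop := forall x y, inner (T x) y = inner x (S y).

(* In the order of R[i], [0 <= z] says that z is real and nonnegative. *)
Definition positive_op T : Prop := forall x, 0 <= inner (T x) x.

(* P = |T|, i.e. P is the positive square root of T^* T. *)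
Definition is_absolute_value T P : Prop :=
  positive_op P /\ exists2 S, is_adjoint T S & P * P = S * T.

Definition orthonormal_set E : Prop :=
  (forall e, E e -> inner e e = 1) /\
  (forall e f, E e -> E f -> e <> f -> inner e f = 0).

(* The last condition says that E is a maximal orthonormal set, equivalently (by
   completeness of H) that its span is dense. *)
Definition orthonormal_basis E : Prop :=
  orthonormal_set E /\ forall x, (forall e, E e -> inner x e = 0) -> x = 0.

Lemma exists_orthonormal_basis : exists E, orthonormal_basis E.
Proof.
have [F FP Ftot|E [Eo Emax]] := @Zorn_bigcup H orthonormal_set.
  split=> [e [A FA Ae]|e f [A FA Ae] [B FB Bf] ef]; first exact: (FP _ FA).1.
  have [AB|BA] := Ftot _ _ FA FB.
    by apply: (FP _ FB).2 => //; exact: AB.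
  by apply: (FP _ FA).2 => //; exact: BA.
exists E; split=> // x xE; apply/eqP/negPn/negP => x0.
have nx0 : `|x| != 0 by rewrite normr_eq0.
pose u := `|x|^-1 *: x.
have uE e : E e -> inner u e = 0 by move=> Ee; rewrite innerZl xE ?mulr0.
have Eu e : E e -> inner e u = 0.
  by move=> Ee; rewrite innerC uE// raddf0.
have u1 : inner u u = 1.
  by rewrite innerxx normrZ normfV normr_id mulVf// expr1n.
apply: (Emax (E `|` [set u])).
  split=> [e|]; first by left.
  move=> /(_ u (or_intror erefl)) /uE; rewrite u1 => /eqP.
  by rewrite oner_eq0.
split=> [e [Ee|->//]|e f [Ee|->] [Ef|->] //]; first exact: Eo.1.
- exact: Eo.2.
- by move=> _; exact: Eu.
- by move=> _; exact: uE.
Qed.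

(* A fixed orthonormal basis; the quantities defined with it below do not depend
   on the choice. *)
Definition onb : set H := projT1 (cid exists_orthonormal_basis).

Definition trace_class T : Prop :=
  exists2 P, is_absolute_value T P &
    (\esum_(e in onb) (complex.Re (inner (P e) e))%:E < +oo)%E.

(* The net of finite subsets of onb, directed by inclusion. *)
Definition finite_subsets_filter : set_system (set H) :=
  filter_from (fsets onb) (fun F0 => [set F | fsets onb F /\ F0 `<=` F]).

Definition trace T : R[i] :=
  lim ((fun F => \sum_(e \in F) inner (T e) e : R[i]^o)
       @ finite_subsets_filter).

Definition hs_sqnorm T : \bar R := (\esum_(e in onb) (rnorm (T e) ^+ 2)%:E)%E.

Definition hilbert_schmidt : set (bop H) := [set T | (hs_sqnorm T < +oo)%E].

Definition hs_norm T : R := Num.sqrt (fine (hs_sqnorm T)).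

End operators.

Section ideals.
Context {R : realType} {H : hilbertType R}.
Implicit Types (I J : set (bop H)) (N : bop H -> R).

Definition two_sided_ideal I : Prop :=
  [/\ I 0, forall X Y, I X -> I Y -> I (X + Y) &
      forall A X B, I X -> I (A * X * B)].

(* |||.||| is represented by a function on all bounded operators, of which only
   the values on I matter. *)
Definition norm_on I N : Prop :=
  [/\ forall X Y, I X -> I Y -> N (X + Y) <= N X + N Y,
      forall (a : R[i]) X, I X -> N (a *: X) = rnorm a * N X &
      forall X, I X -> N X = 0 -> X = 0].

Definition symmetric_norm I N : Prop :=
  [/\ norm_on I N,
      forall A X B, I X -> N (A * X * B) <= opnorm A * N X * opnorm B &
      forall X, I X -> rank_one X -> N X = opnorm X].

Definition complete_for I N : Prop :=
  forall u : nat -> bop H, (forall n, I (u n)) ->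
    (forall e : R, 0 < e -> exists n0, forall m n, (n0 <= m)%N -> (n0 <= n)%N ->
       N (u m - u n) < e) ->
    exists2 X, I X & (fun n => N (u n - X)) @ \oo --> (0 : R).

Record sn_ideal I N : Prop := SnIdeal {
  sn_ideal_two_sided : two_sided_ideal I ;
  sn_ideal_norm : symmetric_norm I N ;
  sn_ideal_complete : complete_for I N ;
  sn_ideal_neq0 : exists2 X, I X & X != 0 ;
  sn_ideal_compact : forall X, I X -> compact_op X
}.

Definition approximable I N : Prop :=
  forall X, I X -> forall e : R, 0 < e ->
    exists2 F, I F /\ finite_rank F & N (X - F) < e.

Definition ideal_quotient I J : set (bop H) :=
  [set X | forall Y, J Y -> I (X * Y)].

Definition ideal_product I J : set (bop H) :=
  [set X | exists n (a b : 'I_n -> bop H),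
     [/\ forall i, I (a i), forall i, J (b i) & X = \sum_i a i * b i]].

End ideals.

(* E with the topology having as subbase the balls {y | p (y - x) < e} for p in
   the family P, x in E and e > 0. *)
Definition seminorm_space (R : realType) (E : lmodType R[i])
  (P : set (E -> R)) : Type := E.

Section seminorm_topology.
Context {R : realType} {E : lmodType R[i]} (P : set (E -> R)).

Definition seminorm_balls : set (set E) :=
  [set B | exists p x (e : R), [/\ P p, 0 < e & B = [set y | p (y - x) < e]]].

HB.instance Definition _ := GRing.Lmodule.on (seminorm_space P).
HB.instance Definition _ :=
  isSubBaseTopological.Build (seminorm_space P) seminorm_balls id.

End seminorm_topology.

Section locally_convex.
Context {R : realType}.

Definition absorbs (E : lmodType R[i]) (U A : set E) : Prop :=
  exists2 r : R, 0 < r &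
    forall t : R[i], r <= rnorm t -> A `<=` [set t *: u | u in U].

Definition lc_bounded (E : preTopologicalLmodType R[i]) (A : set E) : Prop :=
  forall U, nbhs 0 U -> absorbs U A.

Definition continuous_dual (E : preTopologicalLmodType R[i]) :
    set (E -> R[i]) :=
  [set f | scalar f /\ continuous (f : E -> R[i]^o)].

End locally_convex.

Arguments lc_bounded {R} E A.
Arguments continuous_dual {R} E.

(* The topologies t1 and t2 on T, given by their open sets, induce the same
   topology on the subset S. *)
Definition coincide_on (T : Type) (t1 t2 : set (set T)) (S : set T) : Prop :=
  [set S `&` U | U in t1] = [set S `&` U | U in t2].

Section multiplier_topologies.
Context {R : realType} {H : hilbertType R}.
Implicit Types (I : set (bop H)) (N : bop H -> R).

Definition left_seminorms I N : set (bop H -> R) :=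
  [set fun x => N (x * y) | y in I].

Definition right_seminorms I N : set (bop H -> R) :=
  [set fun x => N (y * x) | y in I].

Definition mu I N : preTopologicalLmodType R[i] :=
  seminorm_space (left_seminorms I N).

Definition mu_star I N : preTopologicalLmodType R[i] :=
  seminorm_space (left_seminorms I N `|` right_seminorms I N).

Definition opens_mu I N : set (set (bop H)) := @open (mu I N).

Definition opens_mu_star I N : set (set (bop H)) := @open (mu_star I N).

Definition trace_functionals : set (bop H -> R[i]) :=
  [set fun T => trace (T * X) | X in trace_class].

End multiplier_topologies.

(* Main.v *)
(* The topologies are compared through rank-one operators, on which all symmetric
   norms agree, and approximability carries the comparison over to all bounded sets;
   parts (1) and (2) follow, the first one with the uniform boundedness principle.

   Two factorizations make the ideals manageable. By polar decomposition the adjoint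
   of X has the form A X B, so ideals are selfadjoint and left and right ideal
   quotients agree. By Douglas' lemma an operator whose adjoint is bounded by the
   adjoints of finitely many z_i belongs to the ideal generated by the z_i; applied
   to a seminorm estimate on rank-one operators this gives (5).

   For (3) and (4), multiplication by an element of a quotient maps one ideal to
   another, and it is bounded by the uniform boundedness principle on the complete
   ideal, applied to finite-rank truncations. *)

Require Import Defs.
From HB Require Import structures.
From mathcomp Require Import all_boot all_order all_algebra.
From mathcomp Require Import complex finmap.
From mathcomp Require Import all_classical all_reals all_analysis.
From mathcomp Require Import ring lra.

Set Implicit Arguments.
Unset Strict Implicit.
Unset Printing Implicit Defensive.

Import Order.TTheory GRing.Theory Num.Theory.
Import numFieldNormedType.Exports.

Local Open Scope classical_set_scope.
Local Open Scope ring_scope.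
Local Open Scope complex_scope.

(** * Hilbert space geometry *)

(** The Hilbert space facts come from one variational lemma, [riesz_range]: a functional g with
    |g|^2 <= c * sum_j |A_j|^2 is v |-> sum_j <A_j v, z_j>, with z in the closure of the joint range
    of the A_j. For A the identity it is the Riesz representation; in general it is the heart of
    Douglas' lemma, from which adjoints and the contractions in the polar decomposition are read off
    without closed subspaces or partial isometries. H may be nonseparable, so basis truncations form
    a net over the finite subsets of [onb]. Uniform boundedness tolerates this: of each truncation
    it asks only for some bound, however bad, and the number of basis vectors gives one. In (3) the
    trace class is not known in advance to be an ideal, nor the trace to be linear. The hypothesis
    on L^1 settles the first; the second follows from limits of finite sums, since the diagonal of a
    trace-class operator is absolutely summable. *)

Section rnorm_extra.
Context {R : realType}.
Local Notation C := R[i].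
Implicit Types (V : normedModType C).

Lemma rnormN (V : normedZmodType C) (x : V) : rnorm (- x) = rnorm x.
Proof. by rewrite /rnorm normrN. Qed.

Lemma rnormB (V : normedZmodType C) (x y : V) : rnorm (x - y) = rnorm (y - x).
Proof. by rewrite /rnorm distrC. Qed.

Lemma rnorm_eq0 (V : normedZmodType C) (x : V) : rnorm x = 0 -> x = 0.
Proof.
by move=> x0; apply/eqP; rewrite -normr_eq0 -rnormE x0.
Qed.

Lemma rnormM (a b : C) : rnorm (a * b) = rnorm a * rnorm b.
Proof. by apply: complexI; rewrite rmorphM /= !rnormE normrM. Qed.

Lemma rnorm_real (r : R) : rnorm (r%:C : C) = `|r|.
Proof. by rewrite /rnorm normc_def /= expr0n addr0 sqrtr_sqr. Qed.

Lemma rnormV (a : C) : rnorm a^-1 = (rnorm a)^-1.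
Proof. by apply: complexI; rewrite rnormE normfV fmorphV /= rnormE. Qed.

Lemma rnorm_conj (a : C) : rnorm (a^*%C) = rnorm a.
Proof. by rewrite /rnorm normcJ. Qed.

Lemma ler_Re_rnorm (a : C) : complex.Re a <= rnorm a.
Proof. by rewrite (le_trans (ler_norm _))// -lecR rnormE normc_ge_Re. Qed.

Lemma rnorm_sum (V : normedZmodType C) (I : Type) (s : seq I) (P : pred I)
  (f : I -> V) : rnorm (\sum_(i <- s | P i) f i) <= \sum_(i <- s | P i) rnorm (f i).
Proof.
elim/big_rec2: _ => [|i y x _ h]; first by rewrite rnorm0.
by rewrite (le_trans (rnormD _ _))// lerD2l.
Qed.

Lemma rnormZr (V : normedModType C) (r : R) (x : V) :
  rnorm (r%:C *: x) = `|r| * rnorm x.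
Proof. by rewrite rnormZ rnorm_real. Qed.

Lemma sqr_rnorm (a : C) : (rnorm a ^+ 2)%:C = a * a^*%C.
Proof. by rewrite rmorphXn /= rnormE sqr_normc. Qed.

Lemma ReM_real (r : R) (a : C) : complex.Re (r%:C * a) = r * complex.Re a.
Proof. by case: a => a b; simpc. Qed.

Lemma ReD (a b : C) : complex.Re (a + b) = complex.Re a + complex.Re b.
Proof. by case: a => ? ?; case: b. Qed.

Lemma ReN (a : C) : complex.Re (- a) = - complex.Re a.
Proof. by case: a. Qed.

Lemma ReB (a b : C) : complex.Re (a - b) = complex.Re a - complex.Re b.
Proof. by rewrite ReD ReN. Qed.

Lemma Re_sum (I : Type) (s : seq I) (P : pred I) (f : I -> C) :
  complex.Re (\sum_(i <- s | P i) f i) = \sum_(i <- s | P i) complex.Re (f i).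
Proof. by elim/big_rec2: _ => [//|i x y _ <-]; rewrite ReD. Qed.

End rnorm_extra.

Section inner_product.
Context {R : realType} {H : hilbertType R}.
Local Notation C := R[i].
Implicit Types (x y z : H) (a : C).

Lemma innerDr x y z : inner x (y + z) = inner x y + inner x z.
Proof. by rewrite innerC innerDl rmorphD /= -!innerC. Qed.

Lemma innerZr a x y : inner x (a *: y) = a^*%C * inner x y.
Proof. by rewrite innerC innerZl rmorphM /= -innerC. Qed.

Lemma innerNl x y : inner (- x) y = - inner x y.
Proof. by rewrite -scaleN1r innerZl mulN1r. Qed.

Lemma innerNr x y : inner x (- y) = - inner x y.
Proof. by rewrite innerC innerNl rmorphN /= -innerC. Qed.

Lemma innerBl x y z : inner (x - y) z = inner x z - inner y z.
Proof. by rewrite innerDl innerNl. Qed.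

Lemma innerBr x y z : inner x (y - z) = inner x y - inner x z.
Proof. by rewrite innerDr innerNr. Qed.

Lemma inner0l x : inner 0 x = 0.
Proof. by rewrite -(scale0r (0 : H)) innerZl mul0r. Qed.

Lemma inner0r x : inner x 0 = 0.
Proof. by rewrite innerC inner0l rmorph0. Qed.

Lemma inner_suml (I : Type) (s : seq I) (P : pred I) (f : I -> H) y :
  inner (\sum_(i <- s | P i) f i) y = \sum_(i <- s | P i) inner (f i) y.
Proof.
by elim/big_rec2: _ => [|i u v _ <-]; rewrite ?inner0l ?innerDl.
Qed.

Lemma inner_sumr (I : Type) (s : seq I) (P : pred I) (f : I -> H) y :
  inner y (\sum_(i <- s | P i) f i) = \sum_(i <- s | P i) inner y (f i).
Proof.
by elim/big_rec2: _ => [|i u v _ <-]; rewrite ?inner0r ?innerDr.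
Qed.

Lemma innerxxE x : inner x x = (rnorm x ^+ 2)%:C.
Proof. by rewrite innerxx rmorphXn /= rnormE. Qed.

Lemma rnormDsqr x y :
  rnorm (x + y) ^+ 2 = rnorm x ^+ 2 + rnorm y ^+ 2 + 2 * complex.Re (inner x y).
Proof.
have -> : rnorm (x + y) ^+ 2 = complex.Re (inner (x + y) (x + y)).
  by rewrite innerxxE.
rewrite innerDl !innerDr !innerxxE (innerC x y) /=.
by case: (inner x y) => a b /=; ring.
Qed.

Lemma parallelogram x y :
  rnorm (x + y) ^+ 2 + rnorm (x - y) ^+ 2 = 2 * rnorm x ^+ 2 + 2 * rnorm y ^+ 2.
Proof.
by rewrite !rnormDsqr innerNr rnormN raddfN /=; ring.
Qed.

Lemma inner_eq x y : (forall z, inner z x = inner z y) -> x = y.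
Proof.
move=> h; apply/eqP; rewrite -subr_eq0; apply/eqP/rnorm_eq0.
apply/eqP; rewrite -sqrf_eq0; apply/eqP/complexI.
by rewrite -innerxxE innerBr h subrr.
Qed.

End inner_product.

Section sesquilinear.
Context {R : realType} {V : lmodType R[i]}.
Local Notation C := R[i].

(* The discriminant of the nonnegative quadratic t |-> B (x - t c y) (x - t c y),
   with c = B x y, has to be nonpositive. *)
Lemma cauchy_schwarz_form (B : V -> V -> C) :
  (forall x y z, B (x + y) z = B x z + B y z) ->
  (forall a x y, B (a *: x) y = a * B x y) ->
  (forall x y, B y x = (B x y)^*%C) ->
  (forall x, 0 <= B x x) ->
  forall x y, rnorm (B x y) ^+ 2 <= complex.Re (B x x) * complex.Re (B y y).
Proof.
move=> BD BZ BC B0 x y.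
set p := complex.Re (B x x); set q := complex.Re (B y y); set c := rnorm (B x y).
have Bx z : B z z = (complex.Re (B z z))%:C by rewrite RRe_real ?realE ?B0.
have key t : 0 <= p - 2 * t * c ^+ 2 + t ^+ 2 * c ^+ 2 * q.
  have := B0 (x + ((- t)%:C * B x y) *: y).
  have BDr u v w : B u (v + w) = B u v + B u w by rewrite BC BD rmorphD /= -!BC.
  have BZr a u v : B u (a *: v) = a^*%C * B u v.
    by rewrite BC BZ rmorphM /= -BC.
  rewrite BD !BDr !BZ !BZr (BC x y) (Bx x) (Bx y) -/p -/q lecE => /andP[_].
  have : (c ^+ 2)%:C = B x y * (B x y)^*%C by exact: sqr_rnorm.
  case: (B x y) => a b [/= -> _]; congr (0 <= _); ring.
have p0 : 0 <= p by rewrite -lecR -Bx B0.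
have q0 : 0 <= q by rewrite -lecR -Bx B0.
have c0 : 0 <= c ^+ 2 by rewrite sqr_ge0.
have [q0'|q1] := eqVneq q 0.
  have [->|c1] := eqVneq (c ^+ 2) 0; first by rewrite mulr_ge0.
  (* For q = 0 the quadratic is affine in t, and at this t it equals p - 2 (p + 1) < 0. *)
  have := key ((p + 1) / c ^+ 2); rewrite q0' !mulr0 addr0.
  have -> : 2 * ((p + 1) / c ^+ 2) * c ^+ 2 = 2 * (p + 1).
    by rewrite -!mulrA mulVf ?mulr1.
  by move=> ?; lra.
rewrite -subr_ge0.
(* The right factor is [key] at its minimizer t = 1 / q. *)
have -> : p * q - c ^+ 2 = q * (p - 2 * q^-1 * c ^+ 2 + q^-1 ^+ 2 * c ^+ 2 * q).
  by field.
by rewrite mulr_ge0 ?key.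
Qed.

End sesquilinear.

Section hilbert_extra.
Context {R : realType} {H : hilbertType R}.
Local Notation C := R[i].
Implicit Types (x y z : H).

Lemma cauchy_schwarz x y : rnorm (inner x y) <= rnorm x * rnorm y.
Proof.
have := @cauchy_schwarz_form R H inner.
move=> /(_ (@innerDl _ _) (@innerZl _ _) (@innerC _ _)) h.
rewrite -(@ler_pXn2r _ 2)// ?nnegrE ?mulr_ge0 ?rnorm_ge0//.
have := h _ x y; rewrite !innerxxE /= exprMn; apply => z.
by rewrite innerxxE ler0c sqr_ge0.
Qed.


(** The distances in H take values in C, but a positive element of C is real, so real error bounds
    suffice. *)
Lemma hilbert_complete (u : nat -> H) :
  (forall e : R, 0 < e -> exists n0, forall m n, (n0 <= m)%N -> (n0 <= n)%N ->
     rnorm (u m - u n) < e) ->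
  exists l, (fun n => rnorm (u n - l)) @ \oo --> (0 : R).
Proof.
move=> uC; have ReE (e : C) : 0 < e -> e = (complex.Re e)%:C /\ 0 < complex.Re e.
  by case: e => a b; rewrite ltcE /= => /andP[/eqP -> ->].
have : cvg (u @ \oo).
  apply/cauchy_cvgP/cauchy_ballP => e /ReE[-> e0].
  have [n0 hn] := uC _ e0.
  exists (u @` [set n | (n0 <= n)%N], u @` [set n | (n0 <= n)%N]) => /=.
    by split; exists n0 => // m /= n0m; exists m.
  move=> [x y] [/= [m n0m <-] [n n0n <-]].
  by rewrite -ball_normE /= -rnormE ltcR; exact: hn.
move=> /cvg_ex[l ul]; exists l; apply/cvgrPdist_lt => e e0.
have := ul => /cvgrPdist_lt /(_ e%:C); rewrite ltcR => /(_ e0).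
apply: filterS => n /=; rewrite -rnormE ltcR.
by rewrite sub0r normrN ger0_norm ?rnorm_ge0// rnormB.
Qed.
End hilbert_extra.

Section riesz.
Context {R : realType} {H : hilbertType R} {V : lmodType R[i]} {n : nat}.
Local Notation C := R[i].
Variables (A : 'I_n -> V -> H) (g : V -> C) (c : R).
Hypothesis Al : forall j, linear (A j).
Hypothesis gl : scalar g.
Hypothesis gA : forall v, rnorm (g v) ^+ 2 <= c * \sum_j rnorm (A j v) ^+ 2.
Hypothesis c0 : 0 <= c.

Let S v := \sum_j rnorm (A j v) ^+ 2.
(** If g v = sum_j <A_j v, z_j>, then phi v = sum_j |A_j v - z_j|^2 - sum_j |z_j|^2: minimizing phi
    means approaching the unknown z from the joint range. *)
Let phi v := S v - 2 * complex.Re (g v).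

Let AD j v w : A j (v + w) = A j v + A j w.
Proof. by have := Al j 1 v w; rewrite !scale1r. Qed.

Let AZ j a v : A j (a *: v) = a *: A j v.
Proof.
have A0 : A j 0 = 0.
  by have := Al j (-1) 0 0; rewrite scaler0 addr0 scaleN1r addNr.
by have := Al j a v 0; rewrite !addr0 A0 addr0.
Qed.

Let gD v w : g (v + w) = g v + g w.
Proof. by have := gl 1 v w; rewrite scale1r mul1r. Qed.

Let gZ a v : g (a *: v) = a * g v.
Proof.
have g0 : g 0 = 0.
  by have := gl (-1) 0 0; rewrite scaler0 addr0 mulN1r addNr.
by have := gl a v 0; rewrite !addr0 g0 addr0.
Qed.

Let S0 v : 0 <= S v.
Proof. by apply: sumr_ge0 => j _; rewrite sqr_ge0. Qed.

(** Young's inequality: 2 |g v| <= 2 sqrt (c S v) <= S v + c. *)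
Let phi_ge v : - c <= phi v.
Proof.
rewrite /phi lerBrDr addrC -lerBrDr opprK.
have h : (2 * rnorm (g v)) ^+ 2 <= (S v + c) ^+ 2.
  by have := gA v; have := sqr_ge0 (S v - c); rewrite -/(S v) => ? ?; nra.
rewrite (@le_trans _ _ (2 * rnorm (g v)))//.
  by rewrite ler_pM2l ?ler_Re_rnorm.
by rewrite -(@ler_pXn2r _ 2)// nnegrE ?addr_ge0 ?mulr_ge0 ?rnorm_ge0.
Qed.

Let S_parallelogram v w : S (v + w) + S (v - w) = 2 * S v + 2 * S w.
Proof.
rewrite /S -big_split /= !big_distrr /= -big_split /=; apply: eq_bigr => j _.
by rewrite -scaleN1r !AD AZ scaleN1r parallelogram.
Qed.

Let S_half v : S (2^-1%:C *: v) = S v / 4.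
Proof.
rewrite /S mulr_suml; apply: eq_bigr => j _.
by rewrite AZ rnormZr exprMn ger0_norm ?invr_ge0// mulrC; congr (_ * _); field.
Qed.

Let m := inf (range phi).

Let has_inf_phi : has_inf (range phi).
Proof.
by split; [exists (phi 0), 0|exists (- c) => _ [v _ <-]].
Qed.

Let m_le v : m <= phi v.
Proof. by apply: ge_inf; [case: has_inf_phi|exists v]. Qed.

(** Comparing the midpoint of v and w with the infimum m in the parallelogram law shows that
    near-minimizers have close images under every A_j. *)
Let S_sub v w : S (v - w) <= 2 * (phi v - m) + 2 * (phi w - m).
Proof.
have := m_le (2^-1%:C *: (v + w)).
rewrite /phi S_half gZ gD ReM_real ReD.
have := S_parallelogram v w; lra.
Qed.

Let S_line v w (t : R) : phi (v + t%:C *: w) =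
  phi v + t ^+ 2 * S w +
  2 * t * complex.Re (\sum_j inner (A j w) (A j v) - g w).
Proof.
rewrite /phi gD gZ ReD ReM_real ReB.
suff -> : S (v + t%:C *: w) = S v + t ^+ 2 * S w +
    2 * t * complex.Re (\sum_j inner (A j w) (A j v)) by ring.
rewrite /S Re_sum !big_distrr /= -!big_split /=; apply: eq_bigr => j _.
rewrite AD AZ rnormDsqr rnormZr exprMn real_normK ?num_real//.
rewrite innerZr innerC; case: (inner (A j w) _) => a b /=; ring.
Qed.

(* z is the limit of the A v along a minimizing sequence of
   sum_j |A_j v|^2 - 2 Re (g v); it is Cauchy by the parallelogram law. *)
Lemma riesz_range : exists z : 'I_n -> H,
  [/\ forall v, g v = \sum_j inner (A j v) (z j),
      forall e : R, 0 < e -> exists v, forall j, rnorm (A j v - z j) < e &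
      \sum_j rnorm (z j) ^+ 2 <= c].
Proof.
have /choice[v_ v_m] : forall k : nat, exists v, phi v < m + k.+1%:R^-1.
  move=> k; have [_ [v _ <-] hv] := @inf_adherent _ (range phi) k.+1%:R^-1
    ltac:(by rewrite invr_gt0) has_inf_phi.
  by exists v.
have SP v : S v = \sum_j rnorm (A j v) ^+ 2 by [].
have Sj v j : rnorm (A j v) ^+ 2 <= S v.
  by rewrite SP (bigD1 j)//= lerDl sumr_ge0// => i _; rewrite sqr_ge0.
have AB j v w : A j (v - w) = A j v - A j w.
  by rewrite -scaleN1r AD AZ scaleN1r.
have inv_small (e : R) : 0 < e -> \forall k \near \oo, k.+1%:R^-1 < e.
  by move=> e0; exact: (near_infty_natSinv_lt (PosNum e0)).
have /choice[z zP] : forall j, exists l,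
    (fun k => rnorm (A j (v_ k) - l)) @ \oo --> (0 : R).
  move=> j; apply: hilbert_complete => e e0.
  have [k0 _ hk0] := inv_small (e ^+ 2 / 4) ltac:(by rewrite divr_gt0 ?exprn_gt0).
  exists k0 => k l k0k k0l; rewrite -(@ltr_pXn2r _ 2)// ?nnegrE ?rnorm_ge0 ?ltW//.
  rewrite -AB; apply: (le_lt_trans (Sj _ _)); apply: (le_lt_trans (S_sub _ _)).
  have := hk0 k k0k; have := hk0 l k0l; have := v_m k; have := v_m l; rewrite /=.
  by move: k.+1%:R^-1 l.+1%:R^-1 (phi _) (phi _) => a b p q ? ? ? ?; lra.
pose delta k := \sum_j rnorm (A j (v_ k) - z j).
have deltaj k j : rnorm (A j (v_ k) - z j) <= delta k.
  by rewrite /delta (bigD1 j)//= lerDl sumr_ge0// => i _; rewrite rnorm_ge0.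
have delta0 : delta @ \oo --> (0 : R).
  rewrite [X in _ --> X](_ : _ = \sum_(j < n) 0); last by rewrite big1.
  by apply: cvg_big => [|j _]; [exact: add_continuous|exact: zP].
have delta_small (e : R) : 0 < e -> \forall k \near \oo, delta k < e.
  move=> e0; move/cvgrPdist_lt : delta0 => /(_ _ e0).
  by apply: filterS => k; rewrite sub0r normrN => /(le_lt_trans (ler_norm _)).
have z_close e : 0 < e -> exists v, forall j, rnorm (A j v - z j) < e.
  move=> /delta_small[k _ hk]; exists (v_ k) => j.
  by rewrite (le_lt_trans (deltaj _ _))// hk/=.
(* The first variation vanishes in the limit: d is the limit of dk, half the derivative of phi at
   [v_ k] along w, and dk tends to 0. *)
have ReE w : complex.Re (\sum_j inner (A j w) (z j) - g w) = 0.
  set d := complex.Re _; apply/eqP/negPn/negP => dn0.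
  pose K := 1 + \sum_j rnorm (A j w).
  have K0 : 0 < K by rewrite ltr_pwDl// sumr_ge0// => j _; rewrite rnorm_ge0.
  have d0 : 0 < `|d| by rewrite normr_gt0.
  have d2 : 0 < (`|d| / 2) ^+ 2 / (S w + 1).
    by rewrite divr_gt0 ?exprn_gt0 ?divr_gt0// ltr_wpDl.
  near \oo => k.
  pose dk := complex.Re (\sum_j inner (A j w) (A j (v_ k)) - g w).
  (* Moving by - dk / (S w + 1) along w lowers phi by at least the left side, while [v_ k] is within
     1 / (k + 1) of the infimum. The added 1 keeps the denominator positive. *)
  have dk2 : dk ^+ 2 / (S w + 1) <= k.+1%:R^-1.
    have := m_le (v_ k + (- dk / (S w + 1))%:C *: w); rewrite S_line -/dk.
    have := v_m k; have Sw := S0 w; move: k.+1%:R^-1 (S w) Sw => a s s0.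
    have -> : dk ^+ 2 / (s + 1) = (- dk / (s + 1)) ^+ 2 * (s + 1).
      by field; rewrite gt_eqF// ltr_wpDl.
    have -> : 2 * (- dk / (s + 1)) * dk = - 2 * ((- dk / (s + 1)) ^+ 2 * (s + 1)).
      by field; rewrite gt_eqF// ltr_wpDl.
    have := sqr_ge0 (- dk / (s + 1)); move: ((- dk / (s + 1)) ^+ 2) => u.
    by nra.
  have ddk : `|d - dk| <= K * delta k.
    have -> : d - dk = complex.Re (\sum_j inner (A j w) (z j - A j (v_ k))).
      rewrite /d /dk -ReB opprB addrA subrK -sumrB; congr complex.Re.
      by apply: eq_bigr => j _; rewrite innerBr.
    apply: (@le_trans _ _ (\sum_j rnorm (A j w) * delta k)).
      apply: (@le_trans _ _ (rnorm (\sum_j inner (A j w) (z j - A j (v_ k))))).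
        by rewrite -lecR rnormE normc_ge_Re.
      apply: (le_trans (rnorm_sum _ _ _)); apply: ler_sum => j _.
      rewrite (le_trans (cauchy_schwarz _ _))// ler_wpM2l ?rnorm_ge0//.
      by rewrite rnormB.
    rewrite -mulr_suml ler_wpM2r ?lerDr//.
    by rewrite /delta sumr_ge0// => j _; rewrite rnorm_ge0.
  have hdk : `|dk| < `|d| / 2.
    rewrite -(@ltr_pXn2r _ 2)// ?nnegrE ?divr_ge0// real_normK ?num_real//.
    have : k.+1%:R^-1 < (`|d| / 2) ^+ 2 / (S w + 1).
      by near: k; exact: inv_small.
    by move=> /(le_lt_trans dk2); rewrite ltr_pM2r ?invr_gt0// ltr_wpDl.
  have : K * delta k < `|d| / 2.
    rewrite mulrC -ltr_pdivlMr//; near: k; apply: delta_small.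
    by rewrite !divr_gt0.
  by have := ler_normD (d - dk) dk; rewrite subrK; lra.
exists z; split=> //.
- move=> v; apply/eqP; rewrite eq_sym -subr_eq0 eq_complex ReE eqxx /=.
  (* The real part at 'i v is, up to sign, the imaginary part at v. *)
  have := ReE ('i *: v); rewrite gZ (eq_bigr (fun j => 'i * inner (A j v) (z j))).
    rewrite -mulr_sumr -mulrBr => /eqP; case: (_ - _) => a b /=.
    by rewrite mul0r mul1r sub0r oppr_eq0.
  by move=> j _; rewrite AZ innerZl.
- apply/ler_addgt0Pr => e e0.
  have n1 : 0 < n%:R + 1 :> R by rewrite ltr_wpDl.
  have [v hv] := z_close (Num.sqrt (e / (n%:R + 1))) ltac:(by rewrite sqrtr_gt0 divr_gt0).
  have gv : complex.Re (g v) = complex.Re (\sum_j inner (A j v) (z j)).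
    by have := ReE v; rewrite ReB; lra.
  (* Completing the square; [phi_ge] then bounds - phi v by c. *)
  have : \sum_j rnorm (z j) ^+ 2 = - phi v + \sum_j rnorm (A j v - z j) ^+ 2.
    rewrite /phi gv SP Re_sum mulr_sumr -sumrB -sumrN -big_split/=.
    by apply: eq_bigr => j _; rewrite rnormDsqr rnormN innerNr ReN; ring.
  have : \sum_j rnorm (A j v - z j) ^+ 2 <= e.
    apply: (@le_trans _ _ (\sum_(j < n) e / (n%:R + 1))).
      apply: ler_sum => j _; rewrite -[leRHS]sqr_sqrtr; last first.
        by rewrite divr_ge0 ?(ltW e0) ?(ltW n1).
      by rewrite ler_pXn2r ?nnegrE ?rnorm_ge0 ?sqrtr_ge0// ltW.
    rewrite sumr_const card_ord -(mulr_natl (_ / _)) mulrA ler_pdivrMr// mulrC.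
    by rewrite ler_pM2l// lerDl.
  by have := phi_ge v; lra.
Unshelve. all: by end_near. Qed.
End riesz.

(** * Adjoints, square roots and polar decomposition *)

Section bop_basics.
Context {R : realType} {H : hilbertType R}.
Local Notation C := R[i].
Implicit Types (S T X : bop H) (x y : H).

Lemma bop_linear T : linear T.
Proof. by case: T => T /= /asboolP[]. Qed.

Lemma bopDr T x y : T (x + y) = T x + T y.
Proof. by have := bop_linear T 1 x y; rewrite !scale1r. Qed.

Lemma bop0r T : T 0 = 0.
Proof.
by have := bop_linear T (-1) 0 0; rewrite scaler0 addr0 scaleN1r addNr.
Qed.

Lemma bopZr T a x : T (a *: x) = a *: T x.
Proof. by have := bop_linear T a x 0; rewrite !addr0 bop0r addr0. Qed.

Lemma bopNr T x : T (- x) = - T x.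
Proof. by rewrite -scaleN1r bopZr scaleN1r. Qed.

Lemma bopBr T x y : T (x - y) = T x - T y.
Proof. by rewrite bopDr bopNr. Qed.

Lemma bop_sumr T (I : Type) (s : seq I) (P : pred I) (f : I -> H) :
  T (\sum_(i <- s | P i) f i) = \sum_(i <- s | P i) T (f i).
Proof. by elim/big_rec2: _ => [|i u v _ <-]; rewrite ?bop0r ?bopDr. Qed.

Lemma bopD S T x : (S + T) x = S x + T x. Proof. by []. Qed.

Lemma bopN T x : (- T) x = - T x.
Proof. by []. Qed.

Lemma bopB S T x : (S - T) x = S x - T x. Proof. by []. Qed.

Lemma bopZ a T x : (a *: T) x = a *: T x. Proof. by []. Qed.

Lemma bopM S T x : (S * T) x = S (T x). Proof. by []. Qed.

Lemma bop1 x : (1 : bop H) x = x. Proof. by []. Qed.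

Lemma bop0 x : (0 : bop H) x = 0. Proof. by []. Qed.

Lemma bop_sum (I : Type) (s : seq I) (P : pred I) (f : I -> bop H) x :
  (\sum_(i <- s | P i) f i) x = \sum_(i <- s | P i) f i x.
Proof. by elim/big_rec2: _ => [//|i u v _ <-]; rewrite bopD. Qed.

Lemma bopZM a S T : (a *: S) * T = a *: (S * T).
Proof. exact: bopP. Qed.

Lemma bopMZ a S T : S * (a *: T) = a *: (S * T).
Proof. by apply: bopP => x; rewrite bopM !bopZ bopM bopZr. Qed.

Definition mkbop (f : H -> H) (h : bounded_linear f) : bop H := Bop (asboolT h).

Lemma opnorm_has_sup T : has_sup [set rnorm (T x) | x in [set x | rnorm x <= 1]].
Proof.
split; first by exists (rnorm (T 0)), 0 => //=; rewrite rnorm0.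
case: T => T /= /asboolP[_ [M TM]]; exists `|M| => _ [x /= x1 <-].
rewrite (le_trans (TM _))// (@le_trans _ _ (`|M| * rnorm x))//.
  by rewrite ler_wpM2r ?rnorm_ge0// ler_norm.
by rewrite ler_piMr.
Qed.

Lemma opnorm_ge0 T : 0 <= opnorm T.
Proof.
rewrite -[X in X <= _](@rnorm0 _ H) -(bop0r T).
apply: ub_le_sup; first by case: (opnorm_has_sup T).
by exists 0 => //=; rewrite rnorm0.
Qed.

Lemma le_opnorm T x : rnorm (T x) <= opnorm T * rnorm x.
Proof.
have [x0|x0] := eqVneq (rnorm x) 0.
  by rewrite (rnorm_eq0 x0) bop0r rnorm0 mulr0.
have xp : 0 < rnorm x by rewrite lt_neqAle eq_sym x0 rnorm_ge0.
rewrite -ler_pdivrMr//.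
have -> : rnorm (T x) / rnorm x = rnorm (T ((rnorm x)^-1%:C *: x)).
  by rewrite bopZr rnormZr ger0_norm ?invr_ge0 ?rnorm_ge0// mulrC.
apply: ub_le_sup; first by case: (opnorm_has_sup T).
exists ((rnorm x)^-1%:C *: x) => //=.
by rewrite rnormZr ger0_norm ?invr_ge0 ?rnorm_ge0// mulVf.
Qed.

Lemma opnorm_le T (M : R) : 0 <= M ->
  (forall x, rnorm (T x) <= M * rnorm x) -> opnorm T <= M.
Proof.
move=> M0 TM; apply: ge_sup; first by case: (opnorm_has_sup T).
by move=> _ [x /= x1 <-]; rewrite (le_trans (TM _))// ler_piMr.
Qed.

Lemma opnorm1_le : opnorm (1 : bop H) <= 1.
Proof. by apply: opnorm_le => // x; rewrite bop1 mul1r. Qed.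

Lemma opnormD S T : opnorm (S + T) <= opnorm S + opnorm T.
Proof.
apply: opnorm_le => [|x]; first by rewrite addr_ge0 ?opnorm_ge0.
by rewrite bopD (le_trans (rnormD _ _))// mulrDl lerD ?le_opnorm.
Qed.

Lemma opnormM S T : opnorm (S * T) <= opnorm S * opnorm T.
Proof.
apply: opnorm_le => [|x]; first by rewrite mulr_ge0 ?opnorm_ge0.
rewrite bopM (le_trans (le_opnorm _ _))// -mulrA ler_wpM2l ?opnorm_ge0//.
exact: le_opnorm.
Qed.

Lemma opnormN T : opnorm (- T) = opnorm T.
Proof.
suff h X : opnorm (- X) <= opnorm X.
  by apply/eqP; rewrite eq_le h -{1}(opprK T) h.
apply: opnorm_le => [|x]; first exact: opnorm_ge0.
by rewrite bopN rnormN le_opnorm.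
Qed.

End bop_basics.

Section douglas.
Context {R : realType} {H : hilbertType R}.
Local Notation C := R[i].
Implicit Types (S T X : bop H) (x y : H).

(* Douglas' range inclusion lemma for several operators: X^* = sum_j Z_j^* W_j. *)
Lemma douglas n X (Z : 'I_n -> bop H) (c : R) : 0 <= c ->
  (forall x, rnorm (X x) ^+ 2 <= c * \sum_j rnorm (Z j x) ^+ 2) ->
  exists2 W : 'I_n -> bop H,
    forall x y, inner (X x) y = \sum_j inner (Z j x) (W j y) &
    forall j y, rnorm (W j y) <= Num.sqrt c * rnorm y.
Proof.
move=> c0 XZ; pose clos (z : 'I_n -> H) :=
  forall e : R, 0 < e -> exists v, forall j, rnorm (Z j v - z j) < e.
have /choice[w wP] : forall y, exists z, [/\
    forall v, inner (X v) y = \sum_j inner (Z j v) (z j),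
    clos z & \sum_j rnorm (z j) ^+ 2 <= c * rnorm y ^+ 2].
  move=> y; apply: riesz_range => [j|a u v|v|]; first exact: bop_linear.
  - by rewrite bopDr bopZr innerDl innerZl.
  - rewrite mulrAC; apply: (@le_trans _ _ ((rnorm (X v) * rnorm y) ^+ 2)).
      by rewrite ler_pXn2r ?nnegrE ?mulr_ge0 ?rnorm_ge0// cauchy_schwarz.
    by rewrite exprMn ler_wpM2r ?sqr_ge0.
  - by rewrite mulr_ge0 ?sqr_ge0.
(* A tuple in the closure of the joint range that is orthogonal to this range vanishes. So the tuple
   chosen for y is unique, which is what makes w linear in y. *)
have uniq (u : 'I_n -> H) : clos u ->
    (forall v, \sum_j inner (Z j v) (u j) = 0) -> forall j, u j = 0.
  move=> uc u0; pose K := \sum_j rnorm (u j).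
  have K0 : 0 <= K by apply: sumr_ge0 => j _; exact: rnorm_ge0.
  have : \sum_j rnorm (u j) ^+ 2 <= 0.
    apply/ler_addgt0Pr => e e0; rewrite add0r.
    have [v hv] := uc (e / (K + 1)) ltac:(by rewrite divr_gt0// ltr_wpDl).
    have -> : \sum_j rnorm (u j) ^+ 2 = complex.Re (\sum_j inner (u j - Z j v) (u j)).
      under [in RHS]eq_bigr do rewrite innerBl.
      rewrite sumrB u0 subr0 Re_sum; apply: eq_bigr => j _.
      by rewrite innerxxE.
    apply: (le_trans (ler_Re_rnorm _)); apply: (le_trans (rnorm_sum _ _ _)).
    apply: (@le_trans _ _ (\sum_j e / (K + 1) * rnorm (u j))).
      apply: ler_sum => j _; rewrite (le_trans (cauchy_schwarz _ _))//.
      by rewrite ler_wpM2r ?rnorm_ge0// rnormB ltW.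
    rewrite -mulr_sumr -/K -mulrA ger_pMr// mulrC ler_pdivrMr ?mul1r ?lerDl//.
    by rewrite ltr_wpDl.
  move=> h j; apply: rnorm_eq0; apply/eqP; rewrite -sqrf_eq0 eq_le sqr_ge0 andbT.
  rewrite (le_trans _ h)// (bigD1 j)//= lerDl sumr_ge0// => i _.
  exact: sqr_ge0.
have wl j : linear (w ^~ j).
  move=> a y y'; apply/eqP; rewrite -subr_eq0; apply/eqP.
  move: j; apply: uniq.
    move=> e e0; pose d := e / (rnorm a + 2).
    have a2 : 0 < rnorm a + 2 by rewrite ltr_wpDl ?rnorm_ge0.
    have d0 : 0 < d by rewrite divr_gt0.
    have [_ /(_ _ d0)[u1 h1] _] := wP (a *: y + y').
    have [_ /(_ _ d0)[u2 h2] _] := wP y.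
    have [_ /(_ _ d0)[u3 h3] _] := wP y'.
    exists (u1 - (a *: u2 + u3)) => j.
    rewrite bopBr bopDr bopZr.
    have -> : Z j u1 - (a *: Z j u2 + Z j u3) -
        (w (a *: y + y') j - (a *: w y j + w y' j)) =
        (Z j u1 - w (a *: y + y') j) - (a *: (Z j u2 - w y j) + (Z j u3 - w y' j)).
      rewrite scalerBr [in RHS]addrACA -opprD !opprB addrACA [RHS]addrACA.
      by congr (_ + _); rewrite addrC.
    rewrite (le_lt_trans (rnormD _ _))// rnormN.
    have : rnorm (a *: (Z j u2 - w y j) + (Z j u3 - w y' j)) <= rnorm a * d + d.
      rewrite (le_trans (rnormD _ _))// lerD// ?(ltW (h3 j))// rnormZ.
      by rewrite ler_wpM2l ?rnorm_ge0// ltW.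
    have -> : e = rnorm a * d + d + d.
      by rewrite /d; field; rewrite gt_eqF.
    by have := h1 j; lra.
  move=> v; under eq_bigr do rewrite innerBr innerDr innerZr.
  rewrite sumrB big_split/= -mulr_sumr.
  have [<- _ _] := wP (a *: y + y').
  have [<- _ _] := wP y.
  have [<- _ _] := wP y'.
  by rewrite innerDr innerZr subrr.
have wb j y : rnorm (w y j) <= Num.sqrt c * rnorm y.
  rewrite -(@ler_pXn2r _ 2)// ?nnegrE ?mulr_ge0 ?rnorm_ge0 ?sqrtr_ge0//.
  rewrite exprMn sqr_sqrtr//; have [_ _] := wP y; apply: le_trans.
  rewrite (bigD1 j)//= lerDl sumr_ge0// => i _; exact: sqr_ge0.
exists (fun j => mkbop (conj (wl j) (ex_intro _ _ (wb j)))) => //= x y.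
by have [] := wP y.
Qed.

(** [douglas] with the single operator 1 as Z: the factor that it returns is the adjoint. *)
Lemma adjoint_ex T : exists S, is_adjoint T S.
Proof.
have [|W WP _] := @douglas 1 T (fun=> 1) (opnorm T ^+ 2) (sqr_ge0 _).
  move=> x; rewrite big_ord1 -exprMn ler_pXn2r ?nnegrE ?mulr_ge0 ?opnorm_ge0 ?rnorm_ge0//.
  exact: le_opnorm.
by exists (W ord0) => x y; rewrite WP big_ord1.
Qed.

Definition adj T : bop H := projT1 (cid (adjoint_ex T)).

Lemma adjP T x y : inner (T x) y = inner x (adj T y).
Proof. by rewrite /adj; case: cid => S /= ->. Qed.

Lemma adjPr T x y : inner x (T y) = inner (adj T x) y.
Proof. by rewrite innerC adjP -innerC. Qed.

Lemma adj_unique T S : is_adjoint T S -> S = adj T.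
Proof. by move=> h; apply: bopP => y; apply: inner_eq => x; rewrite -h adjP. Qed.

Lemma adjK T : adj (adj T) = T.
Proof. by apply/esym/adj_unique => x y; rewrite adjPr. Qed.

Lemma adjM S T : adj (S * T) = adj T * adj S.
Proof. by apply/esym/adj_unique => x y; rewrite !bopM !adjP. Qed.

Lemma adjD S T : adj (S + T) = adj S + adj T.
Proof.
by apply/esym/adj_unique => x y; rewrite !bopD innerDl !adjP innerDr.
Qed.

Lemma adj_sum (I : Type) (s : seq I) (P : pred I) (f : I -> bop H) :
  adj (\sum_(i <- s | P i) f i) = \sum_(i <- s | P i) adj (f i).
Proof.
elim/big_rec2: _ => [|i u v _ <-]; last by rewrite adjD.
by apply/esym/adj_unique => x y; rewrite !bop0 inner0l inner0r.
Qed.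

Lemma le_opnorm_adj T x : rnorm (adj T x) <= opnorm T * rnorm x.
Proof.
have [x0|x0] := eqVneq (rnorm (adj T x)) 0.
  by rewrite x0 mulr_ge0 ?opnorm_ge0 ?rnorm_ge0.
have xp : 0 < rnorm (adj T x) by rewrite lt_neqAle eq_sym x0 rnorm_ge0.
rewrite -(ler_pM2l xp) -expr2.
have -> : rnorm (adj T x) ^+ 2 = complex.Re (inner (T (adj T x)) x).
  by rewrite adjP innerxxE.
rewrite (le_trans (ler_Re_rnorm _))// (le_trans (cauchy_schwarz _ _))//.
by rewrite mulrA [_ * opnorm T]mulrC ler_wpM2r ?rnorm_ge0// le_opnorm.
Qed.

Lemma opnorm_adj T : opnorm (adj T) = opnorm T.
Proof.
suff h X : opnorm (adj X) <= opnorm X.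
  by apply/eqP; rewrite eq_le h -{1}(adjK T) h.
by apply: opnorm_le; [exact: opnorm_ge0|exact: le_opnorm_adj].
Qed.

End douglas.

Section norm_limits.
Context {R : realType} {H : hilbertType R}.
Local Notation C := R[i].
Implicit Types (u v : nat -> H) (l : H) (T : bop H).

Definition rcvg u l := (fun n => rnorm (u n - l)) @ \oo --> (0 : R).

Lemma squeeze_rcvg u l (a : nat -> R) :
  (forall n, rnorm (u n - l) <= a n) -> a @ \oo --> (0 : R) -> rcvg u l.
Proof.
move=> ua a0; apply: (@squeeze_cvgr _ _ _ _ (fun=> 0) a) => //.
  by apply: nearW => n; rewrite rnorm_ge0 ua.
exact: cvg_cst.
Qed.

Lemma rcvgD u v l l' : rcvg u l -> rcvg v l' -> rcvg (fun n => u n + v n) (l + l').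
Proof.
move=> ul vl; apply: squeeze_rcvg; last by rewrite -[0](addr0 0); exact: cvgD ul vl.
by move=> n /=; rewrite opprD addrACA; exact: rnormD.
Qed.

Lemma rcvg_bop T u l : rcvg u l -> rcvg (fun n => T (u n)) (T l).
Proof.
move=> ul; apply: (@squeeze_rcvg _ _ (fun n => opnorm T * rnorm (u n - l))).
  by move=> n; rewrite -bopBr le_opnorm.
by rewrite -(mulr0 (opnorm T)); apply: cvgMl_tmp ul.
Qed.

Lemma rcvgZ (a : C) u l : rcvg u l -> rcvg (fun n => a *: u n) (a *: l).
Proof. exact: (@rcvg_bop (a *: (1 : bop H)) u l). Qed.

Lemma cvg0_ge_cst (r : R) (a : nat -> R) :
  (forall n, r <= a n) -> a @ \oo --> (0 : R) -> r <= 0.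
Proof.
move=> ra a0; apply/ler_addgt0Pr => e e0.
move/cvgrPdist_lt : a0 => /(_ _ e0)[n _ /(_ n (leqnn n))] /=.
rewrite sub0r normrN add0r => /ltW; apply: le_trans.
by rewrite (le_trans (ra n))// ler_norm.
Qed.

Lemma rcvg_unique u l l' : rcvg u l -> rcvg u l' -> l = l'.
Proof.
move=> ul ul'; apply/eqP; rewrite -subr_eq0; apply/eqP/rnorm_eq0.
apply/eqP; rewrite eq_le rnorm_ge0 andbT.
apply: (@cvg0_ge_cst _ (fun n => rnorm (u n - l) + rnorm (u n - l'))).
  by move=> n; rewrite (rnormB _ l) -(subrKA (u n) l) rnormD.
by rewrite -[0](addr0 0); exact: cvgD ul ul'.
Qed.

Lemma rcvg_le u l (M : R) : (forall n, rnorm (u n) <= M) -> rcvg u l -> rnorm l <= M.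
Proof.
move=> uM ul; apply/ler_addgt0Pr => e e0.
move/cvgrPdist_lt : ul => /(_ _ e0)[n _ /(_ n (leqnn n))] /=.
rewrite sub0r normrN ger0_norm ?rnorm_ge0// => h.
by rewrite -(subKr (u n) l) (le_trans (rnormD _ _))// rnormN lerD// ltW.
Qed.

Lemma rcvg_shift u l : rcvg u l -> rcvg (fun n => u n.+1) l.
Proof. by move=> ul; rewrite /rcvg (cvg_shiftS (fun n => rnorm (u n - l))). Qed.

End norm_limits.

Section square_root.
Context {R : realType} {H : hilbertType R}.
Local Notation C := R[i].
Implicit Types (S T P : bop H) (x y : H).

(** Polarization: the diagonal of the form is real, and testing this at x + y and x + 'i y compares
    the imaginary and the real parts of <P x, y> and <P y, x>. *)
Lemma positive_op_sym P : positive_op P -> forall x y, inner (P x) y = inner x (P y).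
Proof.
move=> P0 x y.
have Im0 z : complex.Im (inner (P z) z) = 0 by exact: ger0_Im.
have := Im0 (x + y); have := Im0 (x + 'i *: y).
rewrite !bopDr !bopZr !innerDl !innerDr !innerZl !innerZr (innerC (P y) x).
have := Im0 x; have := Im0 y.
case: (inner (P x) x) => a b; case: (inner (P y) y) => c d.
case: (inner (P x) y) => p q; case: (inner (P y) x) => r s /=.
move=> -> -> h1 h2; apply/eqP; rewrite eq_complex /=.
by apply/andP; split; apply/eqP; move: h1 h2; lra.
Qed.

Lemma positive_op_adj P : positive_op P -> adj P = P.
Proof. by move=> P0; apply/esym/adj_unique; exact: positive_op_sym. Qed.

Lemma positive_op_cs P : positive_op P -> forall x y,
  rnorm (inner (P x) y) ^+ 2 <= complex.Re (inner (P x) x) * complex.Re (inner (P y) y).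
Proof.
move=> P0; apply: (@cauchy_schwarz_form R H (fun x y => inner (P x) y)) => //.
- by move=> x y z; rewrite bopDr innerDl.
- by move=> a x y; rewrite bopZr innerZl.
- by move=> x y; rewrite positive_op_sym// -innerC.
Qed.

(** Cauchy-Schwarz for the form of P at the pair x, P x: |P x|^4 <= <P x, x> <P P x, P x> <= c |x|^2
    * c |P x|^2. *)
Lemma positive_op_bound P (c : R) : positive_op P -> 0 <= c ->
  (forall x, complex.Re (inner (P x) x) <= c * rnorm x ^+ 2) ->
  forall x, rnorm (P x) <= c * rnorm x.
Proof.
move=> P0 c0 Pc x; have [x0|x0] := eqVneq (rnorm (P x)) 0.
  by rewrite x0 mulr_ge0 ?rnorm_ge0.
have xp : 0 < rnorm (P x) ^+ 2 by rewrite exprn_gt0// lt_neqAle eq_sym x0 rnorm_ge0.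
rewrite -(@ler_pXn2r _ 2)// ?nnegrE ?mulr_ge0 ?rnorm_ge0// -(ler_pM2r xp).
have := positive_op_cs P0 x (P x); rewrite innerxxE rnorm_real ger0_norm ?sqr_ge0//.
rewrite -expr2 => /le_trans; apply.
have re0 y : 0 <= complex.Re (inner (P y) y).
  by have := P0 y; rewrite lecE => /andP[].
apply: (@le_trans _ _ ((c * rnorm x ^+ 2) * (c * rnorm (P x) ^+ 2))).
  by apply: ler_pM.
by rewrite le_eqVlt; apply/orP; left; apply/eqP; ring.
Qed.

Section iteration.
Variable b : bop H.
Hypothesis b1 : forall x, rnorm (b x) <= rnorm x.
Hypothesis bsym : adj b = b.

(* The increments of Y, whose terms commute, are dominated by those of the scalar
   iteration s, which is bounded by 1; the limit y satisfies (1 - y)^2 = 1 - b. *)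
Let half : C := (2^-1)%:C.

Let Y := fix Y n := if n is n'.+1 then half *: (b + Y n' * Y n') else 0.

Let s : nat -> R := fix s n := if n is n'.+1 then 2^-1 * (1 + s n' ^+ 2) else 0.

Let Y0 : Y 0 = 0. Proof. by []. Qed.

Let YS n : Y n.+1 = half *: (b + Y n * Y n). Proof. by []. Qed.

Let s0 : s 0 = 0. Proof. by []. Qed.

Let sS n : s n.+1 = 2^-1 * (1 + s n ^+ 2). Proof. by []. Qed.

Let s01 n : 0 <= s n <= 1.
Proof. by elim: n => [|n /andP[h1 h2]] /=; [lra|apply/andP; split; nra]. Qed.

Let s_mono n : s n <= s n.+1.
Proof. by have := s01 n; rewrite /= => /andP[? ?]; nra. Qed.

Let Y_comm X : b * X = X * b -> forall n, Y n * X = X * Y n.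
Proof.
move=> bX; elim=> [|n IH] /=; first by rewrite mul0r mulr0.
rewrite bopZM bopMZ mulrDl mulrDr bX -mulrA IH mulrA IH mulrA//.
Qed.

(** All Y n are polynomials in b. Commutation lets the difference of two squares factor in
    [Y_step]. *)
Let YY m n : Y m * Y n = Y n * Y m.
Proof. by apply: Y_comm; rewrite Y_comm. Qed.

Let Y_step n : Y n.+2 - Y n.+1 = half *: ((Y n.+1 + Y n) * (Y n.+1 - Y n)).
Proof.
have -> : (Y n.+1 + Y n) * (Y n.+1 - Y n) = Y n.+1 * Y n.+1 - Y n * Y n.
  by rewrite mulrBr !mulrDl (YY n n.+1) opprD addrA addrK.
by rewrite (YS n.+1) {2}(YS n) -scalerBr opprD addrACA subrr add0r.
Qed.

Let Y_le n x : rnorm (Y n x) <= s n * rnorm x.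
Proof.
elim: n x => [|n IH] x; first by rewrite Y0 bop0 rnorm0 s0 mul0r.
rewrite YS sS bopZ rnormZr ger0_norm ?invr_ge0// -mulrA ler_pM2l ?invr_gt0//.
rewrite bopD bopM (le_trans (rnormD _ _))// mulrDl mul1r lerD//.
rewrite (le_trans (IH _))// expr2 -mulrA ler_wpM2l//.
by have /andP[] := s01 n.
Qed.

Let Y_diff n x : rnorm ((Y n.+1 - Y n) x) <= (s n.+1 - s n) * rnorm x.
Proof.
elim: n x => [|n IH] x.
  by have := Y_le 1 x; rewrite Y0 s0 !subr0.
have -> : s n.+2 - s n.+1 = 2^-1 * ((s n.+1 + s n) * (s n.+1 - s n)).
  rewrite (sS n.+1) {1}(sS n) [(s _ + _) * _]mulrC -subr_sqr -mulrBr opprD.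
  by rewrite addrACA subrr add0r.
rewrite Y_step bopZ rnormZr ger0_norm ?invr_ge0// -!mulrA ler_pM2l ?invr_gt0//.
rewrite bopM; set z := ((Y n.+1 - Y n : bop H) x).
apply: (@le_trans _ _ ((s n.+1 + s n) * rnorm z)).
  by rewrite bopD (le_trans (rnormD _ _))// mulrDl lerD.
rewrite ler_wpM2l ?IH// addr_ge0//; have /andP[] := s01 n => //.
by have /andP[] := s01 n.+1.
Qed.

Let Y_sub n k x : rnorm (Y (n + k)%N x - Y n x) <= (s (n + k)%N - s n) * rnorm x.
Proof.
elim: k => [|k IH]; first by rewrite addn0 !subrr rnorm0 mul0r.
rewrite addnS -(subrKA (Y (n + k)%N x)) (le_trans (rnormD _ _))//.
rewrite -[s _.+1](subrK (s (n + k)%N)) -addrA mulrDl lerD//.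
by rewrite -bopB Y_diff.
Qed.

Let Y_adj n : adj (Y n) = Y n.
Proof.
elim: n => [|n IH]; apply/esym/adj_unique => x y.
  by rewrite Y0 !bop0 inner0l inner0r.
rewrite !YS !bopZ innerZl innerZr conjc_real !bopD innerDl innerDr adjP bsym !bopM.
by rewrite adjP IH adjP IH.
Qed.

Lemma sqrt_iteration_limit : exists2 y : bop H,
  2%:R *: y = b + y * y & positive_op (1 - y).
Proof.
have s_cvg : cvg (s @ \oo).
  apply: nondecreasing_is_cvgn.
    by apply/nondecreasing_seqP; exact: s_mono.
  by exists 1 => _ [n _ <-]; have /andP[] := s01 n.
have /choice[l lP] : forall x, exists l, rcvg (fun n => Y n x) l.
  move=> x; apply: hilbert_complete => e e0.
  have x1 : 0 < rnorm x + 1 by rewrite ltr_wpDl ?rnorm_ge0.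
  pose d := e / (4 * (rnorm x + 1)).
  have d0 : 0 < d by rewrite divr_gt0// mulr_gt0.
  have dE : 2 * (d * (rnorm x + 1)) = e / 2.
    by rewrite /d; field; rewrite gt_eqF.
  move/cvgrPdist_lt : s_cvg => /(_ _ d0)[n0 _ hn0].
  exists n0 => m n n0m n0n.
  have le k : (n0 <= k)%N -> rnorm (Y k x - Y n0 x) < e / 2.
    move=> n0k; have := Y_sub n0 (k - n0) x; rewrite subnKC//.
    move=> /le_lt_trans; apply; rewrite -dE mulrA.
    apply: (@le_lt_trans _ _ (2 * d * rnorm x)); last first.
      by rewrite ltr_pM2l ?ltrDl// mulr_gt0.
    rewrite ler_wpM2r ?rnorm_ge0//.
    have := hn0 k n0k; have := hn0 n0 (leqnn n0); rewrite /= !ltr_norml.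
    by move=> /andP[? ?] /andP[? ?]; lra.
  rewrite -(subrKA (Y n0 x)) (le_lt_trans (rnormD _ _))// [ltRHS]splitr.
  by rewrite ltrD ?le// rnormB le.
have ll : linear l.
  move=> a x x'; apply: (@rcvg_unique _ _ (fun n => Y n (a *: x + x'))) => //.
  under [fun n => _]funext do rewrite bopDr bopZr.
  by apply: rcvgD => //; exact: rcvgZ.
have l1 x : rnorm (l x) <= 1 * rnorm x.
  apply: (rcvg_le _ (lP x)) => n; rewrite (le_trans (Y_le n x))//.
  by rewrite ler_wpM2r ?rnorm_ge0//; have /andP[] := s01 n.
pose y := mkbop (conj ll (ex_intro _ 1 l1)).
have Yy x : rcvg (fun n => Y n x) (y x) by exact: lP.
exists y.
  apply: bopP => x; apply: (@rcvg_unique _ _ (fun n => 2%:R *: Y n.+1 x)).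
    by rewrite bopZ; apply: rcvgZ; apply: (rcvg_shift (Yy x)).
  have -> : (fun n => 2%:R *: Y n.+1 x) = (fun n => b x + Y n (Y n x)).
    apply/funext => n; rewrite YS bopZ scalerA /half.
    by rewrite fmorphV rmorph_nat mulfV ?pnatr_eq0// scale1r bopD.
  rewrite bopD; apply: rcvgD.
    by rewrite /rcvg subrr rnorm0; exact: cvg_cst.
  (* Both the operator and its argument vary with n; the contractions Y n are applied to an argument
     that converges in norm. *)
  rewrite bopM; have -> : (fun n => Y n (Y n x)) =
      (fun n => Y n (Y n x - y x) + Y n (y x)).
    by apply/funext => n; rewrite bopBr subrK.
  rewrite -[X in rcvg _ X]add0r; apply: rcvgD => //.
  apply: squeeze_rcvg (Yy x) => n; rewrite subr0 (le_trans (Y_le _ _))//.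
  by rewrite ler_piMl ?rnorm_ge0//; have /andP[] := s01 n.
have ysym : adj y = y.
  apply/esym/adj_unique => x x'; apply/eqP; rewrite -subr_eq0; apply/eqP/rnorm_eq0.
  apply/eqP; rewrite eq_le rnorm_ge0 andbT.
  apply: (@cvg0_ge_cst _ _ (fun n => rnorm (Y n x - y x) * rnorm x' +
                                   rnorm x * rnorm (Y n x' - y x'))).
    move=> n; have -> : inner (y x) x' - inner x (y x') =
        - inner (Y n x - y x) x' + inner x (Y n x' - y x').
      by rewrite innerBl innerBr opprB -(Y_adj n) -adjPr (Y_adj n) subrKA.
    by rewrite (le_trans (rnormD _ _))// rnormN lerD// cauchy_schwarz.
  rewrite -[0](addr0 0); apply: cvgD.
    by rewrite -(mul0r (rnorm x')); apply: cvgMr_tmp; exact: Yy.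
  by rewrite -(mulr0 (rnorm x)); apply: cvgMl_tmp; exact: Yy.
(* Symmetry of y makes <y x, x> real, and contractivity bounds it by |x|^2. *)
move=> x; rewrite bopB innerBl innerxxE.
have : inner (y x) x = (inner (y x) x)^*%C.
  by rewrite -innerC -{1}ysym -adjPr.
have : complex.Re (inner (y x) x) <= rnorm x ^+ 2.
  rewrite (le_trans (ler_Re_rnorm _))// (le_trans (cauchy_schwarz _ _))//.
  by rewrite expr2 ler_wpM2r ?rnorm_ge0//; have := l1 x; rewrite mul1r.
case: (inner _ _) => p q /= pq [qq]; rewrite lecE /= subr_ge0 pq andbT.
by apply/eqP; lra.
Qed.
End iteration.

Lemma adj_self_mul T x y : inner ((adj T * T) x) y = inner (T x) (T y).
Proof. by rewrite bopM -adjPr. Qed.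

(** After rescaling by c > ||P||, the operator b = 1 - P / c is a positive contraction. The
    iteration yields (1 - y)^2 = 1 - b = P / c, so sqrt c (1 - y) is a root of P. *)
Lemma positive_sqrt P : positive_op P -> exists2 S, positive_op S & S * S = P.
Proof.
move=> P0; pose c := opnorm P + 1.
have c0 : 0 < c by rewrite ltr_wpDl ?opnorm_ge0.
have ReP x : 0 <= complex.Re (inner (P x) x) <= c * rnorm x ^+ 2.
  have := P0 x; rewrite lecE => /andP[_ ->] /=.
  rewrite (le_trans (ler_Re_rnorm _))// (le_trans (cauchy_schwarz _ _))//.
  rewrite expr2 mulrA ler_wpM2r ?rnorm_ge0// (le_trans (le_opnorm _ _))//.
  by rewrite ler_wpM2r ?rnorm_ge0// lerDl.
pose b : bop H := 1 - (c^-1)%:C *: P.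
have innerb x : inner (b x) x = (rnorm x ^+ 2 - c^-1 * complex.Re (inner (P x) x))%:C.
  rewrite bopB bopZ innerBl innerZl innerxxE.
  rewrite [in LHS](_ : inner (P x) x = (complex.Re (inner (P x) x))%:C); last first.
    by rewrite RRe_real// realE P0.
  by rewrite -rmorphM -rmorphB.
have b0 : positive_op b.
  move=> x; rewrite innerb ler0c subr_ge0 mulrC ler_pdivrMr// mulrC.
  by have /andP[] := ReP x.
have b1 x : rnorm (b x) <= rnorm x.
  rewrite -[leRHS]mul1r; apply: positive_op_bound => // z.
  rewrite innerb mul1r /= gerBl mulr_ge0 ?invr_ge0 ?(ltW c0)//.
  by have /andP[] := ReP z.
have [y yE y0] := sqrt_iteration_limit b1 (positive_op_adj b0).
have yyE : (1 - y) * (1 - y) = (c^-1)%:C *: P.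
  rewrite mulrBr mulr1 mulrBl mul1r opprB addrACA -opprD -[y + y]mulr2n.
  by rewrite -scaler_nat yE opprD addrACA subrr addr0 /b opprB addrC subrK.
exists ((Num.sqrt c)%:C *: (1 - y)).
  by move=> x; rewrite bopZ innerZl mulr_ge0// ler0c sqrtr_ge0.
rewrite bopZM bopMZ scalerA -rmorphM /= -expr2 sqr_sqrtr ?(ltW c0)//.
by rewrite yyE scalerA -rmorphM /= mulfV ?gt_eqF// scale1r.
Qed.

Lemma absolute_value_ex T : exists P, is_absolute_value T P.
Proof.
have [|P P0 PP] := @positive_sqrt (adj T * T).
  by move=> x; rewrite adj_self_mul innerxxE ler0c sqr_ge0.
by exists P; split=> //; exists (adj T) => // x y; rewrite adjP.
Qed.

Lemma absolute_value_norm T P x : is_absolute_value T P -> rnorm (P x) = rnorm (T x).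
Proof.
move=> [P0 [S /adj_unique -> PP]]; apply/eqP.
rewrite -(@eqrXn2 _ 2)// ?rnorm_ge0//; apply/eqP/complexI.
by rewrite -!innerxxE -(adj_self_mul T) -PP bopM [RHS]positive_op_sym.
Qed.

(** Douglas' lemma with one operator gives S^* = T^* W; the contraction wanted here is the adjoint
    of W. *)
Lemma contraction_factor S T : (forall x, rnorm (S x) <= rnorm (T x)) ->
  exists2 W, S = W * T & forall x, rnorm (W x) <= rnorm x.
Proof.
move=> ST; have [|x|W WP Wn] := @douglas _ _ 1 S (fun=> T) 1 => //.
  by rewrite big_ord1 mul1r ler_pXn2r ?nnegrE ?rnorm_ge0.
exists (adj (W ord0)).
  apply: bopP => x; apply: inner_eq => z.
  by rewrite innerC WP big_ord1 -innerC bopM -adjP.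
move=> x; rewrite (le_trans (le_opnorm_adj _ _))// ler_piMl ?rnorm_ge0//.
by apply: opnorm_le => // z; rewrite (le_trans (Wn _ _))// sqrtr1.
Qed.

(** T and its absolute value have equal norms at every vector, so each is a contraction times the
    other. The two contractions stand in for the partial isometry and its adjoint. *)
Lemma polar T P : is_absolute_value T P -> exists U V, [/\ T = U * P, P = V * T,
  forall x, rnorm (U x) <= rnorm x & forall x, rnorm (V x) <= rnorm x].
Proof.
move=> TP; have [x|V PV V1] := @contraction_factor P T.
  by rewrite (absolute_value_norm x TP).
have [x|U TU U1] := @contraction_factor T P.
  by rewrite (absolute_value_norm x TP).
by exists U, V.
Qed.

(** With T = U P and P = V T one has T^* = P U^* = V T U^*. *)
Lemma adj_factor T : exists A B, adj T = A * T * B.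
Proof.
have [P TP] := absolute_value_ex T; have [U [V [TE PE _ _]]] := polar TP.
exists V, (adj U); rewrite {1}TE adjM -PE; congr (_ * _).
by case: TP => P0 _; exact: positive_op_adj.
Qed.

End square_root.

(** * Rank-one operators and basis projections *)

Section rank_one_operators.
Context {R : realType} {H : hilbertType R}.
Local Notation C := R[i].
Implicit Types (S T X : bop H) (x y u v : H).

Lemma rk1_subproof u v : bounded_linear (fun x => inner x v *: u).
Proof.
split=> [a x y|]; first by rewrite innerDl innerZl scalerDl scalerA.
exists (rnorm v * rnorm u) => x; rewrite rnormZ mulrAC ler_wpM2r ?rnorm_ge0//.
by rewrite mulrC cauchy_schwarz.
Qed.

Definition rk1 u v : bop H := mkbop (rk1_subproof u v).

Lemma rk1E u v x : rk1 u v x = inner x v *: u. Proof. by []. Qed.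

Lemma mulr_rk1 T u v : T * rk1 u v = rk1 (T u) v.
Proof. by apply: bopP => x; rewrite bopM !rk1E bopZr. Qed.

Lemma rk1_mulr T u v : rk1 u v * T = rk1 u (adj T v).
Proof. by apply: bopP => x; rewrite bopM !rk1E adjP. Qed.

Lemma rk1_adj u v : adj (rk1 u v) = rk1 v u.
Proof.
apply/esym/adj_unique => x y.
by rewrite !rk1E innerZl innerZr -innerC mulrC.
Qed.

Lemma rk1Dl u u' v : rk1 (u + u') v = rk1 u v + rk1 u' v.
Proof. by apply: bopP => x; rewrite bopD !rk1E scalerDr. Qed.

Lemma rk1Dr u v v' : rk1 u (v + v') = rk1 u v + rk1 u v'.
Proof. by apply: bopP => x; rewrite bopD !rk1E innerDr scalerDl. Qed.

Lemma rk1Zl a u v : rk1 (a *: u) v = a *: rk1 u v.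
Proof. by apply: bopP => x; rewrite bopZ !rk1E !scalerA mulrC. Qed.

Lemma rk1Zr a u v : rk1 u (a *: v) = a^*%C *: rk1 u v.
Proof. by apply: bopP => x; rewrite bopZ !rk1E innerZr scalerA. Qed.

Lemma rk1_rank_le u v : rank_le 1 (rk1 u v).
Proof.
by exists (fun=> u) => x; exists (fun=> inner x v); rewrite big_ord1.
Qed.

Lemma opnorm_rk1 u v : opnorm (rk1 u v) = rnorm u * rnorm v.
Proof.
apply/eqP; rewrite eq_le; apply/andP; split.
  apply: opnorm_le => [|x]; first by rewrite mulr_ge0 ?rnorm_ge0.
  rewrite rk1E rnormZ mulrC -mulrA ler_wpM2l ?rnorm_ge0// mulrC.
  exact: cauchy_schwarz.
have [v0|v0] := eqVneq (rnorm v) 0; first by rewrite v0 mulr0 opnorm_ge0.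
have vp : 0 < rnorm v by rewrite lt_neqAle eq_sym v0 rnorm_ge0.
have := le_opnorm (rk1 u v) v; rewrite rk1E rnormZ innerxxE rnorm_real.
by rewrite ger0_norm ?sqr_ge0// expr2 mulrAC ler_pM2r// mulrC.
Qed.

Lemma rk1_eq0 u v : rk1 u v = 0 -> u = 0 \/ v = 0.
Proof.
move=> uv0; have := congr1 opnorm uv0; rewrite opnorm_rk1 => uv.
have : rnorm u * rnorm v <= 0.
  by rewrite uv; apply: opnorm_le => // x; rewrite bop0 rnorm0 mul0r.
rewrite le_eqVlt ltNge mulr_ge0 ?rnorm_ge0// orbF mulf_eq0.
by move=> /orP[] /eqP /rnorm_eq0 ->; [left|right].
Qed.

Lemma rank_le_sum n T : rank_le n T ->
  exists u v : 'I_n -> H, T = \sum_i rk1 (u i) (v i).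
Proof.
elim: n T => [|n IH] T [w Tw].
  exists (fun=> 0), (fun=> 0); rewrite big_ord0; apply: bopP => x.
  by have [c ->] := Tw x; rewrite big_ord0.
(* P projects onto the line of w0, so the range of T - P T is spanned by one vector less. For w0 = 0
   the inverse is 0, and P w0 = w0 still holds. *)
pose w0 := w ord0; pose r : C := ((rnorm w0)^-1 ^+ 2)%:C.
pose P := rk1 w0 (r *: w0).
have PE x : P x = (r * inner x w0) *: w0.
  by rewrite rk1E innerZr conjc_real.
have Pw0 : P w0 = w0.
  have [w00|w00] := eqVneq (rnorm w0) 0; first by rewrite (rnorm_eq0 w00) bop0r.
  by rewrite PE innerxxE -rmorphM /= -exprMn mulVf// expr1n scale1r.
have [|u [v uv]] := IH (T - P * T).
  exists (fun i => w (lift ord0 i) - P (w (lift ord0 i))) => x.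
  have [c cE] := Tw x; exists (fun i => c (lift ord0 i)).
  rewrite bopB bopM cE big_ord_recl -/w0 bopDr bopZr Pw0 opprD addrACA subrr add0r.
  rewrite bop_sumr -sumrB; apply: eq_bigr => i _.
  by rewrite bopZr scalerBr.
exists (fun i => if unlift ord0 i is Some j then u j else w0).
exists (fun i => if unlift ord0 i is Some j then v j else adj T (r *: w0)).
rewrite big_ord_recl unlift_none -rk1_mulr -/P.
under eq_bigr do rewrite liftK.
by rewrite -uv addrC subrK.
Qed.

Lemma finite_rank_sum T : finite_rank T ->
  exists n (u v : 'I_n -> H), T = \sum_i rk1 (u i) (v i).
Proof. by move=> [n /rank_le_sum uv]; exists n. Qed.

End rank_one_operators.

Section orthonormal_basis_theory.
Context {R : realType} {H : hilbertType R}.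
Local Notation C := R[i].
Implicit Types (S T X : bop H) (x y u v e f : H) (K L : {fset H}).

Lemma onbP : orthonormal_basis (@onb R H).
Proof. by rewrite /onb; case: cid. Qed.

Lemma ler_sum_fset (a : H -> R) K L : (forall e, 0 <= a e) -> (K `<=` L)%fset ->
  \sum_(e <- K) a e <= \sum_(e <- L) a e.
Proof.
move=> a0 KL; rewrite [leRHS](big_fsetID _ (mem K))/=.
have -> : [fset e in L | e \in K]%fset = K.
  apply/fsetP => e; rewrite !inE/= andbC.
  by case: (boolP (e \in K)) => // /(fsubsetP KL).
by rewrite lerDl sumr_ge0.
Qed.

Definition finonb K : Prop := [set` K] `<=` @onb R H.

Lemma finonbU K L : finonb K -> finonb L -> finonb (K `|` L)%fset.
Proof. by move=> hK hL e /=; rewrite inE => /orP[/hK|/hL]. Qed.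

Lemma finonb0 : finonb fset0.
Proof. by move=> e /=; rewrite inE. Qed.

Lemma inner_onb e f : onb e -> onb f -> inner e f = (e == f)%:R :> C.
Proof.
have [[e1 e0] _] := onbP => Ee Ef.
by case: eqP => [<-|ef]; [exact: e1|exact: e0].
Qed.

Lemma rnorm_onb e : onb e -> rnorm e = 1 :> R.
Proof.
move=> Ee; apply/eqP; rewrite -(@eqrXn2 _ 2)// ?rnorm_ge0// expr1n.
by apply/eqP/complexI; rewrite -innerxxE inner_onb// eqxx.
Qed.

Definition onbproj K : bop H := \sum_(e <- K) rk1 e e.

Definition coefs K x : R := \sum_(e <- K) rnorm (inner x e) ^+ 2.

Lemma onbprojE K x : onbproj K x = \sum_(e <- K) inner x e *: e.
Proof. by rewrite /onbproj bop_sum. Qed.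

Lemma onbproj_adj K : adj (onbproj K) = onbproj K.
Proof. by rewrite /onbproj adj_sum; apply: eq_bigr => e _; rewrite rk1_adj. Qed.

Lemma inner_onbproj K x e : finonb K -> e \in K -> inner (onbproj K x) e = inner x e.
Proof.
move=> hK eK; rewrite onbprojE inner_suml (big_fsetD1 e)//= innerZl.
have Ee : onb e by exact: hK eK.
rewrite (inner_onb Ee Ee) eqxx mulr1 big_seq big1 ?addr0// => f.
rewrite !inE => /andP[fe fK].
by rewrite innerZl (inner_onb (hK f fK) Ee) (negPf fe) mulr0.
Qed.

Lemma onbproj_sqr K x : finonb K -> rnorm (onbproj K x) ^+ 2 = coefs K x.
Proof.
move=> hK; apply: complexI; rewrite -innerxxE {2}onbprojE inner_sumr /coefs rmorph_sum.
rewrite big_seq [RHS]big_seq; apply: eq_bigr => e eK.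
by rewrite innerZr inner_onbproj// mulrC -sqr_rnorm.
Qed.

Lemma pythagoras K x : finonb K ->
  rnorm x ^+ 2 = coefs K x + rnorm (x - onbproj K x) ^+ 2.
Proof.
move=> hK; rewrite -onbproj_sqr//.
have -> : rnorm x ^+ 2 = rnorm (onbproj K x + (x - onbproj K x)) ^+ 2.
  by rewrite addrC subrK.
rewrite rnormDsqr innerBr.
have -> : inner (onbproj K x) x = inner (onbproj K x) (onbproj K x).
  rewrite [in LHS]onbprojE [in X in _ = inner _ X]onbprojE inner_suml inner_sumr.
  rewrite big_seq [RHS]big_seq; apply: eq_bigr => e eK.
  by rewrite innerZl innerZr inner_onbproj// -innerC mulrC.
by rewrite subrr /= mulr0 addr0.
Qed.

Lemma coefs_le K x : finonb K -> coefs K x <= rnorm x ^+ 2.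
Proof. by move=> hK; rewrite (pythagoras x hK) lerDl sqr_ge0. Qed.

Lemma coefs_mono K L x : (K `<=` L)%fset -> coefs K x <= coefs L x.
Proof.
by move=> KL; apply: ler_sum_fset => // e; exact: sqr_ge0.
Qed.

Lemma onbproj_le K x : finonb K -> rnorm (onbproj K x) <= rnorm x.
Proof.
by move=> hK; rewrite -(@ler_pXn2r _ 2)// ?nnegrE ?rnorm_ge0// onbproj_sqr// coefs_le.
Qed.

Lemma onbcoproj_le K x : finonb K -> rnorm (x - onbproj K x) <= rnorm x.
Proof.
move=> hK; rewrite -(@ler_pXn2r _ 2)// ?nnegrE ?rnorm_ge0//.
by rewrite [leRHS](pythagoras x hK) lerDr -onbproj_sqr// sqr_ge0.
Qed.

Lemma coefs_onbproj K L x : finonb L -> (K `<=` L)%fset ->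
  coefs K (onbproj L x) = coefs K x.
Proof.
move=> hL KL; rewrite /coefs big_seq [RHS]big_seq; apply: eq_bigr => e eK.
by rewrite inner_onbproj// (fsubsetP KL).
Qed.

Lemma onbproj_onbproj K L x : finonb L -> (K `<=` L)%fset ->
  onbproj K (onbproj L x) = onbproj K x.
Proof.
move=> hL KL; rewrite [LHS]onbprojE [RHS]onbprojE big_seq [RHS]big_seq.
apply: eq_bigr => e eK.
by rewrite inner_onbproj// (fsubsetP KL).
Qed.

(** Although the basis may be uncountable, a sequence of finite sets whose Bessel sums approach
    their supremum suffices: the projections of x converge, and maximality of the basis identifies
    the limit with x. *)
Lemma onbproj_cvg x (eps : R) : 0 < eps -> exists2 K, finonb K &
  forall L, finonb L -> (K `<=` L)%fset -> rnorm (x - onbproj L x) < eps.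
Proof.
move=> eps0; pose A := [set coefs K x | K in finonb].
have A_sup : has_sup A.
  split; first by exists (coefs fset0 x), fset0 => //; exact: finonb0.
  by exists (rnorm x ^+ 2) => _ [K hK <-]; exact: coefs_le.
pose s := sup A.
have coefs_s K : finonb K -> coefs K x <= s.
  by move=> hK; apply: ub_le_sup; [case: A_sup|exists K].
have /choice[K_ KP] : forall n : nat, exists K,
    finonb K /\ s - n.+1%:R^-1 ^+ 2 < coefs K x.
  move=> n; have [_ [K hK <-] sK] := @sup_adherent _ A (n.+1%:R^-1 ^+ 2)
    ltac:(by rewrite exprn_gt0// invr_gt0) A_sup.
  by exists K.
have hK n : finonb (K_ n) by have [] := KP n.
pose q n := onbproj (K_ n) x.
have qsub n L : finonb L -> (K_ n `<=` L)%fset -> rnorm (onbproj L x - q n) <= n.+1%:R^-1.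
  move=> hL KL; rewrite -(@ler_pXn2r _ 2)// ?nnegrE ?invr_ge0 ?rnorm_ge0//.
  have := pythagoras (onbproj L x) (hK n).
  rewrite coefs_onbproj// onbproj_onbproj// onbproj_sqr// -/(q n).
  by have [_] := KP n; have := coefs_s L hL; move: n.+1%:R^-1 => d ? ? ?; lra.
have near_inv (d : R) : 0 < d -> exists n0, forall n, (n0 <= n)%N -> n.+1%:R^-1 < d.
  by move=> d0; have [n _ h] := near_infty_natSinv_lt (PosNum d0); exists n.
have [z qz] : exists z, rcvg q z.
  apply: hilbert_complete => d d0.
  have [n0 hn0] := near_inv (d / 2) ltac:(by rewrite divr_gt0).
  (* The sets [K_ n] need not increase, so two of them are compared through their union. *)
  exists n0 => m n n0m n0n; pose L := (K_ m `|` K_ n)%fset.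
  have hL : finonb L by exact: finonbU.
  rewrite -(subrKA (onbproj L x)) (le_lt_trans (rnormD _ _))// rnormB [ltRHS]splitr.
  apply: ltrD.
    by rewrite (le_lt_trans _ (hn0 m n0m))// qsub// fsubsetUl.
  by rewrite (le_lt_trans _ (hn0 n n0n))// qsub// fsubsetUr.
have xz f : onb f -> inner (x - z) f = 0.
  move=> Ef; apply: rnorm_eq0; apply/eqP; rewrite eq_le rnorm_ge0 andbT.
  (* If f is outside [K_ n], adjoining it would push the Bessel sum above the supremum unless its
     coefficient is this small. *)
  have qf n : rnorm (inner (x - q n) f) <= n.+1%:R^-1.
    rewrite innerBl; have [fK|fK] := boolP (f \in K_ n).
      by rewrite inner_onbproj// subrr rnorm0 invr_ge0.
    have -> : inner (q n) f = 0.
      rewrite /q onbprojE inner_suml big_seq big1// => g gK.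
      rewrite innerZl (inner_onb (hK n g gK) Ef).
      by case: eqP => [gf|]; rewrite ?mulr0// -gf gK in fK *.
    rewrite subr0 -(@ler_pXn2r _ 2)// ?nnegrE ?invr_ge0 ?rnorm_ge0//.
    have hL : finonb (f |` K_ n)%fset.
      by move=> g /=; rewrite !inE => /orP[/eqP ->//|/(hK n)].
    have := coefs_s _ hL; rewrite /coefs big_fsetU1//= -/(coefs _ _).
    by have [_] := KP n; move: n.+1%:R^-1 => d ? ?; lra.
  apply: (@cvg0_ge_cst _ _ (fun n => n.+1%:R^-1 + rnorm (q n - z))).
    move=> n; rewrite -(subrKA (q n)) innerDl (le_trans (rnormD _ _))// lerD//.
    by rewrite (le_trans (cauchy_schwarz _ _))// (rnorm_onb Ef) mulr1.
  by rewrite -[0](addr0 0); apply: cvgD qz; exact: cvg_harmonic.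
have {}xz : x = z.
  have [_ h] := onbP; apply/eqP; rewrite -subr_eq0; apply/eqP; exact: h.
move: qz; rewrite -xz => /cvgrPdist_lt /(_ _ eps0)[n _ /(_ n (leqnn n))] /=.
rewrite sub0r normrN ger0_norm ?rnorm_ge0// => qe.
exists (K_ n) => // L hL KL; apply: le_lt_trans qe.
(* By Pythagoras a larger finite set can only decrease the distance to x. *)
rewrite rnormB -(@ler_pXn2r _ 2)// ?nnegrE ?rnorm_ge0//.
have := pythagoras x (hK n); have := pythagoras x hL; have := coefs_mono x KL.
rewrite rnormB -/(q n) [rnorm (x - q n)]rnormB; lra.
Qed.

End orthonormal_basis_theory.

(** * Symmetric ideals *)

Section onbproj_cvg_seq.
Context {R : realType} {H : hilbertType R}.
Implicit Types (K L : {fset H}) (x : H).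

Lemma onbproj_cvg_seq (s : seq H) (eps : R) : 0 < eps -> exists2 K, finonb K &
  forall L, finonb L -> (K `<=` L)%fset ->
    forall x, x \in s -> rnorm (x - onbproj L x) < eps.
Proof.
move=> eps0; elim: s => [|x s [K hK KL]]; first by exists fset0 => //; exact: finonb0.
have [K' hK' KL'] := onbproj_cvg x eps0.
exists (K' `|` K)%fset; first exact: finonbU.
move=> L hL; rewrite fsubUset => /andP[K'L K_L] y.
by rewrite inE => /orP[/eqP ->|]; [exact: KL'|exact: KL].
Qed.

Lemma rk1Br (u v v' : H) : rk1 u (v - v') = rk1 u v - rk1 u v'.
Proof. by apply: bopP => x; rewrite bopB !rk1E innerBr scalerBl. Qed.

End onbproj_cvg_seq.

Section symmetric_ideals.
Context {R : realType} {H : hilbertType R}.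
Local Notation C := R[i].
Implicit Types (I : set (bop H)) (N : bop H -> R) (X Y A B : bop H).
Implicit Types (x y u v e : H) (K L : {fset H}).

(* An sn-ideal without completeness and definiteness of the norm, so that it
   remains to check little for the Hilbert-Schmidt operators. *)
Record sym_ideal I N : Prop := SymIdeal {
  sym_ideal_two_sided : two_sided_ideal I ;
  sym_ideal_ler_normD : forall X Y, I X -> I Y -> N (X + Y) <= N X + N Y ;
  sym_ideal_normZ : forall (a : C) X, I X -> N (a *: X) = rnorm a * N X ;
  sym_ideal_norm_mul : forall A X B, I X -> N (A * X * B) <= opnorm A * N X * opnorm B ;
  sym_ideal_rk1 : forall u v, I (rk1 u v) ;
  sym_ideal_norm_rk1 : forall u v, N (rk1 u v) = rnorm u * rnorm v
}.

(** If X x is nonzero, sandwiching X between [rk1] operators built from X x and x produces every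
    [rk1 u v]. The zero operator is treated apart since [rank_one] excludes it. *)
Lemma sn_ideal_sym I N : sn_ideal I N -> sym_ideal I N.
Proof.
case=> I2 [[ND NZ _] NM N1] _ [X IX X0] _; have [I0 ID IM] := I2.
have Irk1 u v : I (rk1 u v).
  have [x Xx] : exists x, X x != 0.
    apply: contrapT => /forallNP h; move/eqP: X0; apply; apply: bopP => x.
    by apply/eqP/negPn/negP; exact: h.
  have Xx0 : rnorm (X x) != 0 by apply: contra_neq Xx => /rnorm_eq0.
  have -> : rk1 u v = rk1 u (((rnorm (X x))^-1 ^+ 2)%:C *: X x) * X * rk1 x v.
    rewrite -mulrA mulr_rk1 mulr_rk1 rk1E innerZr conjc_real innerxxE -rmorphM /=.
    by rewrite -exprMn mulVf// expr1n scale1r.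
  exact: IM.
split=> // u v; have [uv0|uv0] := eqVneq (rk1 u v) 0.
  have N0 : N 0 = 0 by have := NZ 0 _ I0; rewrite scaler0 rnorm0 mul0r.
  by rewrite uv0 N0; case: (rk1_eq0 uv0) => ->; rewrite rnorm0 ?mulr0 ?mul0r.
by rewrite N1 ?opnorm_rk1//; split=> //; exact: rk1_rank_le.
Qed.

Section theory.
Variables (I : set (bop H)) (N : bop H -> R).
Hypothesis IN : sym_ideal I N.

Lemma sym_ideal0 : I 0.
Proof. by have [] := sym_ideal_two_sided IN. Qed.

Lemma sym_idealD X Y : I X -> I Y -> I (X + Y).
Proof. by have [_ + _] := sym_ideal_two_sided IN; apply. Qed.

Lemma sym_idealM A X B : I X -> I (A * X * B).
Proof. by have [_ _ +] := sym_ideal_two_sided IN; apply. Qed.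

Lemma sym_idealMl A X : I X -> I (A * X).
Proof. by move=> /(sym_idealM A 1); rewrite mulr1. Qed.

Lemma sym_idealMr A X : I X -> I (X * A).
Proof. by move=> /(sym_idealM 1 A); rewrite mul1r. Qed.

Lemma sym_idealZ a X : I X -> I (a *: X).
Proof. by move=> IX; rewrite -[X]mul1r -bopZM; exact: sym_idealMl. Qed.

Lemma sym_idealB X Y : I X -> I Y -> I (X - Y).
Proof.
by move=> IX IY; rewrite -scaleN1r; apply: sym_idealD => //; exact: sym_idealZ.
Qed.

Lemma sym_ideal_sum (J : Type) (s : seq J) (P : pred J) (f : J -> bop H) :
  (forall j, P j -> I (f j)) -> I (\sum_(j <- s | P j) f j).
Proof. by move=> If; apply: big_ind => //; [exact: sym_ideal0|exact: sym_idealD]. Qed.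

Lemma sym_ideal_norm0 : N 0 = 0.
Proof.
rewrite -(scale0r 0) (sym_ideal_normZ IN) ?rnorm0 ?mul0r//; exact: sym_ideal0.
Qed.

Lemma sym_ideal_normN X : I X -> N (- X) = N X.
Proof.
by move=> IX; rewrite -scaleN1r (sym_ideal_normZ IN)// rnormN rnorm_real normr1 mul1r.
Qed.

Lemma sym_ideal_norm_ge0 X : I X -> 0 <= N X.
Proof.
move=> IX; have := sym_ideal_ler_normD IN IX (sym_idealZ (-1) IX).
by rewrite scaleN1r subrr sym_ideal_norm0 sym_ideal_normN//; lra.
Qed.

Lemma sym_ideal_norm_sum (J : Type) (s : seq J) (P : pred J) (f : J -> bop H) :
  (forall j, P j -> I (f j)) ->
  N (\sum_(j <- s | P j) f j) <= \sum_(j <- s | P j) N (f j).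
Proof.
move=> If; suff [] : I (\sum_(j <- s | P j) f j) /\
    N (\sum_(j <- s | P j) f j) <= \sum_(j <- s | P j) N (f j) by [].
elim/big_rec2: _ => [|j r X Pj [IX NX]].
  by split; [exact: sym_ideal0|rewrite sym_ideal_norm0].
split; first by apply: sym_idealD => //; exact: If.
by rewrite (le_trans (sym_ideal_ler_normD IN (If j Pj) IX))// lerD2l.
Qed.

Lemma sym_ideal_norm_mull A X : I X -> N (A * X) <= opnorm A * N X.
Proof.
move=> IX; rewrite -[A * X]mulr1 (le_trans (sym_ideal_norm_mul IN _ _ IX))//.
by rewrite ler_piMr ?opnorm1_le// mulr_ge0 ?opnorm_ge0 ?sym_ideal_norm_ge0.
Qed.

Lemma sym_ideal_norm_mulr A X : I X -> N (X * A) <= N X * opnorm A.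
Proof.
move=> IX; rewrite -[X in N (X * A)]mul1r (le_trans (sym_ideal_norm_mul IN _ _ IX))//.
rewrite ler_wpM2r ?opnorm_ge0//.
by rewrite ler_piMl ?opnorm1_le ?sym_ideal_norm_ge0.
Qed.

(** X * [rk1 x x] has norm |X x| |x|, being rank one, and at most N X |x|^2, by symmetry of the
    norm. *)
Lemma sym_ideal_ge_rnorm X x : I X -> rnorm (X x) <= N X * rnorm x.
Proof.
move=> IX; have [x0|x0] := eqVneq (rnorm x) 0.
  by rewrite (rnorm_eq0 x0) bop0r rnorm0 mulr0.
have xp : 0 < rnorm x by rewrite lt_neqAle eq_sym x0 rnorm_ge0.
rewrite -(ler_pM2r xp) -(sym_ideal_norm_rk1 IN) -mulr_rk1 -mulrA -opnorm_rk1.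
exact: sym_ideal_norm_mulr.
Qed.

Lemma sym_ideal_adj X : I X -> I (adj X).
Proof. by move=> IX; have [A [B ->]] := adj_factor X; exact: sym_idealM. Qed.

Hypothesis Iapp : approximable I N.

(** X is within eps / 2 of a finite sum of [rk1 (u i) (v i)]. One finite set serves all u i and v i,
    and c turns their individual errors into a total of at most eps / 2. *)
Lemma approximable_coproj X (eps : R) : I X -> 0 < eps -> exists2 K, finonb K &
  forall L, finonb L -> (K `<=` L)%fset ->
    N (X - onbproj L * X) < eps /\ N (X - X * onbproj L) < eps.
Proof.
move=> IX eps0; have [F [IF /finite_rank_sum[n [u [v FE]]]] XF] :=
  Iapp IX (ltac:(by rewrite divr_gt0) : 0 < eps / 2).
have IXF : I (X - F) by exact: sym_idealB.
pose c := \sum_i (rnorm (u i) + rnorm (v i)) + 1.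
have c0 : 0 < c by rewrite ltr_wpDl// sumr_ge0// => i _; rewrite addr_ge0 ?rnorm_ge0.
have [K hK KL] := onbproj_cvg_seq (codom u ++ codom v)
  (ltac:(by rewrite !divr_gt0) : 0 < eps / 2 / c).
exists K => // L hL /(KL L hL) LE.
have Lu i : rnorm (u i - onbproj L (u i)) <= eps / 2 / c.
  by apply/ltW/LE; rewrite mem_cat codom_f.
have Lv i : rnorm (v i - onbproj L (v i)) <= eps / 2 / c.
  by apply/ltW/LE; rewrite mem_cat codom_f orbT.
have L1 : opnorm (1 - onbproj L) <= 1.
  by apply: opnorm_le => // x; rewrite mul1r; exact: onbcoproj_le.
have sum_le (a : 'I_n -> R) : (forall i, a i <= rnorm (u i) + rnorm (v i)) ->
    \sum_i eps / 2 / c * a i <= eps / 2.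
  move=> ac; rewrite -mulr_sumr -mulrA ger_pMr ?divr_gt0// mulrC ler_pdivrMr// mul1r.
  by rewrite /c (@le_trans _ _ (\sum_i (rnorm (u i) + rnorm (v i))))// ?ler_sum ?lerDl.
have NXF : N (X - F) < eps / 2 by [].
split.
  have -> : X - onbproj L * X = (1 - onbproj L) * (X - F) +
      \sum_i rk1 (u i - onbproj L (u i)) (v i).
    rewrite (eq_bigr (fun i => (1 - onbproj L) * rk1 (u i) (v i))) => [|i _].
      by rewrite -mulr_sumr -FE -mulrDr subrK mulrBl mul1r.
    by rewrite mulr_rk1.
  rewrite (le_lt_trans (sym_ideal_ler_normD IN _ _))//.
  - exact: sym_idealMl.
  - by apply: sym_ideal_sum => i _; exact: (sym_ideal_rk1 IN).
  rewrite [ltRHS]splitr; apply: ltr_leD.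
    rewrite (le_lt_trans (sym_ideal_norm_mull _ IXF))//.
    by rewrite (le_lt_trans _ NXF)// ler_piMl// sym_ideal_norm_ge0.
  apply: le_trans (sum_le (fun i => rnorm (v i)) _); last first.
    by move=> i; rewrite lerDr rnorm_ge0.
  apply: (le_trans (sym_ideal_norm_sum _ _)) => [i _|]; first exact: (sym_ideal_rk1 IN).
  by apply: ler_sum => i _; rewrite (sym_ideal_norm_rk1 IN) ler_wpM2r ?rnorm_ge0.
have -> : X - X * onbproj L = (X - F) * (1 - onbproj L) +
    \sum_i rk1 (u i) (v i - onbproj L (v i)).
  rewrite (eq_bigr (fun i => rk1 (u i) (v i) * (1 - onbproj L))) => [|i _].
    by rewrite -mulr_suml -FE -mulrDl subrK mulrBr mulr1.
  by rewrite mulrBr mulr1 rk1_mulr onbproj_adj rk1Br.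
rewrite (le_lt_trans (sym_ideal_ler_normD IN _ _))//.
- exact: sym_idealMr.
- by apply: sym_ideal_sum => i _; exact: (sym_ideal_rk1 IN).
rewrite [ltRHS]splitr; apply: ltr_leD.
  rewrite (le_lt_trans (sym_ideal_norm_mulr _ IXF))//.
  by rewrite (le_lt_trans _ NXF)// ler_piMr// sym_ideal_norm_ge0.
apply: le_trans (sum_le (fun i => rnorm (u i)) _); last first.
  by move=> i; rewrite lerDl rnorm_ge0.
apply: (le_trans (sym_ideal_norm_sum _ _)) => [i _|]; first exact: (sym_ideal_rk1 IN).
by apply: ler_sum => i _; rewrite (sym_ideal_norm_rk1 IN) mulrC ler_wpM2r ?rnorm_ge0.
Qed.

End theory.
End symmetric_ideals.

(** * Hilbert-Schmidt operators *)

Section sums_over_onb.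
Context {R : realType} {H : hilbertType R}.
Implicit Types (K L : {fset H}) (a : H -> R).

Lemma esum_onb_ge a K : finonb K ->
  ((\sum_(e <- K) a e)%:E <= \esum_(e in @onb R H) (a e)%:E)%E.
Proof.
move=> hK; apply: ereal_sup_ubound.
by exists [set` K]; [split|rewrite fsbig_finite// set_fsetK sumEFin].
Qed.

Lemma esum_onb_le a (c : R) :
  (\esum_(e in @onb R H) (a e)%:E <= c%:E)%E <->
  (forall K, finonb K -> \sum_(e <- K) a e <= c).
Proof.
split=> [h K hK|h].
  by rewrite -lee_fin; apply: le_trans h; exact: esum_onb_ge.
apply: ge_ereal_sup => _ [A [finA AE] <-].
rewrite fsbig_finite// sumEFin lee_fin; apply: h.
by rewrite /finonb fset_setK.
Qed.

Lemma esum_onb_lt a (c : R) : (c%:E < \esum_(e in @onb R H) (a e)%:E)%E ->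
  exists2 K, finonb K & c < \sum_(e <- K) a e.
Proof.
move=> ca; apply: contrapT => h; move: ca; rewrite ltNge => /negP; apply.
apply/esum_onb_le => K hK; rewrite leNgt; apply/negP => cK; apply: h.
by exists K.
Qed.

Lemma esum_onb_sub a (c eps : R) : 0 < eps ->
  (\esum_(e in @onb R H) (a e)%:E = c%:E)%E ->
  exists2 K, finonb K & c - eps < \sum_(e <- K) a e.
Proof.
by move=> e0 ac; apply: esum_onb_lt; rewrite ac lte_fin gtrBl.
Qed.

Lemma parseval (x : H) :
  (\esum_(e in onb) (rnorm (inner x e) ^+ 2)%:E)%E = (rnorm x ^+ 2)%:E.
Proof.
apply/eqP; rewrite eq_le; apply/andP; split.
  by apply/esum_onb_le => K hK; exact: coefs_le.
apply/lee_addgt0Pr => eps eps0.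
have seps0 : 0 < Num.sqrt eps by rewrite sqrtr_gt0.
have [K hK /(_ K hK (fsubset_refl _))] := onbproj_cvg x seps0.
move=> h; have {h}xK : rnorm (x - onbproj K x) ^+ 2 < eps.
  by rewrite -[ltRHS]sqr_sqrtr ?(ltW eps0)// ltr_pXn2r ?nnegrE ?rnorm_ge0 ?sqrtr_ge0.
rewrite (pythagoras x hK) EFinD leeD// ?lee_fin ?(ltW xK)//.
exact: (esum_onb_ge (fun e => rnorm (inner x e) ^+ 2)).
Qed.

End sums_over_onb.

Section hilbert_schmidt.
Context {R : realType} {H : hilbertType R}.
Local Notation C := R[i].
Implicit Types (X Y A B : bop H) (x y u v e f : H) (K L : {fset H}).

Lemma hs_sqnorm_ge0 X : (0 <= hs_sqnorm X)%E.
Proof. by apply: esum_ge0 => e _; rewrite lee_fin sqr_ge0. Qed.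

Lemma hs_normE X : hilbert_schmidt X -> hs_sqnorm X = (hs_norm X ^+ 2)%:E.
Proof.
rewrite /hilbert_schmidt /= => hX; have X0 := hs_sqnorm_ge0 X.
by rewrite sqr_sqrtr ?fine_ge0// fineK// ge0_fin_numE.
Qed.

Lemma hs_sum_le X K : hilbert_schmidt X -> finonb K ->
  \sum_(e <- K) rnorm (X e) ^+ 2 <= hs_norm X ^+ 2.
Proof. by move=> /hs_normE hX; move: K; apply/esum_onb_le; rewrite -hX. Qed.

Lemma hs_norm_ge0 X : 0 <= hs_norm X. Proof. exact: sqrtr_ge0. Qed.

Lemma hs_norm_le X (c : R) : 0 <= c ->
  (forall K, finonb K -> \sum_(e <- K) rnorm (X e) ^+ 2 <= c ^+ 2) ->
  hilbert_schmidt X /\ hs_norm X <= c.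
Proof.
move=> c0 /esum_onb_le; rewrite -/(hs_sqnorm X) => hc.
have hX : hilbert_schmidt X by rewrite /hilbert_schmidt /= (le_lt_trans hc)// ltry.
split=> //; move: hc; rewrite hs_normE// lee_fin.
by rewrite ler_pXn2r ?nnegrE ?hs_norm_ge0.
Qed.

(** Parseval expands each |Y^* f|^2; exchanging the sums over e and over finitely many f, then
    Bessel's inequality for Y e, gives one inequality, and the involution the other. *)
Lemma hs_sqnorm_adj X : hs_sqnorm (adj X) = hs_sqnorm X.
Proof.
suff h Y : (hs_sqnorm (adj Y) <= hs_sqnorm Y)%E.
  by apply/eqP; rewrite eq_le h -{1}(adjK X) h.
apply: ge_ereal_sup => _ [A [finA AE] <-]; rewrite fsbig_finite//.
under eq_bigr do rewrite -parseval.
rewrite -esum_sum => [|e f _ _]; last by rewrite lee_fin sqr_ge0.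
apply: le_esum => e Ee; rewrite sumEFin lee_fin.
rewrite (eq_bigr (fun f => rnorm (inner (Y e) f) ^+ 2)) => [|f _].
  by apply: coefs_le; rewrite /finonb fset_setK.
by rewrite -adjPr -[inner f _]conjcK -innerC rnorm_conj.
Qed.

Lemma hs_adj X : hilbert_schmidt X -> hilbert_schmidt (adj X).
Proof. by rewrite /hilbert_schmidt /= hs_sqnorm_adj. Qed.

Lemma hs_norm_adj X : hs_norm (adj X) = hs_norm X.
Proof. by rewrite /hs_norm hs_sqnorm_adj. Qed.

Lemma hsMl A X : hilbert_schmidt X ->
  hilbert_schmidt (A * X) /\ hs_norm (A * X) <= opnorm A * hs_norm X.
Proof.
move=> hX; apply: hs_norm_le => [|K hK].
  by rewrite mulr_ge0 ?opnorm_ge0 ?hs_norm_ge0.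
rewrite exprMn (le_trans _ (ler_wpM2l (sqr_ge0 _) (hs_sum_le hX hK)))//.
rewrite mulr_sumr ler_sum// => e _; rewrite bopM -exprMn.
by rewrite ler_pXn2r ?nnegrE ?mulr_ge0 ?rnorm_ge0 ?opnorm_ge0// le_opnorm.
Qed.

Lemma hsMr A X : hilbert_schmidt X ->
  hilbert_schmidt (X * A) /\ hs_norm (X * A) <= hs_norm X * opnorm A.
Proof.
move=> /hs_adj /(hsMl (adj A)) [h1 h2]; rewrite -[X * A]adjK adjM.
by split; [exact: hs_adj|rewrite hs_norm_adj mulrC -(opnorm_adj A) -(hs_norm_adj X)].
Qed.

Lemma hsD X Y : hilbert_schmidt X -> hilbert_schmidt Y ->
  hilbert_schmidt (X + Y) /\ hs_norm (X + Y) <= hs_norm X + hs_norm Y.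
Proof.
move=> hX hY; set a := hs_norm X; set b := hs_norm Y.
have a0 : 0 <= a := hs_norm_ge0 X; have b0 : 0 <= b := hs_norm_ge0 Y.
have key (eps : R) : 0 < eps -> hilbert_schmidt (X + Y) /\
    hs_norm (X + Y) <= (a + eps) + (b + eps).
  move=> eps0; apply: hs_norm_le => [|K hK]; first by rewrite !addr_ge0// ltW.
  have ha : 0 < a + eps by rewrite ltr_wpDl.
  have hb : 0 < b + eps by rewrite ltr_wpDl.
  (* The weight minimizing (1 + t) a^2 + (1 + 1/t) b^2, whose minimum is (a + b)^2; eps keeps both
     norms positive. *)
  pose t := (b + eps) / (a + eps); have t0 : 0 < t by rewrite divr_gt0.
  apply: (@le_trans _ _ (\sum_(e <- K)
      ((1 + t) * rnorm (X e) ^+ 2 + (1 + t^-1) * rnorm (Y e) ^+ 2))).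
    apply: ler_sum => e _; rewrite bopD.
    apply: (@le_trans _ _ ((rnorm (X e) + rnorm (Y e)) ^+ 2)).
      by rewrite ler_pXn2r ?nnegrE ?addr_ge0 ?rnorm_ge0// rnormD.
    rewrite -subr_ge0.
    have -> : (1 + t) * rnorm (X e) ^+ 2 + (1 + t^-1) * rnorm (Y e) ^+ 2 -
        (rnorm (X e) + rnorm (Y e)) ^+ 2 = t^-1 * (t * rnorm (X e) - rnorm (Y e)) ^+ 2.
      by field; rewrite gt_eqF.
    by rewrite mulr_ge0 ?sqr_ge0// invr_ge0 ltW.
  rewrite big_split /= -!mulr_sumr.
  have hx := hs_sum_le hX hK; have hy := hs_sum_le hY hK.
  apply: (@le_trans _ _ ((1 + t) * (a + eps) ^+ 2 + (1 + t^-1) * (b + eps) ^+ 2)).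
    apply: lerD; rewrite ler_pM2l ?addr_gt0 ?invr_gt0//.
      rewrite (le_trans hx)// ler_pXn2r ?nnegrE ?addr_ge0 ?(ltW eps0)//.
      by rewrite lerDl ltW.
    rewrite (le_trans hy)// ler_pXn2r ?nnegrE ?addr_ge0 ?(ltW eps0)//.
    by rewrite lerDl ltW.
  rewrite /t invf_div le_eqVlt; apply/orP; left; apply/eqP; field.
  by rewrite !gt_eqF.
split; first by have [] := key 1 ltr01.
apply/ler_addgt0Pr => eps eps0; have [_] := key (eps / 2) ltac:(by rewrite divr_gt0).
by lra.
Qed.

Lemma hsZ (a : C) X : hilbert_schmidt X ->
  hilbert_schmidt (a *: X) /\ hs_norm (a *: X) = rnorm a * hs_norm X.
Proof.
have le b Y : hilbert_schmidt Y ->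
    hilbert_schmidt (b *: Y) /\ hs_norm (b *: Y) <= rnorm b * hs_norm Y.
  move=> hY; apply: hs_norm_le => [|K hK].
    by rewrite mulr_ge0 ?rnorm_ge0 ?hs_norm_ge0.
  rewrite exprMn (le_trans _ (ler_wpM2l (sqr_ge0 _) (hs_sum_le hY hK)))//.
  by rewrite mulr_sumr ler_sum// => e _; rewrite bopZ rnormZ exprMn.
move=> hX; have [haX leaX] := le a X hX; split=> //.
have [a0|a0] := eqVneq a 0.
  apply/eqP; rewrite eq_le leaX a0 rnorm0 mul0r; exact: hs_norm_ge0.
apply/eqP; rewrite eq_le leaX /=.
have [_] := le a^-1 _ haX; rewrite scalerA mulVf// scale1r.
have ra : 0 < rnorm a.
  by rewrite lt_neqAle rnorm_ge0 andbT eq_sym; apply: contra_neq a0 => /rnorm_eq0.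
have -> : rnorm a^-1 = (rnorm a)^-1.
  have ra0 : rnorm a != 0 by rewrite gt_eqF.
  by apply: (mulfI ra0); rewrite -rnormM mulfV// mulfV// /rnorm normr1.
by rewrite mulrC ler_pdivlMr// mulrC.
Qed.

Lemma hs_rk1 u v : hilbert_schmidt (rk1 u v) /\ hs_norm (rk1 u v) = rnorm u * rnorm v.
Proof.
have sumE K : \sum_(e <- K) rnorm (rk1 u v e) ^+ 2 = rnorm u ^+ 2 * coefs K v.
  rewrite /coefs mulr_sumr; apply: eq_bigr => e _.
  by rewrite rk1E rnormZ exprMn mulrC innerC rnorm_conj.
have [|K hK|hh hle] := @hs_norm_le (rk1 u v) (rnorm u * rnorm v).
- by rewrite mulr_ge0 ?rnorm_ge0.
- by rewrite sumE exprMn ler_wpM2l ?sqr_ge0// coefs_le.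
split=> //; apply/eqP; rewrite eq_le hle/=.
rewrite -(@ler_pXn2r _ 2)// ?nnegrE ?mulr_ge0 ?rnorm_ge0 ?hs_norm_ge0//.
have [u0|u0] := eqVneq (rnorm u ^+ 2) 0; first by rewrite exprMn u0 mul0r sqr_ge0.
have up : 0 < rnorm u ^+ 2 by rewrite lt_neqAle eq_sym u0 sqr_ge0.
rewrite exprMn mulrC -ler_pdivlMr// -lee_fin -parseval; apply/esum_onb_le => K hK.
by rewrite ler_pdivlMr// mulrC -/(coefs _ _) -sumE; exact: hs_sum_le.
Qed.

Lemma hs_sym_ideal : sym_ideal (@hilbert_schmidt R H) hs_norm.
Proof.
split; last by move=> u v; have [] := hs_rk1 u v.
- split.
  + have [+ _] := hs_rk1 (0 : H) 0; suff -> : rk1 (0 : H) 0 = 0 by [].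
    by apply: bopP => x; rewrite rk1E scaler0 bop0.
  + by move=> X Y hX hY; have [] := hsD hX hY.
  + by move=> A X B hX; have [h _] := hsMl A hX; have [] := hsMr B h.
- by move=> X Y hX hY; have [] := hsD hX hY.
- by move=> a X hX; have [] := hsZ a hX.
- move=> A X B hX; have [h le1] := hsMl A hX; have [_ le2] := hsMr B h.
  by rewrite (le_trans le2)// ler_wpM2r ?opnorm_ge0.
- by move=> u v; have [] := hs_rk1 u v.
Qed.

Lemma finite_rank_onbproj X K : finite_rank (X * onbproj K).
Proof.
exists (size K), (fun i => X (tnth (in_tuple K) i)) => x.
exists (fun i => inner x (tnth (in_tuple K) i)).
rewrite bopM onbprojE bop_sumr big_tnth; apply: eq_bigr => i _.
by rewrite bopZr.
Qed.

Lemma hs_approximable : approximable (@hilbert_schmidt R H) hs_norm.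
Proof.
move=> X hX eps eps0.
(* Leaving out less than eps^2 / 4 of the square sum puts X * [onbproj K] at Hilbert-Schmidt
   distance at most eps / 2: the difference D vanishes on K and agrees with X on the other basis
   vectors. *)
have [K hK XK] := @esum_onb_sub _ _ _ _ (eps ^+ 2 / 4)
  ltac:(by rewrite divr_gt0 ?exprn_gt0) (hs_normE hX).
exists (X * onbproj K).
  by split; [have [] := hsMr (onbproj K) hX|exact: finite_rank_onbproj].
have Ke e : e \in K -> onbproj K e = e.
  move=> eK; rewrite onbprojE (big_fsetD1 e)//= (inner_onb (hK e eK) (hK e eK)).
  rewrite eqxx scale1r big_seq big1 ?addr0// => f; rewrite !inE => /andP[fe fK].
  by rewrite (inner_onb (hK e eK) (hK f fK)) eq_sym (negPf fe) scale0r.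
have Kn e : onb e -> e \notin K -> onbproj K e = 0.
  move=> Ee eK; rewrite onbprojE big_seq big1// => f fK.
  rewrite (inner_onb Ee (hK f fK)); case: eqP => [ef|]; last by rewrite scale0r.
  by rewrite ef fK in eK.
have [D DX] : exists D, D = X - X * onbproj K by exists (X - X * onbproj K).
have DE e : D e = X e - X (onbproj K e) by rewrite DX.
rewrite -DX; have [| |_] := @hs_norm_le D (eps / 2).
- by rewrite divr_ge0// ltW.
- move=> L hL; pose M := (K `|` L)%fset; have hM : finonb M by exact: finonbU.
  have := hs_sum_le hX hM; rewrite (big_fsetID _ (mem K) M) /=.
  have -> : [fset e in M | e \in K]%fset = K.
    by apply/fsetP => e; rewrite !inE /= andbC; case: (e \in K).
  have : \sum_(e <- L) rnorm (D e) ^+ 2 <=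
      \sum_(i <- [fset x in M | x \notin K]%fset) rnorm (X i) ^+ 2.
    rewrite (big_fsetID _ (mem K) L) /= big_seq big1 ?add0r => [|e]; last first.
      rewrite !inE /= => /andP[_ eK].
      by rewrite DE Ke// subrr rnorm0 expr0n.
    have -> : [fset e in M | e \notin K]%fset = [fset e in L | e \notin K]%fset.
      by apply/fsetP => e; rewrite !inE /=; case: (e \in K); rewrite ?andbF.
    rewrite big_seq [leRHS]big_seq ler_sum// => e; rewrite !inE /= => /andP[eL eK].
    by rewrite DE (Kn e (hL e eL) eK) bop0r subr0.
  by move: XK; lra.
- by move=> /le_lt_trans; apply; lra.
Qed.

(** With S the square root of |T|, T = U S S and <T e, e> = <S e, S U^* e>, where S and S U^* are
    Hilbert-Schmidt. *)
Lemma trace_class_summable T : trace_class T -> exists c : R,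
  forall K, finonb K -> \sum_(e <- K) rnorm (inner (T e) e) <= c.
Proof.
move=> [P TP Pfin]; have [U [_ [TE _ _ _]]] := polar TP.
have [P0 _] := TP; have [S S0 SE] := positive_sqrt P0.
have Se e : rnorm (S e) ^+ 2 = complex.Re (inner (P e) e).
  by rewrite -SE bopM positive_op_sym// innerxxE.
have hS : hilbert_schmidt S.
  rewrite /hilbert_schmidt /= /hs_sqnorm; apply: le_lt_trans Pfin.
  by apply: le_esum => e _; rewrite lee_fin Se.
have hSU : hilbert_schmidt (S * adj U) by have [] := hsMr (adj U) hS.
exists (hs_norm S ^+ 2 + hs_norm (S * adj U) ^+ 2) => K hK.
apply: le_trans (lerD (hs_sum_le hS hK) (hs_sum_le hSU hK)).
rewrite -big_split /=; apply: ler_sum => e _.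
rewrite TE -SE !bopM adjP positive_op_sym// (le_trans (cauchy_schwarz _ _))//.
have := sqr_ge0 (rnorm (S e) - rnorm (S (adj U e))).
have := sqr_ge0 (rnorm (S e)); have := sqr_ge0 (rnorm (S (adj U e))).
by nra.
Qed.

End hilbert_schmidt.

(** * Uniform boundedness *)

Section uniform_boundedness.
Context {R : realType} {V : lmodType R[i]}.
Local Notation C := R[i].
Implicit Types (J : set V) (p q : V -> R).

Definition seminorm_on J p : Prop :=
  (forall x y, J x -> J y -> p (x + y) <= p x + p y) /\
  (forall (a : C) x, J x -> p (a *: x) = rnorm a * p x).

Variables (J : set V) (M : V -> R) (Q : set (V -> R)).
Hypothesis J0 : J 0.
Hypothesis JD : forall x y, J x -> J y -> J (x + y).
Hypothesis JZ : forall (a : C) x, J x -> J (a *: x).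

Let JB x y : J x -> J y -> J (x - y).
Proof. by move=> Jx Jy; rewrite -scaleN1r; apply: JD => //; exact: JZ. Qed.

Section seminorm_facts.
Variable p : V -> R.
Hypothesis pJ : seminorm_on J p.

Lemma seminorm0 : p 0 = 0.
Proof. by have [_ h] := pJ; have := h 0 _ J0; rewrite scale0r rnorm0 mul0r. Qed.

Lemma seminormZr (r : R) x : J x -> p (r%:C *: x) = `|r| * p x.
Proof. by have [_ h] := pJ; move=> /h ->; rewrite rnorm_real. Qed.

Lemma seminormN x : J x -> p (- x) = p x.
Proof.
have [_ h] := pJ; move=> Jx.
by rewrite -scaleN1r h// rnormN /rnorm normr1 mul1r.
Qed.

Lemma seminormB x y : J x -> J y -> p (x - y) = p (y - x).
Proof. by move=> Jx Jy; rewrite -opprB seminormN//; exact: JB. Qed.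

Lemma seminorm_ge0 x : J x -> 0 <= p x.
Proof.
move=> Jx; have [h _] := pJ; have := h x (- x) Jx.
have JN : J (- x) by rewrite -scaleN1r; exact: JZ.
by rewrite subrr seminorm0 seminormN// => /(_ JN); lra.
Qed.

End seminorm_facts.

Hypothesis MJ : seminorm_on J M.
Hypothesis Jcomplete : forall u : nat -> V, (forall n, J (u n)) ->
  (forall e : R, 0 < e -> exists n0, forall m n, (n0 <= m)%N -> (n0 <= n)%N ->
     M (u m - u n) < e) ->
  exists2 x, J x & (fun n => M (u n - x)) @ \oo --> (0 : R).
Hypothesis QJ : forall q, Q q -> seminorm_on J q.
Hypothesis QM : forall q, Q q -> exists c : R, forall x, J x -> q x <= c * M x.

Let S q := sup [set q x | x in [set x | J x /\ M x <= 1]].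

Let has_sup_S q : Q q -> has_sup [set q x | x in [set x | J x /\ M x <= 1]].
Proof.
move=> Qq; split.
  by exists (q 0), 0 => //; split=> //; rewrite (seminorm0 MJ).
have [c qc] := QM Qq; exists `|c| => _ [x [Jx Mx] <-].
rewrite (le_trans (qc _ Jx))// (@le_trans _ _ (`|c| * M x))//.
  by rewrite ler_wpM2r ?(seminorm_ge0 MJ)// ler_norm.
by rewrite ler_piMr.
Qed.

Let le_S q x : Q q -> J x -> q x <= S q * M x.
Proof.
move=> Qq Jx; have [M0|M0] := eqVneq (M x) 0.
  by have [c qc] := QM Qq; rewrite (le_trans (qc _ Jx))// M0 !mulr0.
have Mp : 0 < M x by rewrite lt_neqAle eq_sym M0 (seminorm_ge0 MJ).
rewrite -ler_pdivrMr//.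
have -> : q x / M x = q ((M x)^-1%:C *: x).
  by rewrite (seminormZr (QJ Qq))// ger0_norm ?invr_ge0 ?(ltW Mp)// mulrC.
apply: ub_le_sup; first by case: (has_sup_S Qq).
exists ((M x)^-1%:C *: x) => //; split; first exact: JZ.
by rewrite (seminormZr MJ)// ger0_norm ?invr_ge0 ?(ltW Mp)// mulVf.
Qed.

(* Sokal's gliding hump: add 3^-n times an almost norming vector of the n-th
   seminorm, with the sign that does not decrease this seminorm. *)
Lemma uniform_boundedness :
  (forall x, J x -> exists K : R, forall q, Q q -> q x <= K) ->
  exists2 c : R, 0 <= c & forall q x, Q q -> J x -> q x <= c * M x.
Proof.
move=> Qpt; apply: contrapT => unb.
pose t (n : nat) : R := 3^-1 ^+ n.
have t0 n : 0 < t n by rewrite exprn_gt0// invr_gt0.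
have tS n : t n = 3 * t n.+1 by rewrite /t exprS mulrA mulfV ?mul1r.
have large (B : R) : 0 <= B -> exists2 q, Q q & B < S q.
  move=> B0; apply: contrapT => h; apply: unb; exists B => // q x Qq Jx.
  rewrite (le_trans (le_S Qq Jx))// ler_wpM2r ?(seminorm_ge0 MJ)// leNgt.
  by apply/negP => ?; apply: h; exists q.
(* The factor 6 pays for the end of the proof: the n-th hump contributes 2/3 t_n S, the later ones
   remove at most 1/2 t_n S, and the remaining t_n S / 6 exceeds n. *)
have /choice[qz /all_and4[Qq Sq Jz /all_and2[Mz qzS]]] : forall n : nat,
    exists qz : (V -> R) * V,
    [/\ Q qz.1, 6 * n%:R / t n < S qz.1, J qz.2 &
        M qz.2 <= t n /\ 2 / 3 * t n * S qz.1 <= qz.1 qz.2].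
  move=> n; have B0 : 0 <= 6 * n%:R / t n by rewrite !mulr_ge0// invr_ge0 ltW.
  have [q Qq Bq] := large _ B0; have Sq0 : 0 < S q := le_lt_trans B0 Bq.
  have [_ [x [Jx Mx] <-] qx] := @sup_adherent _ _ (S q / 3)
    ltac:(by rewrite divr_gt0) (has_sup_S Qq).
  exists (q, (t n)%:C *: x) => /=; split=> //; first exact: JZ.
  rewrite (seminormZr MJ)// (seminormZr (QJ Qq))// ger0_norm ?(ltW (t0 n))//; split.
    by rewrite ler_piMr// (ltW (t0 n)).
  by rewrite [2 / 3 * _]mulrC -mulrA ler_pM2l//; move: qx; rewrite -/(S q); lra.
pose q n := (qz n).1; pose z n := (qz n).2.
pose u := fix u n := if n is n'.+1 then
  (if q n' (z n') <= q n' (u n' + z n') then u n' + z n' else u n' - z n') else 0.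
have uS n : u n.+1 = if q n (z n) <= q n (u n + z n) then u n + z n else u n - z n by [].
have Ju n : J (u n).
  elim: n => [|n IH]; first exact: J0.
  by rewrite uS; case: ifP => _; [exact: JD IH (Jz n)|exact: JB IH (Jz n)].
have Mu n : M (u n.+1 - u n) <= t n.
  rewrite uS; case: ifP => _; rewrite addrAC subrr add0r ?(seminormN MJ (Jz n));
  exact: Mz.
have qu n : 2 / 3 * t n * S (q n) <= q n (u n.+1).
  apply: (le_trans (qzS n)); rewrite uS; case: ifPn => //; rewrite -ltNge => h.
  have qJ : seminorm_on J (q n) := QJ (Qq n); have [qD _] := qJ.
  have : 2 * q n (z n) <= q n (u n + z n) + q n (u n - z n).
    rewrite [q n (u n - _)](seminormB qJ (Ju n) (Jz n)).
    apply: le_trans (qD _ _ (JD (Ju n) (Jz n)) (JB (Jz n) (Ju n))).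
    rewrite [u n + _ + _]addrC addrA subrK.
    have -> : z n + z n = (2 : R)%:C *: z n by rewrite rmorph_nat scaler_nat mulr2n.
    by rewrite (seminormZr qJ _ (Jz n)) ger0_norm.
  by rewrite -/(q n) -/(z n); lra.
have Mtail n k : M (u (n + k)%N - u n) <= 3 / 2 * (t n - t (n + k)%N).
  elim: k => [|k IH]; first by rewrite addn0 !subrr (seminorm0 MJ) mulr0.
  rewrite addnS -(subrKA (u (n + k)%N)).
  have [MD _] := MJ; apply: le_trans (MD _ _ (JB (Ju _) (Ju _)) (JB (Ju _) (Ju _))) _.
  by have := Mu (n + k)%N; have := tS (n + k)%N; lra.
have Mtail' n m : (n <= m)%N -> M (u m - u n) <= 3 / 2 * t n.
  by move=> nm; have := Mtail n (m - n)%N; rewrite subnKC//; have := t0 m; lra.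
have t_cvg : t @ \oo --> (0 : R).
  by apply: cvg_expr; rewrite ger0_norm ?invr_ge0// invf_lt1// ltr1n.
have [x Jx ux] : exists2 x, J x & (fun n => M (u n - x)) @ \oo --> (0 : R).
  apply: Jcomplete => // e e0.
  move/cvgrPdist_lt : t_cvg => /(_ (e / 3) ltac:(by rewrite divr_gt0))[n0 _ hn0].
  exists n0 => m n n0m n0n; rewrite -(subrKA (u n0)).
  have [MD _] := MJ; apply: le_lt_trans (MD _ _ (JB (Ju _) (Ju _)) (JB (Ju _) (Ju _))) _.
  rewrite [M (u n0 - u n)](seminormB MJ)//.
  have := Mtail' _ _ n0m; have := Mtail' _ _ n0n.
  have := hn0 n0 (leqnn n0); rewrite /= sub0r normrN ger0_norm ?(ltW (t0 n0))//; lra.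
have [K hK] := Qpt x Jx.
have [n Kn] : exists n : nat, K < n%:R.
  by exists (Num.truncn `|K|).+1; rewrite (le_lt_trans (ler_norm _))// truncnS_gt.
have := hK _ (Qq n); apply/negP; rewrite -ltNge; apply: (lt_le_trans Kn).
have Sn := Sq n; have Sn0 : 0 < S (q n).
  by apply: le_lt_trans Sn; rewrite !mulr_ge0// invr_ge0 ltW.
(* The humps after the n-th sum to at most 3/2 t_{n+1} = t_n / 2. *)
have Mx : M (x - u n.+1) <= t n / 2.
  apply/ler_addgt0Pr => e e0.
  have [m nm h] : exists2 m, (n < m)%N & M (u m - x) < e.
    move/cvgrPdist_lt : ux => /(_ _ e0)[n1 _ hn1]; exists (maxn n1 n.+1).
      exact: leq_maxr.
    have := hn1 _ (leq_maxl n1 n.+1); rewrite /= sub0r normrN.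
    exact: le_lt_trans (ler_norm _).
  rewrite -(subrKA (u m)).
  have [MD _] := MJ; apply: le_trans (MD _ _ (JB Jx (Ju _)) (JB (Ju _) (Ju _))) _.
  rewrite (seminormB MJ)//.
  by have := Mtail' _ _ nm; have := tS n; lra.
have qJ : seminorm_on J (q n) := QJ (Qq n); have [qD _] := qJ.
have : q n (u n.+1) <= q n x + S (q n) * (t n / 2).
  rewrite -[u n.+1](subrKC x) (le_trans (qD _ _ Jx (JB (Ju _) Jx)))// lerD2l.
  rewrite (seminormB qJ)// (le_trans (le_S (Qq n) (JB Jx (Ju _))))//.
  by rewrite ler_pM2l.
have := qu n; move: Sn; rewrite ltr_pdivrMr// -/(q n).
move: (S (q n)) (t n) (q n x) (q n (u n.+1)) n%:R => s tt a b m; nra.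
Qed.

End uniform_boundedness.

(** * Seminorm topologies *)

Section seminorm_topologies.
Context {R : realType} {E : lmodType R[i]}.
Local Notation C := R[i].
Implicit Types (P Q : set (E -> R)) (p q : E -> R).

Definition seminorms P : Prop := forall p, P p -> seminorm_on setT p.

Section one_family.
Variable P : set (E -> R).
Hypothesis PE : seminorms P.

(** The subbasic balls have arbitrary centres c; by the triangle inequality each contains a ball
    around its point x, of radius r - p (x - c). *)
Lemma nbhs_seminormP (x : seminorm_space P) (U : set (seminorm_space P)) :
  nbhs x U <-> exists n (q : 'I_n -> E -> R) (e : 'I_n -> R),
    (forall i, P (q i) /\ 0 < e i) /\
    forall y, (forall i, q i (y - x) < e i) -> U y.
Proof.
split=> [|[n [q [e [Pq qU]]]]].
  rewrite nbhsE => -[V [Vop Vx] VU].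
  case: Vop => D' D'f Vcup; move: Vx; rewrite -Vcup => -[B D'B Bx].
  have [F FD FB] := D'f _ D'B.
  pose F_ (i : 'I_(size F)) := tnth (in_tuple F) i.
  have F_F i : F_ i \in F by exact: mem_tnth.
  have Fx i : F_ i x by move: Bx; rewrite -FB => /(_ _ (F_F i)).
  have /choice[pr prP] : forall i, exists pr : (E -> R) * R, [/\ P pr.1, 0 < pr.2 &
      forall y, pr.1 (y - x) < pr.2 -> F_ i y].
    move=> i; have /set_mem [p [c [r [Pp r0 FE]]]] := FD _ (F_F i).
    have [pD _] := PE Pp.
    have px : p (x - c) < r by move: (Fx i); rewrite FE.
    exists (p, r - p (x - c)); split=> //=; first by rewrite subr_gt0.
    move=> y; rewrite FE /= -{2}(subrK x y) -addrA => ?.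
    by rewrite (le_lt_trans (pD _ _ I I))// addrC -ltrBrDr addrC; lra.
  exists (size F), (fun i => (pr i).1), (fun i => (pr i).2); split.
    by move=> i; have [] := prP i.
  move=> y yF; apply: VU; rewrite -Vcup; exists B => //.
  suff : B y by []; rewrite -FB => A AF.
  have /tnthP[i ->] : A \in in_tuple F by [].
  by have [_ _] := prP i; apply.
apply: (@filterS _ _ _ [set y | forall i, q i (y - x) < e i]) => //.
suff h i : nbhs x [set y | q i (y - x) < e i] by exact: filter_forall h.
have [Pqi e0] := Pq i.
apply: open_nbhs_nbhs; split; last by rewrite /= subrr (seminorm0 I (PE Pqi)).
exists [set [set y | q i (y - x) < e i]]; last by rewrite bigcup_set1.
move=> _ ->.
by apply: (@finI_from1 _ _ (seminorm_balls P) id); exists (q i), x, (e i).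
Qed.

Definition dominated p : Prop := exists n (q : 'I_n -> E -> R) (c : R),
  [/\ 0 <= c, forall i, P (q i) & forall x, p x <= c * \sum_i q i x].

Lemma nbhs0_dominated p : seminorm_on setT p ->
  nbhs (0 : seminorm_space P) [set x | p x < 1] -> dominated p.
Proof.
move=> pE /nbhs_seminormP[n [q [e [Pq qp]]]].
have q0 i x : 0 <= q i x.
  by have [Pqi _] := Pq i; exact: (@seminorm_ge0 _ _ setT I (fun _ _ _ => I) _ (PE Pqi)).
have e0 i : 0 < e i by have [] := Pq i.
exists n, q, (\sum_i (e i)^-1); split=> [|i|x].
- by rewrite sumr_ge0// => i _; rewrite invr_ge0 ltW.
- by have [] := Pq i.
apply: (@le_trans _ _ (\sum_i (e i)^-1 * q i x)); last first.
  rewrite mulr_sumr ler_sum// => i _; rewrite ler_wpM2r//.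
  by rewrite (bigD1 i)//= lerDl sumr_ge0// => j _; rewrite invr_ge0 ltW.
(* Dividing x by s moves it into the neighborhood, and homogeneity then bounds p x by s. The margin
   d makes s positive and the inequalities strict. *)
apply/ler_addgt0Pr => d d0; set s := _ + d.
have si i : (e i)^-1 * q i x < s.
  rewrite /s (bigD1 i)//= -addrA ltrDl ltr_wpDl// sumr_ge0// => j _.
  by rewrite mulr_ge0// invr_ge0 ltW.
have s0 : 0 < s.
  by rewrite /s ltr_wpDl// sumr_ge0// => j _; rewrite mulr_ge0// invr_ge0 ltW.
have : p ((s^-1)%:C *: x) < 1.
  apply: qp => i; rewrite subr0; have [Pqi _] := Pq i.
  rewrite (seminormZr (PE Pqi))// ger0_norm ?invr_ge0 ?(ltW s0)//.
  by rewrite mulrC ltr_pdivrMr// -ltr_pdivrMl.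
rewrite (seminormZr pE)// ger0_norm ?invr_ge0 ?(ltW s0)//.
by rewrite mulrC ltr_pdivrMr// mul1r => /ltW.
Qed.

Lemma dominated_nbhs p (x : seminorm_space P) (eps : R) : 0 < eps -> dominated p ->
  nbhs x [set y | p (y - x) < eps].
Proof.
move=> eps0 [n [q [c [c0 Pq pq]]]]; apply/nbhs_seminormP.
have d0 : 0 < eps / ((c + 1) * (n%:R + 1)).
  by rewrite divr_gt0// mulr_gt0 ?ltr_wpDl.
exists n, q, (fun=> eps / ((c + 1) * (n%:R + 1))); split=> // y qy.
apply: (le_lt_trans (pq _)).
apply: (@le_lt_trans _ _ (c * \sum_(i < n) (eps / ((c + 1) * (n%:R + 1))))).
  by rewrite ler_wpM2l// ler_sum// => i _; exact: ltW.
rewrite sumr_const card_ord -(mulr_natl (_ / _)).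
have D0 : 0 < (c + 1) * (n%:R + 1) by rewrite mulr_gt0 ?ltr_wpDl.
rewrite !mulrA ltr_pdivrMr// [ltRHS]mulrC ltr_pM2r//.
have : 0 <= n%:R :> R by [].
by nra.
Qed.

Lemma dominated_self p : P p -> dominated p.
Proof. by move=> Pp; exists 1%N, (fun=> p), 1; split=> // x; rewrite big_ord1 mul1r. Qed.

Lemma lc_boundedP (A : set E) : lc_bounded (seminorm_space P) A <->
  forall p, P p -> exists K : R, forall x, A x -> p x <= K.
Proof.
split=> [Ab p Pp|PA U /nbhs_seminormP[n [q [e [Pq qU]]]]].
  have := dominated_nbhs (0 : seminorm_space P) ltr01 (dominated_self Pp).
  move=> /Ab[r r0 /(_ r%:C)].
  rewrite rnorm_real ger0_norm ?(ltW r0)// => /(_ (lexx _)) Ar.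
  exists r => x /Ar[u /= pu <-]; rewrite (seminormZr (PE Pp))// ger0_norm ?(ltW r0)//.
  by rewrite ler_piMr ?(ltW r0)//; move: pu; rewrite subr0 => /ltW.
have /choice[K KP] : forall i, exists K, forall x, A x -> q i x <= K.
  by move=> i; apply: PA; have [] := Pq i.
have e0 i : 0 < e i by have [] := Pq i.
pose r := \sum_i `|K i| / e i + 1.
have Ki0 i : 0 <= `|K i| / e i by rewrite divr_ge0// ltW.
have r0 : 0 < r by rewrite ltr_wpDl// sumr_ge0.
exists r => // t rt x Ax; have t0 : 0 < rnorm t := lt_le_trans r0 rt.
have tn0 : t != 0 by apply: contraTneq t0 => ->; rewrite rnorm0 ltxx.
exists (t^-1 *: x); last by rewrite scalerA mulfV// scale1r.
apply: qU => i; rewrite subr0; have [Pqi _] := Pq i; have [_ qZ] := PE Pqi.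
rewrite qZ// rnormV mulrC ltr_pdivrMr//; apply: (le_lt_trans (KP i x Ax)).
rewrite (le_lt_trans (ler_norm _))// -ltr_pdivrMl// mulrC (lt_le_trans _ rt)//.
by rewrite /r (bigD1 i)//= -addrA ltrDl ltr_wpDl// sumr_ge0.
Qed.

Lemma continuous_dualP (f : E -> C) :
  continuous_dual (seminorm_space P) f <-> scalar f /\ dominated (fun x => rnorm (f x)).
Proof.
have fE : scalar f ->
    seminorm_on setT (fun x => rnorm (f x)) /\ forall x y, f (x - y) = f x - f y.
  move=> fl.
  have fD x y : f (x + y) = f x + f y by have := fl 1 x y; rewrite scale1r mul1r.
  have f0 : f 0 = 0 by apply: (addIr (f 0)); rewrite -fD addr0 add0r.
  have fZ a x : f (a *: x) = a * f x by have := fl a x 0; rewrite !addr0 f0 addr0.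
  split; last by move=> x y; rewrite -scaleN1r fD fZ mulN1r.
  split=> [x y _ _|a x _]; first by rewrite fD rnormD.
  by rewrite fZ rnormM.
split=> [[fl fc]|[fl fdom]]; split=> //; have [fS fB] := fE fl.
  apply: nbhs0_dominated => //.
  have := fc (0 : seminorm_space P) => /cvgrPdist_lt /(_ 1 ltr01).
  by apply: filterS => x /=; rewrite -rnormE ltcR rnormB -fB subr0.
move=> x; have nF : Filter (nbhs (x : seminorm_space P)) by exact: nbhs_filter.
apply/(@cvgrPdist_lt _ _ _ _ nF) => e e0.
have [eR e0'] : e = (complex.Re e)%:C /\ 0 < complex.Re e.
  by case: e e0 => a b; rewrite ltcE /= => /andP[/eqP -> ->].
apply: filterS (dominated_nbhs x e0' fdom) => y /=.
by rewrite fB rnormB => ?; rewrite -rnormE [ltRHS]eR ltcR.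
Qed.

Lemma dominated_sum n p (q : 'I_n -> E -> R) (c : 'I_n -> R) :
  (forall i, 0 <= c i) -> (forall i, P (q i)) ->
  (forall x, p x <= \sum_i c i * q i x) -> dominated p.
Proof.
move=> c0 Pq pq; exists n, q, (\sum_i c i); split=> //; first exact: sumr_ge0.
move=> x; apply: (le_trans (pq x)); rewrite mulr_sumr ler_sum// => i _.
rewrite ler_wpM2r//.
  exact: (@seminorm_ge0 _ _ setT I (fun _ _ _ => I) _ (PE (Pq i))).
by rewrite (bigD1 i)//= lerDl sumr_ge0.
Qed.

Lemma nbhs_seminormS (x : seminorm_space P) (A B : set E) :
  A `<=` B -> nbhs x A -> nbhs x B.
Proof. by move=> AB; exact: filterS. Qed.

End one_family.

Lemma dominated_nbhs_sub P Q : seminorms P -> seminorms Q ->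
  (forall p, P p -> dominated Q p) ->
  forall (x : E) (U : set E),
  nbhs (x : seminorm_space P) U -> nbhs (x : seminorm_space Q) U.
Proof.
move=> PE QE PQ x U /(nbhs_seminormP PE)[n [q [e [Pq qU]]]].
apply: (@filterS _ _ _ [set y | forall i, q i (y - x) < e i]) => //.
suff h i : nbhs (x : seminorm_space Q) [set y | q i (y - x) < e i].
  exact: filter_forall h.
by have [Pqi e0] := Pq i; apply: dominated_nbhs => //; exact: PQ.
Qed.

Lemma dominated_open_sub P Q : seminorms P -> seminorms Q ->
  (forall p, P p -> dominated Q p) ->
  @open (seminorm_space P) `<=` @open (seminorm_space Q).
Proof.
move=> PE QE PQ U; rewrite !openE => h x Ux.
by apply: (@dominated_nbhs_sub P Q) => //; exact: h.
Qed.

Lemma open_sub_dominated P Q : seminorms P -> seminorms Q ->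
  @open (seminorm_space P) `<=` @open (seminorm_space Q) ->
  forall p, P p -> dominated Q p.
Proof.
move=> PE QE PQ p Pp; apply: nbhs0_dominated => //; first exact: PE.
have := dominated_nbhs PE (0 : seminorm_space P) ltr01 (dominated_self Pp).
rewrite nbhsE => -[V [/PQ Vo V0] VU]; rewrite nbhsE; exists V => //.
by move=> x /VU /=; rewrite subr0.
Qed.

Lemma coincide_on_seminorms P Q (S : set E) : seminorms P -> seminorms Q ->
  (forall p x (eps : R), P p -> S x -> 0 < eps ->
    nbhs (x : seminorm_space Q) [set y | S y -> p (y - x) < eps]) ->
  (forall q x (eps : R), Q q -> S x -> 0 < eps ->
    nbhs (x : seminorm_space P) [set y | S y -> q (y - x) < eps]) ->
  coincide_on (@open (seminorm_space P)) (@open (seminorm_space Q)) S.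
Proof.
suff main P' Q' : seminorms P' -> seminorms Q' ->
  (forall p x (eps : R), P' p -> S x -> 0 < eps ->
    nbhs (x : seminorm_space Q') [set y | S y -> p (y - x) < eps]) ->
  [set S `&` U | U in @open (seminorm_space P')] `<=`
  [set S `&` U | U in @open (seminorm_space Q')].
  by move=> PE QE PQ QP; apply/seteqP; split; [exact: (main P Q)|exact: (main Q P)].
move=> PE QE PQ _ [U Uo <-].
(* The largest open set of the other topology whose trace on S lies in U. *)
exists (\bigcup_(W in [set W | @open (seminorm_space Q') W /\ S `&` W `<=` U]) W).
  by apply: bigcup_open => W [].
apply/seteqP; split=> [x [Sx [W [_ WU] Wx]]|x [Sx Ux]]; first by split=> //; exact: WU.
split=> //.
have : nbhs (x : seminorm_space P') U by apply: open_nbhs_nbhs.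
move=> /(nbhs_seminormP PE)[n [q [e [Pq qU]]]].
have h i : nbhs (x : seminorm_space Q') [set y | S y -> q i (y - x) < e i].
  by have [Pqi e0] := Pq i; exact: PQ.
have := filter_forall (nbhs_filter (x : seminorm_space Q')) h.
rewrite nbhsE => -[W [Wo Wx] WU]; exists W => //.
split=> // y [Sy /WU h']; by apply: qU => i; exact: h'.
Qed.

End seminorm_topologies.

(** * Multiplier topologies *)

Section multiplier_seminorms.
Context {R : realType} {H : hilbertType R}.
Local Notation C := R[i].
Implicit Types (I J : set (bop H)) (N M : bop H -> R).
Implicit Types (X Y Z A B T : bop H) (x y u v e f : H) (K L : {fset H}).

Lemma left_seminorm_on I N Y : sym_ideal I N -> I Y ->
  seminorm_on setT (fun X => N (X * Y)).
Proof.
move=> IN IY; split=> [X Z _ _|a X _].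
  by rewrite mulrDl; apply: (sym_ideal_ler_normD IN); exact: (sym_idealMl IN _ IY).
by rewrite bopZM (sym_ideal_normZ IN)//; exact: (sym_idealMl IN _ IY).
Qed.

Lemma right_seminorm_on I N Y : sym_ideal I N -> I Y ->
  seminorm_on setT (fun X => N (Y * X)).
Proof.
move=> IN IY; split=> [X Z _ _|a X _].
  by rewrite mulrDr; apply: (sym_ideal_ler_normD IN); exact: (sym_idealMr IN _ IY).
by rewrite bopMZ (sym_ideal_normZ IN)//; exact: (sym_idealMr IN _ IY).
Qed.

Lemma left_seminormsP I N : sym_ideal I N -> seminorms (left_seminorms I N).
Proof. by move=> IN _ [Y IY <-]; exact: left_seminorm_on IN IY. Qed.

Lemma star_seminormsP I N : sym_ideal I N ->
  seminorms (left_seminorms I N `|` right_seminorms I N).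
Proof.
by move=> IN _ [[Y IY <-]|[Y IY <-]];
  [exact: left_seminorm_on IN IY|exact: right_seminorm_on IN IY].
Qed.

(** A family between the left and the bilateral seminorms covers both topologies at once.
    Boundedness tested at [rk1 x x] bounds |T x| |x| for each x, the pointwise hypothesis of uniform
    boundedness. *)
Lemma multiplier_bounded I N : sym_ideal I N -> forall P : set (bop H -> R),
  left_seminorms I N `<=` P -> P `<=` left_seminorms I N `|` right_seminorms I N ->
  forall S : set (bop H),
    lc_bounded (seminorm_space P) S <-> norm_bounded S.
Proof.
move=> IN P leftP Pstar S.
have PE : seminorms P by move=> p /Pstar; exact: star_seminormsP.
split=> [/(lc_boundedP PE) Sb|[c Sc]]; last first.
  apply/(lc_boundedP PE) => p /Pstar[[Y IY <-]|[Y IY <-]]; exists (c * N Y) => T ST.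
    rewrite (le_trans (sym_ideal_norm_mull IN _ IY))//.
    by rewrite ler_wpM2r ?(sym_ideal_norm_ge0 IN IY)// Sc.
  rewrite (le_trans (sym_ideal_norm_mulr IN _ IY))// mulrC.
  by rewrite ler_wpM2r ?(sym_ideal_norm_ge0 IN IY)// Sc.
pose Q := [set fun x => rnorm (T x) | T in S].
have rnorm_seminorm : seminorm_on setT (@rnorm R H).
  by split=> [x y _ _|a x _]; [exact: rnormD|exact: rnormZ].
have [||||||||c c0 Qc] := @uniform_boundedness R H setT (@rnorm R H) Q => //.
- move=> w _ wC; have [l wl] := hilbert_complete wC; by exists l.
- move=> _ [T ST <-]; split=> [x y _ _|a x _]; first by rewrite bopDr rnormD.
  by rewrite bopZr rnormZ.
- by move=> _ [T ST <-]; exists (opnorm T) => x _; exact: le_opnorm.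
- move=> x _; have [c hc] : exists c : R, forall T, S T -> N (T * rk1 x x) <= c.
    by apply: Sb; apply: leftP; exists (rk1 x x) => //; exact: (sym_ideal_rk1 IN).
  have [x0|x0] := eqVneq (rnorm x) 0.
    by exists 0 => _ [T ST <-]; rewrite (rnorm_eq0 x0) bop0r rnorm0.
  have xp : 0 < rnorm x by rewrite lt_neqAle eq_sym x0 rnorm_ge0.
  exists (c / rnorm x) => _ [T ST <-]; rewrite ler_pdivlMr//.
  by have := hc T ST; rewrite mulr_rk1 (sym_ideal_norm_rk1 IN).
exists c => T ST; apply: opnorm_le => // x; apply: (Qc (fun x => rnorm (T x))) => //.
by exists T.
Qed.

(** Split Z = (Z - F) + F with F of finite rank. On S the first part contributes at most 2c N (Z -
    F); the second is a finite sum of rank-one terms, where N and M agree. *)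
Lemma approximable_local_left I J N M Z (S : set (bop H)) X (eps : R) Q :
  sym_ideal I N -> approximable I N -> sym_ideal J M -> seminorms Q ->
  left_seminorms J M `<=` Q -> norm_bounded S -> I Z -> S X -> 0 < eps ->
  nbhs (X : seminorm_space Q) [set Y | S Y -> N ((Y - X) * Z) < eps].
Proof.
move=> IN Iapp JM QE JQ [c Sc] IZ SX eps0.
have c0 : 0 <= c := le_trans (opnorm_ge0 X) (Sc X SX).
have d0 : 0 < eps / 2 / (c + c + 1) by rewrite !divr_gt0// ltr_wpDl ?addr_ge0.
have [F [IF /finite_rank_sum[n [u [v FE]]]] ZF] := Iapp Z IZ _ d0.
have FQ : dominated Q (fun Y => N (Y * F)).
  exists n, (fun i Y => M (Y * rk1 (u i) (v i))), 1; split=> // [i|Y].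
    by apply: JQ; exists (rk1 (u i) (v i)) => //; exact: (sym_ideal_rk1 JM).
  rewrite mul1r FE mulr_sumr (le_trans (sym_ideal_norm_sum IN _ _))//.
    by move=> i _; rewrite mulr_rk1; exact: (sym_ideal_rk1 IN).
  apply: ler_sum => i _; rewrite mulr_rk1.
  by rewrite (sym_ideal_norm_rk1 IN) (sym_ideal_norm_rk1 JM).
have eps2 : 0 < eps / 2 by rewrite divr_gt0.
apply: nbhs_seminormS (dominated_nbhs QE (X : seminorm_space Q) eps2 FQ).
move=> Y /= YF SY.
have -> : (Y - X) * Z = (Y - X) * (Z - F) + (Y - X) * F by rewrite -mulrDr subrK.
have IZF : I (Z - F) by exact: (sym_idealB IN IZ IF).
have := sym_ideal_ler_normD IN (sym_idealMl IN (Y - X) IZF) (sym_idealMl IN (Y - X) IF).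
move=> /le_lt_trans; apply; rewrite [ltRHS]splitr ltr_leD//; last exact: ltW.
rewrite (le_lt_trans (sym_ideal_norm_mull IN _ IZF))//.
have YX : opnorm (Y - X) <= c + c.
  by rewrite (le_trans (opnormD _ _))// opnormN lerD// Sc.
have ZF0 := sym_ideal_norm_ge0 IN IZF.
apply: (@le_lt_trans _ _ ((c + c) * N (Z - F))); first by rewrite ler_wpM2r.
move: ZF; rewrite ltr_pdivlMr ?ltr_wpDl ?addr_ge0//.
by move: ZF0; move: (N _) => a ? ?; nra.
Qed.

Lemma approximable_local_right I J N M Z (S : set (bop H)) X (eps : R) Q :
  sym_ideal I N -> approximable I N -> sym_ideal J M -> seminorms Q ->
  right_seminorms J M `<=` Q -> norm_bounded S -> I Z -> S X -> 0 < eps ->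
  nbhs (X : seminorm_space Q) [set Y | S Y -> N (Z * (Y - X)) < eps].
Proof.
move=> IN Iapp JM QE JQ [c Sc] IZ SX eps0.
have c0 : 0 <= c := le_trans (opnorm_ge0 X) (Sc X SX).
have d0 : 0 < eps / 2 / (c + c + 1) by rewrite !divr_gt0// ltr_wpDl ?addr_ge0.
have [F [IF /finite_rank_sum[n [u [v FE]]]] ZF] := Iapp Z IZ _ d0.
have FQ : dominated Q (fun Y => N (F * Y)).
  exists n, (fun i Y => M (rk1 (u i) (v i) * Y)), 1; split=> // [i|Y].
    by apply: JQ; exists (rk1 (u i) (v i)) => //; exact: (sym_ideal_rk1 JM).
  rewrite mul1r FE mulr_suml (le_trans (sym_ideal_norm_sum IN _ _))//.
    by move=> i _; rewrite rk1_mulr; exact: (sym_ideal_rk1 IN).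
  apply: ler_sum => i _; rewrite rk1_mulr.
  by rewrite (sym_ideal_norm_rk1 IN) (sym_ideal_norm_rk1 JM).
have eps2 : 0 < eps / 2 by rewrite divr_gt0.
apply: nbhs_seminormS (dominated_nbhs QE (X : seminorm_space Q) eps2 FQ).
move=> Y /= YF SY.
have -> : Z * (Y - X) = (Z - F) * (Y - X) + F * (Y - X) by rewrite -mulrDl subrK.
have IZF : I (Z - F) by exact: (sym_idealB IN IZ IF).
have := sym_ideal_ler_normD IN (sym_idealMr IN (Y - X) IZF) (sym_idealMr IN (Y - X) IF).
move=> /le_lt_trans; apply; rewrite [ltRHS]splitr ltr_leD//; last exact: ltW.
rewrite (le_lt_trans (sym_ideal_norm_mulr IN _ IZF))//.
have YX : opnorm (Y - X) <= c + c.
  by rewrite (le_trans (opnormD _ _))// opnormN lerD// Sc.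
have ZF0 := sym_ideal_norm_ge0 IN IZF.
apply: (@le_lt_trans _ _ (N (Z - F) * (c + c))); first by rewrite ler_wpM2l.
move: ZF; rewrite ltr_pdivlMr ?ltr_wpDl ?addr_ge0//.
by move: ZF0; move: (N _) => a ? ?; nra.
Qed.

Lemma approximable_coincide I J N M (S : set (bop H)) :
  sym_ideal I N -> approximable I N -> sym_ideal J M -> approximable J M ->
  norm_bounded S ->
  coincide_on (opens_mu I N) (opens_mu J M) S /\
  coincide_on (opens_mu_star I N) (opens_mu_star J M) S.
Proof.
move=> IN Iapp JM Japp Sb.
have leftI := left_seminormsP IN; have leftJ := left_seminormsP JM.
have starI := star_seminormsP IN; have starJ := star_seminormsP JM.
split; apply: coincide_on_seminorms => //.
- by move=> _ X eps [Z IZ <-] SX eps0; exact: (@approximable_local_left I J N M).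
- by move=> _ X eps [Z IZ <-] SX eps0; exact: (@approximable_local_left J I M N).
- move=> _ X eps [[Z IZ <-]|[Z IZ <-]] SX eps0.
    by apply: (@approximable_local_left I J N M) => // p ?; left.
  by apply: (@approximable_local_right I J N M) => // p ?; right.
- move=> _ X eps [[Z IZ <-]|[Z IZ <-]] SX eps0.
    by apply: (@approximable_local_left J I M N) => // p ?; left.
  by apply: (@approximable_local_right J I M N) => // p ?; right.
Qed.

End multiplier_seminorms.

(** * Ideal quotients and the comparison of multiplier topologies *)

Section ideal_quotients.
Context {R : realType} {H : hilbertType R}.
Local Notation C := R[i].
Implicit Types (I J : set (bop H)) (N M : bop H -> R).
Implicit Types (X Y Z A B T : bop H) (x y u v e f : H) (K L : {fset H}).

(* Both inclusions use that X^* = A X B for some A and B, see adj_factor. *)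
Lemma ideal_quotient_comm I J N B :
  (forall X Y Z, I X -> I (Y * X * Z)) -> sym_ideal J N ->
  ideal_quotient I J B -> forall Z, J Z -> I (Z * B) /\ I (adj B * Z).
Proof.
move=> IM JN IJB; have [V [W BE]] := adj_factor B.
have Iadj X : I X -> I (adj X).
  by have [V' [W' ->]] := adj_factor X; exact: IM.
have left Z : J Z -> I (adj B * Z).
  move=> JZ; rewrite BE -mulrA -(mulr1 (V * B * _)) -(mulrA V); apply: IM.
  by apply: IJB; exact: (sym_idealMl JN _ JZ).
move=> Z JZ; split; last exact: left.
rewrite -[Z * B]adjK adjM; apply/Iadj/left.
exact: (sym_ideal_adj JN JZ).
Qed.

Lemma onbproj_opnorm K : finonb K -> opnorm (onbproj K) <= 1.
Proof. by move=> hK; apply: opnorm_le => // x; rewrite mul1r onbproj_le. Qed.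

Lemma onbprojMl K T : onbproj K * T = \sum_(e <- K) rk1 e (adj T e).
Proof. by rewrite mulr_suml; apply: eq_bigr => e _; rewrite rk1_mulr. Qed.

Lemma sn_ideal_seminorm I N : sn_ideal I N -> seminorm_on I N.
Proof.
move=> /sn_ideal_sym IN; split=> [X Y|a X]; first exact: sym_ideal_ler_normD.
exact: sym_ideal_normZ.
Qed.

Lemma sym_ideal_opnorm_le I N Z : sym_ideal I N -> I Z -> opnorm Z <= N Z.
Proof.
move=> IN IZ; apply: opnorm_le; first exact: (sym_ideal_norm_ge0 IN IZ).
by move=> x; exact: (sym_ideal_ge_rnorm IN x IZ).
Qed.

Lemma sn_ideal_uniform_boundedness I N : sn_ideal I N ->
  forall Q : set (bop H -> R), (forall q, Q q -> seminorm_on I q) ->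
  (forall q, Q q -> exists c : R, forall X, I X -> q X <= c * N X) ->
  (forall X, I X -> exists c : R, forall q, Q q -> q X <= c) ->
  exists2 c : R, 0 <= c & forall q X, Q q -> I X -> q X <= c * N X.
Proof.
move=> snI Q QI QN; have IN := sn_ideal_sym snI.
apply: uniform_boundedness => //.
- exact: (sym_ideal0 IN).
- exact: (sym_idealD IN).
- exact: (sym_idealZ IN).
- exact: sn_ideal_seminorm.
- exact: (sn_ideal_complete snI).
Qed.

(* A substitute for the closed graph theorem: the truncations of A Z B by finite
   basis projections are bounded in Z, hence uniformly so, and they converge to
   A Z B by approximability. *)
Lemma multiplication_bounded I J N M A B :
  sym_ideal I N -> approximable I N -> sn_ideal J M ->
  (forall Z, J Z -> I (A * Z * B)) ->
  exists2 c : R, 0 <= c & forall Z, J Z -> N (A * Z * B) <= c * M Z.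
Proof.
move=> IN Iapp snJ AB; have JM := sn_ideal_sym snJ.
have IQ K Z : J Z -> I (onbproj K * (A * Z * B)).
  by move=> JZ; apply: (sym_idealMl IN); exact: AB.
pose Q := [set fun Z => N (onbproj K * (A * Z * B)) | K in @finonb R H].
have [|||c c0 Qc] := sn_ideal_uniform_boundedness snJ (Q := Q).
- move=> _ [K hK <-]; split=> [X Z JX JZ|a Z JZ].
    rewrite mulrDr mulrDl mulrDr.
    by apply: (sym_ideal_ler_normD IN); exact: IQ.
  by rewrite bopMZ bopZM bopMZ (sym_ideal_normZ IN)//; exact: IQ.
(* A crude bound growing with K is enough here: a truncation is a sum of |K| rank-one operators,
   each of norm at most ||A|| ||Z|| ||B||. *)
- move=> _ [K hK <-]; exists ((size K)%:R * (opnorm A * opnorm B)) => Z JZ.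
  have /(sym_ideal_norm_sum IN) h : forall e, true -> I (rk1 e (adj (A * Z * B) e)).
    by move=> e _; exact: (sym_ideal_rk1 IN).
  rewrite onbprojMl (le_trans (h _))//.
  apply: (@le_trans _ _ (\sum_(e <- K) opnorm A * opnorm B * M Z)).
    rewrite big_seq [leRHS]big_seq ler_sum// => e eK.
    rewrite (sym_ideal_norm_rk1 IN) (rnorm_onb (hK e eK)) mul1r.
    rewrite (le_trans (le_opnorm_adj _ _))// (rnorm_onb (hK e eK)) mulr1.
    rewrite (le_trans (opnormM _ _))// [leRHS]mulrAC ler_wpM2r ?opnorm_ge0//.
    rewrite (le_trans (opnormM _ _))// ler_wpM2l ?opnorm_ge0//.
    exact: (sym_ideal_opnorm_le JM JZ).
  by rewrite big_const_seq count_predT iter_addr addr0 -[leRHS]mulrA [leRHS]mulr_natl.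
- move=> Z JZ; exists (N (A * Z * B)) => _ [K hK <-].
  have IZ := AB Z JZ; rewrite (le_trans (sym_ideal_norm_mull IN _ IZ))//.
  by rewrite ler_piMl ?onbproj_opnorm// (sym_ideal_norm_ge0 IN).
exists c => // Z JZ; have IZ := AB Z JZ; apply/ler_addgt0Pr => eps eps0.
have [K hK /(_ K hK (fsubset_refl K))[lt _]] := approximable_coproj IN Iapp IZ eps0.
rewrite -[X in N X](subrK (onbproj K * (A * Z * B))) addrC.
rewrite (le_trans (sym_ideal_ler_normD IN _ _))//; first exact: IQ.
  by apply: (sym_idealB IN) => //; exact: IQ.
apply: lerD; last exact: ltW.
by apply: (Qc (fun Z => N (onbproj K * (A * Z * B)))) => //; exists K.
Qed.

(** For Y = sum_i a_i b_i, right multiplication by b_i is bounded from J to I, so N (X a_i b_i) <=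
    c_i M (X a_i). *)
Lemma multiplier_coarser I J N M :
  sn_ideal I N -> approximable I N -> sn_ideal J M ->
  I `<=` ideal_product J (ideal_quotient I J) ->
  opens_mu I N `<=` opens_mu J M /\ opens_mu_star I N `<=` opens_mu_star J M.
Proof.
move=> snI Iapp snJ IJ; have IN := sn_ideal_sym snI; have JM := sn_ideal_sym snJ.
have IM X Y Z : I X -> I (Y * X * Z) by move=> IX; exact: (sym_idealM IN Y Z IX).
have leftP Y Q : seminorms Q -> left_seminorms J M `<=` Q -> I Y ->
    dominated Q (fun X => N (X * Y)).
  move=> QE JQ /IJ[n [a [b [Ja Jb ->]]]].
  have /choice[c cP] : forall i, exists c : R, 0 <= c /\
      forall Z, J Z -> N (Z * b i) <= c * M Z.
    move=> i; have [|c c0 h] := @multiplication_bounded I J N M 1 (b i) IN Iapp snJ.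
      by move=> Z JZ; rewrite mul1r; have [] := ideal_quotient_comm IM JM (Jb i) JZ.
    by exists c; split=> // Z /h; rewrite mul1r.
  apply: (@dominated_sum _ _ Q QE n _ (fun i X => M (X * a i)) c) => // [i|i|X].
  - by have [] := cP i.
  - by apply: JQ; exists (a i).
  have Iab i : I (X * (a i * b i)).
    rewrite mulrA.
    by have [] := ideal_quotient_comm IM JM (Jb i) (sym_idealMl JM X (Ja i)).
  rewrite mulr_sumr (le_trans (sym_ideal_norm_sum IN _ _))//.
  apply: ler_sum => i _; rewrite mulrA; have [_] := cP i; apply.
  exact: (sym_idealMl JM _ (Ja i)).
have rightP Y Q : seminorms Q -> right_seminorms J M `<=` Q -> I Y ->
    dominated Q (fun X => N (Y * X)).
  (* Factoring Y^* instead of Y puts the quotient elements on the left, Y = sum_i b_i^* a_i^*, as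
     the seminorms N (Y X) require. *)
  move=> QE JQ /(sym_ideal_adj IN) /IJ[n [a [b [Ja Jb YE]]]].
  have {YE}-> : Y = \sum_i adj (b i) * adj (a i).
    by rewrite -[Y]adjK YE adj_sum; apply: eq_bigr => i _; rewrite adjM.
  have Jaa i : J (adj (a i)) by exact: (sym_ideal_adj JM (Ja i)).
  have /choice[c cP] : forall i, exists c : R, 0 <= c /\
      forall Z, J Z -> N (adj (b i) * Z) <= c * M Z.
    move=> i; have [|c c0 h] := @multiplication_bounded I J N M (adj (b i)) 1 IN Iapp snJ.
      by move=> Z JZ; rewrite mulr1; have [] := ideal_quotient_comm IM JM (Jb i) JZ.
    by exists c; split=> // Z /h; rewrite mulr1.
  apply: (@dominated_sum _ _ Q QE n _ (fun i X => M (adj (a i) * X)) c) => // [i|i|X].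
  - by have [] := cP i.
  - by apply: JQ; exists (adj (a i)).
  have Iab i : I (adj (b i) * adj (a i) * X).
    rewrite -mulrA.
    by have [] := ideal_quotient_comm IM JM (Jb i) (sym_idealMr JM X (Jaa i)).
  rewrite mulr_suml (le_trans (sym_ideal_norm_sum IN _ _))//.
  apply: ler_sum => i _; rewrite -mulrA; have [_] := cP i; apply.
  exact: (sym_idealMr JM _ (Jaa i)).
have starJ := star_seminormsP JM.
split; apply: dominated_open_sub => //.
- exact: left_seminormsP.
- exact: left_seminormsP.
- by move=> _ [Y IY <-]; apply: leftP => //; exact: left_seminormsP.
- exact: star_seminormsP.
- move=> _ [[Y IY <-]|[Y IY <-]]; first by apply: leftP => // p ?; left.
  by apply: rightP => // p ?; right.
Qed.

(* By Douglas' lemma, Y = sum_i z_i W_i. *)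
Lemma sym_ideal_majorized J M n (z : 'I_n -> bop H) Y (c : R) : sym_ideal J M ->
  (forall i, J (z i)) -> 0 <= c ->
  (forall x, rnorm (adj Y x) <= c * \sum_i rnorm (adj (z i) x)) -> J Y.
Proof.
move=> JM Jz c0 Yz.
(* The constant converts the sum of norms into the square root s^(1/2) of the sum of squares: each
   of the n norms is at most s^(1/2). *)
have [||W WP _] := @douglas _ _ n (adj Y) (fun i => adj (z i)) ((c * n%:R) ^+ 2).
- exact: sqr_ge0.
- move=> x; set s := \sum_i _.
  have zs i : rnorm (adj (z i) x) <= Num.sqrt s.
    rewrite -[leLHS]ger0_norm ?rnorm_ge0// -sqrtr_sqr ler_wsqrtr//.
    by rewrite /s (bigD1 i)//= lerDl sumr_ge0// => j _; rewrite sqr_ge0.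
  have s0 : 0 <= s by apply: sumr_ge0 => j _; rewrite sqr_ge0.
  rewrite -[X in _ <= _ * X]sqr_sqrtr// -exprMn.
  rewrite ler_pXn2r ?nnegrE ?rnorm_ge0 ?mulr_ge0 ?sqrtr_ge0//.
  rewrite (le_trans (Yz x))// -mulrA ler_wpM2l//.
  apply: (@le_trans _ _ (\sum_(i < n) Num.sqrt s)); first exact: ler_sum.
  by rewrite sumr_const card_ord mulr_natl.
have -> : Y = \sum_i z i * W i.
  apply: bopP => y; apply: inner_eq => x.
  rewrite adjPr WP bop_sum inner_sumr; apply: eq_bigr => i _.
  by rewrite bopM [RHS]adjPr.
by apply: (sym_ideal_sum JM) => i _; exact: (sym_idealMr JM).
Qed.

(* Testing a domination of N (X Y) on rank-one operators X = rk1 x y whose x is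
   almost annihilated by the z_i leaves a bound of Y^* by the z_i^*; such x exist,
   since otherwise 1 would be in J. *)
Lemma multiplier_not_dominated I J N M :
  sym_ideal I N -> sym_ideal J M -> ~ (I `<=` J) ->
  ~ (opens_mu I N `<=` opens_mu_star J M).
Proof.
move=> IN JM IJ IJo; apply: IJ => Y IY.
have [J1|nJ1] := pselect (J 1); first by rewrite -[Y]mulr1; exact: (sym_idealMl JM _ J1).
have := open_sub_dominated (left_seminormsP IN) (star_seminormsP JM) IJo.
move=> /(_ _ (ex_intro2 _ _ Y IY erefl))[n [q [c [c0 Jq Yq]]]].
(* On [rk1 x y] a left seminorm equals the first summand and a right one the second, so the sum
   covers both kinds. *)
have /choice[z /all_and2[Jz zq]] : forall i, exists z, J z /\
    forall x y, q i (rk1 x y) <= rnorm x * rnorm (adj z y) + rnorm (z x) * rnorm y.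
  move=> i; case: (Jq i) => -[z Jz <-]; exists z; split=> // x y.
    by rewrite rk1_mulr (sym_ideal_norm_rk1 JM) lerDl mulr_ge0 ?rnorm_ge0.
  by rewrite mulr_rk1 (sym_ideal_norm_rk1 JM) lerDr mulr_ge0 ?rnorm_ge0.
have small (d : R) : 0 < d -> exists2 x, 0 < rnorm x & \sum_i rnorm (z i x) < d * rnorm x.
  move=> d0; apply: contrapT => h; apply: nJ1.
  apply: (@sym_ideal_majorized J M n (fun i => adj (z i)) 1 d^-1) => //.
  - by move=> i; exact: (sym_ideal_adj JM (Jz i)).
  - by rewrite invr_ge0 ltW.
  move=> x; rewrite -(adj_unique (T := 1) (S := 1))// bop1.
  under eq_bigr do rewrite adjK.
  have [x0|x0] := eqVneq (rnorm x) 0.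
    by rewrite x0 mulr_ge0 ?invr_ge0 ?(ltW d0)// sumr_ge0// => i _; rewrite rnorm_ge0.
  rewrite ler_pdivlMl// leNgt; apply/negP => lt; apply: h; exists x => //.
  by rewrite lt_neqAle eq_sym x0 rnorm_ge0.
apply: (@sym_ideal_majorized J M n z Y c) => // y.
apply/ler_addgt0Pr => eps eps0.
(* With this d the right seminorms contribute at most eps |x|, which survives division by |x| as
   eps. *)
have d0 : 0 < eps / (c * rnorm y + 1).
  by rewrite divr_gt0// ltr_wpDl// mulr_ge0 ?rnorm_ge0.
have [x x0 xz] := small _ d0.
rewrite -(ler_pM2l x0) -(sym_ideal_norm_rk1 IN) -rk1_mulr (le_trans (Yq _))//.
have : \sum_i q i (rk1 x y) <=
    rnorm x * \sum_i rnorm (adj (z i) y) + (\sum_i rnorm (z i x)) * rnorm y.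
  by rewrite mulr_sumr mulr_suml -big_split/= ler_sum// => i _; exact: zq.
move=> /(ler_wpM2l c0) /le_trans; apply.
rewrite mulrDr mulrDr mulrCA lerD2l mulrA.
apply: (@le_trans _ _ (c * (eps / (c * rnorm y + 1) * rnorm x) * rnorm y)).
  by rewrite ler_wpM2r ?rnorm_ge0// ler_wpM2l// ltW.
have D0 : 0 < c * rnorm y + 1 by rewrite ltr_wpDl// mulr_ge0 ?rnorm_ge0.
rewrite (_ : _ * _ * _ = rnorm x * eps * (c * rnorm y) / (c * rnorm y + 1)); last first.
  by field; rewrite gt_eqF.
rewrite ler_pdivrMr// ler_wpM2l ?lerDl// mulr_ge0 ?rnorm_ge0//.
exact: ltW.
Qed.

End ideal_quotients.

(** * Traces and duals *)

Section traces.
Context {R : realType} {H : hilbertType R}.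
Local Notation C := R[i].
Implicit Types (I J : set (bop H)) (N M : bop H -> R).
Implicit Types (X Y Z A B T : bop H) (x y u v e f : H) (K L : {fset H}).

Lemma finite_subsets_nearP (P : set (set H)) :
  finite_subsets_filter P <->
  exists2 K, finonb K & forall L, finonb L -> (K `<=` L)%fset -> P [set` L].
Proof.
split=> [[F0 [finF0 F0E] F0P]|[K hK KP]].
  exists (fset_set F0); first by rewrite /finonb fset_setK.
  move=> L hL KL; apply: F0P; split; first by split.
  by move=> e F0e; apply: (fsubsetP KL); rewrite in_fset_set// inE.
exists [set` K]; first by split.
move=> F [[finF FE] KF]; rewrite -(fset_setK finF); apply: KP.
  by rewrite /finonb fset_setK.
by apply/fsubsetP => e eK; rewrite in_fset_set// inE; exact: KF.
Qed.

#[local] Instance finite_subsets_proper : ProperFilter (@finite_subsets_filter R H).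
Proof.
apply: filter_from_proper; first apply: filter_from_filter.
- by exists set0; exact: fsets_set0.
- move=> F G [finF FE] [finG GE]; exists (F `|` G).
    by split; [rewrite finite_setU|move=> e [/FE|/GE]].
  by move=> K [KE KFG]; split; split=> // e ?; apply: KFG; [left|right].
- by move=> F Ffin; exists F; split.
Qed.

(** Unordered summation over [onb]: convergence along [finite_subsets_filter], unfolded to finite
    sets and real errors. *)
Definition net_cvg (g : H -> C) (l : C) : Prop := forall eps : R, 0 < eps ->
  exists2 K, finonb K & forall L, finonb L -> (K `<=` L)%fset ->
    rnorm (\sum_(e <- L) g e - l) < eps.

Lemma net_cvgD g g' l l' : net_cvg g l -> net_cvg g' l' ->
  net_cvg (fun e => g e + g' e) (l + l').
Proof.
move=> gl gl' eps eps0; have eps2 : 0 < eps / 2 by rewrite divr_gt0.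
have [K hK Kg] := gl _ eps2; have [K' hK' Kg'] := gl' _ eps2.
exists (K `|` K')%fset; first exact: finonbU.
move=> L hL; rewrite fsubUset => /andP[KL KL'].
rewrite big_split opprD addrACA (le_lt_trans (rnormD _ _))// [ltRHS]splitr.
by rewrite ltrD ?Kg ?Kg'.
Qed.

Lemma net_cvgZ a g l : net_cvg g l -> net_cvg (fun e => a * g e) (a * l).
Proof.
move=> gl eps eps0; have a1 : 0 < rnorm a + 1 by rewrite ltr_wpDl ?rnorm_ge0.
have [K hK Kg] := gl _ (divr_gt0 eps0 a1).
exists K => // L hL KL; rewrite -mulr_sumr -mulrBr rnormM.
have := Kg L hL KL; rewrite ltr_pdivlMr//; apply: le_lt_trans.
by rewrite mulrC ler_wpM2l ?rnorm_ge0// lerDl.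
Qed.

Lemma net_cvg_eq g g' l : g =1 g' -> net_cvg g l -> net_cvg g' l.
Proof. by move=> /funext ->. Qed.

Lemma net_cvg_le g l (c : R) : (forall K, finonb K -> rnorm (\sum_(e <- K) g e) <= c) ->
  net_cvg g l -> rnorm l <= c.
Proof.
move=> gc gl; apply/ler_addgt0Pr => eps eps0; have [K hK Kg] := gl _ eps0.
have := Kg K hK (fsubset_refl K); rewrite rnormB => /ltW h.
rewrite -(subrK (\sum_(e <- K) g e) l) (le_trans (rnormD _ _))// addrC lerD//.
exact: gc.
Qed.

Lemma net_cvg_nneg (h : H -> R) (c : R) : (forall e, 0 <= h e) ->
  (forall K, finonb K -> \sum_(e <- K) h e <= c) ->
  exists l : R, net_cvg (fun e => (h e)%:C) l%:C.
Proof.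
move=> h0 hc; pose A := [set \sum_(e <- K) h e | K in @finonb R H].
have A_sup : has_sup A.
  split; first by exists (\sum_(e <- fset0) h e), fset0 => //; exact: finonb0.
  by exists c => _ [K hK <-]; exact: hc.
exists (sup A) => eps eps0; have [_ [K hK <-] Kh] := sup_adherent eps0 A_sup.
exists K => // L hL KL.
rewrite -rmorph_sum /= -rmorphB rnorm_real.
have Lh : \sum_(e <- L) h e <= sup A by apply: ub_le_sup; [case: A_sup|exists L].
have KLh : \sum_(e <- K) h e <= \sum_(e <- L) h e.
  exact: ler_sum_fset.
by rewrite ltr_norml; lra.
Qed.

Lemma net_cvg_summable (g : H -> C) (c : R) :
  (forall K, finonb K -> \sum_(e <- K) rnorm (g e) <= c) -> exists l, net_cvg g l.
Proof.
move=> gc; have n0 e : 0 <= rnorm (g e) := rnorm_ge0 (g e).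
have absRe e : `|complex.Re (g e)| <= rnorm (g e).
  by rewrite -lecR rnormE normc_ge_Re.
have absIm e : `|complex.Im (g e)| <= rnorm (g e).
  rewrite -lecR rnormE normc_def lecR -sqrtr_sqr ler_wsqrtr//.
  by rewrite lerDr sqr_ge0.
(* Re g and Im g are written as (|g| + w) - |g|, a difference of nonnegative functions with bounded
   finite sums. *)
pose part (w : H -> R) e := rnorm (g e) + w e.
have cvg_part w : (forall e, `|w e| <= rnorm (g e)) ->
    exists l : R, net_cvg (fun e => (part w e)%:C) l%:C.
  move=> wg; apply: (@net_cvg_nneg _ (c + c)).
    by move=> e; have := wg e; rewrite ler_norml /part => /andP[? ?]; lra.
  move=> K hK; rewrite big_split /= lerD ?gc// (le_trans _ (gc K hK))// ler_sum// => e _.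
  by rewrite (le_trans (ler_norm _))// wg.
have [l gl] := net_cvg_nneg n0 gc.
have [a ga] := cvg_part _ absRe; have [b gb] := cvg_part _ absIm.
have gN := net_cvgZ (-1) gl.
exists ((a%:C + -1 * l%:C) + 'i * (b%:C + -1 * l%:C)).
apply: net_cvg_eq (net_cvgD (net_cvgD ga gN) (net_cvgZ 'i (net_cvgD gb gN))).
move=> e; rewrite /part; case: (g e) => x y; apply/eqP; rewrite eq_complex /=.
by apply/andP; split; apply/eqP; ring.
Qed.

Lemma net_cvg_trace T l : net_cvg (fun e => inner (T e) e) l -> trace T = l.
Proof.
move=> Tl; apply: (@cvg_lim C^o) => //.
apply/cvgrPdist_lt => eps eps0.
have [epsR eps0'] : eps = (complex.Re eps)%:C /\ 0 < complex.Re eps.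
  by case: eps eps0 => a b; rewrite ltcE /= => /andP[/eqP -> ->].
apply/finite_subsets_nearP; have [K hK KT] := Tl _ eps0'.
exists K => // L hL KL; rewrite fsbig_finite// set_fsetK -rnormE epsR ltcR rnormB.
exact: KT.
Qed.

Lemma trace_class_cvg T : trace_class T ->
  net_cvg (fun e => inner (T e) e) (trace T).
Proof.
move=> /trace_class_summable[c Tc]; have [l Tl] := net_cvg_summable Tc.
by rewrite (net_cvg_trace Tl).
Qed.

End traces.

Section dual.
Context {R : realType} {H : hilbertType R}.
Local Notation C := R[i].
Implicit Types (I J : set (bop H)) (N M : bop H -> R).
Implicit Types (X Y Z A B T : bop H) (x y u v e : H) (K L : {fset H}).

(** Riesz representation in the first argument, [riesz_range] for the identity, gives a bounded
    linear map v |-> z v; X is its adjoint. *)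
Lemma bounded_form_op (B : H -> H -> C) (c : R) : 0 <= c ->
  (forall v, scalar (B^~ v)) ->
  (forall a u v w, B u (a *: v + w) = a^*%C * B u v + B u w) ->
  (forall u v, rnorm (B u v) <= c * rnorm u * rnorm v) ->
  exists X, forall u v, B u v = inner (X u) v.
Proof.
move=> c0 Bl Br Bc.
have /choice[z zP] : forall v, exists z, (forall u, B u v = inner u z) /\
    rnorm z <= c * rnorm v.
  move=> v; have [||||z [zB _ zc]] :=
    @riesz_range R H H 1 (fun _ u => u) (B^~ v) ((c * rnorm v) ^+ 2).
  - by move=> _ a u w.
  - exact: Bl.
  - move=> u; rewrite big_ord1 -exprMn ler_pXn2r ?nnegrE ?mulr_ge0 ?rnorm_ge0//.
    by rewrite mulrAC Bc.
  - exact: sqr_ge0.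
  exists (z ord0); split=> [u|]; first by rewrite zB big_ord1.
  by move: zc; rewrite big_ord1 ler_pXn2r ?nnegrE ?mulr_ge0 ?rnorm_ge0.
have zl : linear z.
  move=> a v w; apply: inner_eq => u; have [<- _] := zP (a *: v + w).
  by rewrite Br innerDr innerZr; have [<- _] := zP v; have [<- _] := zP w.
pose Z := mkbop (conj zl (ex_intro _ c (fun v => (zP v).2))).
by exists (adj Z) => u v; rewrite -adjPr; have [] := zP v.
Qed.

(* X represents f on rank-one operators; it is trace class because the partial sums
   of the trace of |X| are values of f on a norm-bounded set, and f T is the limit
   of f (Q T), with Q a finite basis projection, which is a partial sum of the trace
   of T X. *)
Lemma dominated_trace_functional I N (f : bop H -> C) :
  sym_ideal I N -> approximable I N -> scalar f ->
  dominated (left_seminorms I N `|` right_seminorms I N) (fun T => rnorm (f T)) ->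
  trace_functionals f.
Proof.
move=> IN Iapp fl [n [q [c [c0 Pq fq]]]].
have fD X Y : f (X + Y) = f X + f Y by have := fl 1 X Y; rewrite scale1r mul1r.
have f0 : f 0 = 0 by apply: (addIr (f 0)); rewrite -fD !add0r.
have fZ a X : f (a *: X) = a * f X by have := fl a X 0; rewrite !addr0 f0 addr0.
have fB X Y : f (X - Y) = f X - f Y by rewrite -scaleN1r fD fZ mulN1r.
have fsum (s : seq H) (F : H -> bop H) : f (\sum_(e <- s) F e) = \sum_(e <- s) f (F e).
  by elim/big_rec2: _ => [|e a X _ <-]; rewrite ?f0 ?fD.
have [b b0 fb] : exists2 b : R, 0 <= b & forall T, rnorm (f T) <= b * opnorm T.
  have /choice[d dP] : forall i, exists d : R, 0 <= d /\ forall T, q i T <= d * opnorm T.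
    move=> i; case: (Pq i) => -[Y IY <-]; exists (N Y); split.
    - exact: (sym_ideal_norm_ge0 IN IY).
    - by move=> T; rewrite mulrC (sym_ideal_norm_mull IN).
    - exact: (sym_ideal_norm_ge0 IN IY).
    - by move=> T; exact: (sym_ideal_norm_mulr IN _ IY).
  exists (c * \sum_i d i).
    by rewrite mulr_ge0// sumr_ge0// => i _; have [] := dP i.
  move=> T; rewrite (le_trans (fq T))// -mulrA ler_wpM2l// mulr_suml ler_sum// => i _.
  by have [_] := dP i; apply.
have [X XE] : exists X, forall u v, f (rk1 u v) = inner (X u) v.
  apply: (@bounded_form_op (fun u v => f (rk1 u v)) b) => //.
  - by move=> v a u w; rewrite rk1Dl rk1Zl fD fZ.
  - by move=> a u v w; rewrite rk1Dr rk1Zr fD fZ.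
  - by move=> u v; rewrite -mulrA -opnorm_rk1; exact: fb.
exists X.
  have [P XP] := absolute_value_ex X; have [_ [V [_ PE _ V1]]] := polar XP.
  exists P => //; apply: (@le_lt_trans _ _ b%:E); last exact: ltry.
  apply/esum_onb_le => K hK; rewrite -Re_sum.
  (* Since P = V X, <P e, e> = <X e, V^* e> = f ([rk1 e (V^* e)]), and these rank-one operators add
     up to a contraction. *)
  have -> : \sum_(e <- K) inner (P e) e = f (onbproj K * V).
    rewrite onbprojMl fsum; apply: eq_bigr => e _.
    by rewrite XE PE bopM adjP.
  rewrite (le_trans (ler_Re_rnorm _))// (le_trans (fb _))// ler_piMr//.
  apply: opnorm_le => // x; rewrite mul1r bopM.
  by rewrite (le_trans (onbproj_le _ hK))// V1.
apply/funext => T; apply: net_cvg_trace => eps eps0.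
have c1 : 0 < c + 1 by rewrite ltr_wpDl.
have n1 : 0 < n%:R + 1 :> R by rewrite ltr_wpDl.
have T1 : 0 < opnorm T + 1 by rewrite ltr_wpDl ?opnorm_ge0.
pose d := eps / (c + 1) / (n%:R + 1).
have d0 : 0 < d by rewrite !divr_gt0.
have : finite_subsets_filter [set F | forall i, q i (T - onbproj (fset_set F) * T) < d].
  suff h i : finite_subsets_filter [set F | q i (T - onbproj (fset_set F) * T) < d].
    exact: (filter_forall (@finite_subsets_proper R H) h).
  apply/finite_subsets_nearP; case: (Pq i) => -[Y IY <-].
    (* For a left seminorm, T Y belongs to I and is itself truncated from the left; for a right one,
       Y is truncated from the right and T costs the factor ||T||. *)
    have [K hK KY] := approximable_coproj IN Iapp (sym_idealMl IN T IY) d0.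
    exists K => // L hL KL; rewrite /= set_fsetK mulrBl -mulrA.
    by have [] := KY L hL KL.
  have [K hK KY] := approximable_coproj IN Iapp IY (divr_gt0 d0 T1).
  exists K => // L hL KL; rewrite /= set_fsetK.
  have -> : Y * (T - onbproj L * T) = (Y - Y * onbproj L) * T.
    by rewrite mulrBr mulrBl mulrA.
  have IYL : I (Y - Y * onbproj L).
    by apply: (sym_idealB IN) => //; exact: (sym_idealMr IN).
  rewrite (le_lt_trans (sym_ideal_norm_mulr IN _ IYL))//.
  have [_] := KY L hL KL; rewrite ltr_pdivlMr//; apply: le_lt_trans.
  by rewrite ler_wpM2l ?lerDl// (sym_ideal_norm_ge0 IN).
move=> /finite_subsets_nearP[K hK KT]; exists K => // L hL KL.
have -> : \sum_(e <- L) inner ((T * X) e) e = f (onbproj L * T).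
  rewrite onbprojMl fsum; apply: eq_bigr => e _.
  by rewrite XE bopM adjP.
rewrite rnormB -fB (le_lt_trans (fq _))//.
apply: (@le_lt_trans _ _ (c * \sum_(i < n) d)).
  rewrite ler_wpM2l// ler_sum// => i _; have := KT L hL KL i; rewrite /= set_fsetK.
  exact: ltW.
rewrite sumr_const card_ord -(mulr_natl d) /d mulrA mulrA.
rewrite ltr_pdivrMr// mulrA ltr_pdivrMr// [ltLHS]mulrC -[ltRHS]mulrA ltr_pM2l//.
have : 0 <= n%:R :> R by [].
by nra.
Qed.

(** The partial traces of Y B are functionals of Y, each bounded on I. Absolute summability of the
    diagonal of Y B bounds them pointwise, so uniform boundedness replaces any estimate of trace
    norms. *)
Lemma trace_bounded I N B : sn_ideal I N ->
  (forall Y, I Y -> trace_class (Y * B)) ->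
  exists2 c : R, 0 <= c & forall Y K, I Y -> finonb K ->
    rnorm (\sum_(e <- K) inner ((Y * B) e) e) <= c * N Y.
Proof.
move=> snI IB; have IN := sn_ideal_sym snI.
pose q K := fun Y => rnorm (\sum_(e <- K) inner ((Y * B) e) e).
have [|||c c0 Qc] := sn_ideal_uniform_boundedness snI (Q := [set q K | K in @finonb R H]).
- move=> _ [K hK <-]; rewrite /q; split=> [X Y _ _|a X _].
    apply: le_trans (rnormD _ _); rewrite -big_split mulrDl le_eqVlt.
    apply/orP; left; apply/eqP; congr rnorm; apply: eq_bigr => e _.
    by rewrite bopD innerDl.
  rewrite bopZM -rnormM mulr_sumr; congr rnorm; apply: eq_bigr => e _.
  by rewrite bopZ innerZl.
- move=> _ [K hK <-]; exists (\sum_(e <- K) rnorm (B e)) => Y IY.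
  rewrite /q (le_trans (rnorm_sum _ _ _))// mulr_suml.
  rewrite big_seq [leRHS]big_seq ler_sum// => e eK.
  rewrite (le_trans (cauchy_schwarz _ _))// (rnorm_onb (hK e eK)) mulr1 bopM mulrC.
  exact: (sym_ideal_ge_rnorm IN _ IY).
- move=> Y IY; have [c Yc] := trace_class_summable (IB Y IY).
  by exists c => _ [K hK <-]; rewrite /q (le_trans (rnorm_sum _ _ _))// Yc.
exists c => // Y K IY hK; apply: (Qc (q K)) => //.
by exists K.
Qed.

Lemma multiplier_dual I N : sn_ideal I N -> approximable I N ->
  @trace_class R H = ideal_product I (ideal_quotient trace_class I) ->
  continuous_dual (mu I N) = trace_functionals /\
  continuous_dual (mu_star I N) = trace_functionals.
Proof.
move=> snI Iapp L1E; have IN := sn_ideal_sym snI.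
have leftE := left_seminormsP IN; have starE := star_seminormsP IN.
(* The ideal property of the trace class is read off from the factorization: Y and Z are absorbed by
   the factors in I and in the quotient. *)
have L1M X Y Z : trace_class X -> trace_class (Y * X * Z).
  rewrite L1E => -[n [a [b [Ia qb ->]]]].
  exists n, (fun i => Y * a i), (fun i => b i * Z); split=> [i|i|].
  - by apply: (sym_idealMl IN); exact: Ia.
  - by move=> W IW; rewrite -mulrA; apply: qb; exact: (sym_idealMl IN).
  - by rewrite mulr_sumr mulr_suml; apply: eq_bigr => i _; rewrite !mulrA.
have L1Ml X Y : trace_class X -> trace_class (Y * X).
  by move=> /(L1M X Y 1); rewrite mulr1.
have left_dominated X : trace_class X -> scalar (fun T => trace (T * X)) /\
    dominated (left_seminorms I N) (fun T => rnorm (trace (T * X))).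
  move=> L1X; split=> [a S T|].
    apply: net_cvg_trace.
    have trT Y := trace_class_cvg (L1Ml X Y L1X).
    apply: net_cvg_eq (net_cvgD (net_cvgZ a (trT S)) (trT T)).
    by move=> e; rewrite mulrDl bopZM bopD bopZ innerDl innerZl.
  move: (L1X); rewrite L1E => -[n [a [b [Ia qb XE]]]].
  have /choice[c cP] : forall i, exists c : R, 0 <= c /\ forall Y K, I Y -> finonb K ->
      rnorm (\sum_(e <- K) inner ((Y * b i) e) e) <= c * N Y.
    move=> i; have [|c c0 h] := @trace_bounded I N (b i) snI; last by exists c.
    by move=> Y IY; have [] := ideal_quotient_comm L1M IN (qb i) IY.
  apply: (@dominated_sum _ _ _ leftE n _ (fun i T => N (T * a i)) c) => [i|i|T].
  - by have [] := cP i.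
  - by exists (a i).
  (* It suffices to bound the partial traces of T X = sum_i (T a_i) b_i, to which [trace_bounded]
     applies term by term. *)
  apply: net_cvg_le (trace_class_cvg (L1Ml X T L1X)) => K hK.
  have -> : \sum_(e <- K) inner ((T * X) e) e =
      \sum_i \sum_(e <- K) inner ((T * a i * b i) e) e.
    rewrite exchange_big /=; apply: eq_bigr => e _.
    by rewrite XE bop_sum bop_sumr inner_suml.
  rewrite (le_trans (rnorm_sum _ _ _))// ler_sum// => i _.
  by have [_] := cP i; apply=> //; exact: (sym_idealMl IN).
split; apply/seteqP; split=> f.
- move=> /(continuous_dualP leftE)[fl [n [q [c [c0 Pq fq]]]]].
  apply: (dominated_trace_functional IN Iapp fl); exists n, q, c; split=> // i.
  by left.
- by move=> [X /left_dominated[fl fd] <-]; apply/(continuous_dualP leftE).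
- move=> /(continuous_dualP starE)[fl fd].
  exact: (dominated_trace_functional IN Iapp fl fd).
- move=> [X /left_dominated[fl [n [q [c [c0 Pq fq]]]]] <-].
  apply/(continuous_dualP starE).
  by split=> //; exists n, q, c; split=> // i; left.
Qed.

End dual.

Theorem theoremB (R : realType) (H : hilbertType R) :
  [/\ (* (1) *)
      forall (I : set (bop H)) (N : bop H -> R), sn_ideal I N ->
        forall A : set (bop H),
          (lc_bounded (mu I N) A <-> norm_bounded A) /\
          (lc_bounded (mu_star I N) A <-> norm_bounded A),
      (* (2) *)
      forall (I : set (bop H)) (N : bop H -> R),
        sn_ideal I N -> approximable I N ->
        forall S : set (bop H), norm_bounded S ->
          coincide_on (opens_mu I N)
                      (opens_mu hilbert_schmidt hs_norm) S /\
          coincide_on (opens_mu_star I N)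
                      (opens_mu_star hilbert_schmidt hs_norm) S,
      (* (3) *)
      forall (I : set (bop H)) (N : bop H -> R),
        sn_ideal I N -> approximable I N ->
        trace_class = ideal_product I (ideal_quotient trace_class I) ->
        continuous_dual (mu I N) = trace_functionals /\
        continuous_dual (mu_star I N) = trace_functionals,
      (* (4) *)
      forall (I J : set (bop H)) (N M : bop H -> R),
        sn_ideal I N -> approximable I N ->
        sn_ideal J M -> approximable J M ->
        I `<=` ideal_product J (ideal_quotient I J) ->
        opens_mu I N `<=` opens_mu J M /\
        opens_mu_star I N `<=` opens_mu_star J M &
      (* (5) *)
      forall (I J : set (bop H)) (N M : bop H -> R),
        sn_ideal I N -> approximable I N ->
        sn_ideal J M -> approximable J M ->
        ~ (I `<=` J) ->
        ~ (opens_mu I N `<=` opens_mu_star J M)].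
Proof.
split.
- move=> I N /sn_ideal_sym IN A.
  by split; apply: (multiplier_bounded IN) => // p ?; left.
- move=> I N /sn_ideal_sym IN Iapp S Sb.
  exact: approximable_coincide (hs_sym_ideal) (hs_approximable) Sb.
- by move=> I N; exact: multiplier_dual.
- by move=> I J N M snI Iapp snJ _; exact: multiplier_coarser.
- move=> I J N M /sn_ideal_sym IN _ /sn_ideal_sym JM _.
  exact: (multiplier_not_dominated IN JM).
Qed.
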